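(* Let $\mathbb{K}$ be a field and let $G$ be a finite, connected and simple graph with at least one edge. The toric ideal $I_G$ is generalized robust and generated by quadrics if and only if the following hold: $G$ has at most one non bipartite block; if $G$ has a non bipartite block, then this block is either a $K_4$, or a $K_{2,\ell}\cup\{e\}$, or a double-$K_{2,(r,s)}$ graph, or a necklace-$K_{2,\ell}$ graph; and every bipartite block of $G$ is either a $K_{2,\ell}$ (for some $\ell\geq 2$) or a cut edge.
   Context: Toric ideal of a graph: for a graph $G$ with vertices $v_1,\ldots,v_n$ and edges $e_1,\ldots,e_m$, associate to each edge $e=\{v_i,v_j\}$ the vector $a_e=\mathbf{v}_i+\mathbf{v}_j\in\mathbb{N}^n$, where $\mathbf{v}_i$ is the $i$-th canonical basis vector. For a monomial in $\mathbb{K}[e_1,\ldots,e_m]$ put $\deg_A(e_1^{u_1}\cdots e_m^{u_m})=\sum_k u_k a_{e_k}$. The toric ideal $I_G\subseteq\mathbb{K}[e_1,\ldots,e_m]$ is generated by all binomials $\mathbf{e}^{\mathbf{u}}-\mathbf{e}^{\mathbf{v}}$ with $\deg_A(\mathbf{e}^{\mathbf{u}})=\deg_A(\mathbf{e}^{\mathbf{v}})$. A quadric is a homogeneous polynomial of degree two; the zero ideal is generated by quadrics (empty generating set). Bases: a Markov basis of $I_G$ is a minimal generating set of $I_G$ consisting of binomials; the universal Markov basis is the union of all Markov bases; the universal Gröbner basis is the union of the reduced Gröbner bases over all monomial orders. Binomials are considered up to sign. $I_G$ is generalized robust if its universal Gröbner basis equals its universal Markov basis. Graphs: a cut edge (cut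 vertex) is an edge (vertex) whose removal increases the number of connected components; a graph is biconnected if it is connected and has no cut vertex; a block is a maximal biconnected subgraph. A block ''is a cut edge'' if it consists of a single edge and its two endpoints. $K_n$ is the complete graph on $n$ vertices and $K_{r,s}$ the complete bipartite graph with parts of sizes $r,s$; in $K_{2,\ell}$ one has $\ell\ge 2$. $K_{2,\ell}\cup\{e\}$ denotes a non bipartite graph obtained from $K_{2,\ell}$ by adding one edge $e$ joining two of its vertices. Double-$K_{2,(r,s)}$ graph ($r,s\geq 2$): let $G_1=K_{2,r}\cup\{e\}$ be non bipartite, where $e$ is an edge connecting two vertices of $K_{2,r}$, and let $G_2=K_{2,s}$. A double-$K_{2,(r,s)}$ is a graph obtained from $G_1$ and $G_2$ by identifying the edge $e$ of $G_1$ with any edge of $G_2$ (a 2-clique sum). Necklace-$K_{2,\ell}$ graph: a chain of bipartite blocks is a graph with bipartite blocks whose block tree is a path, where the block tree is the bipartite graph whose vertices are the blocks and the cut vertices, a block $B$ being adjacent to a cut vertex $u$ iff $u\in B$. Let $R$ be a bipartite graph consisting of a chain of blocks $B_1,\ldots,B_k$, $k\geq 2$, where each $B_i$ is either a $K_{2,n_i}$ with $n_i\geq 2$ or a cut edge of $R$. Let $x_1\in V(B_1)$ and $x_2\in V(B_k)$ be two non-adjacent vertices of $R$ at odd distance which are not cut vertices of $R$. A necklace-$K_{2,\ell}$ graph is the graph obtained from $R$ by identifying $x_1$ and $x_2$, i.e. the graph with vertex set $(V(R)\setminus\{x_1,x_2\})\cup\{x\}$ and edge set $E(R\setminus\{x_1,x_2\})\cup\{\{u,x\}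 : \{u,x_1\}\in E(R)\text{ or }\{u,x_2\}\in E(R)\}$. *)

(* Defs.v *)
From HB Require Import structures.
From mathcomp Require Import all_boot all_order all_algebra.
From mathcomp.multinomials Require Import mpoly.

Set Implicit Arguments.
Unset Strict Implicit.
Unset Printing Implicit Defensive.

Import GRing.Theory.

(* A finite simple graph is a set of vertices taken in an ambient finite type
   [V], together with a set of two-element subsets of it.  Keeping the vertex
   set separate from [V] makes subgraphs and vertex deletions live in the same
   type as the graph itself. *)
Definition is_graph (V : finType) (g : {set V} * {set {set V}}) : bool :=
  [forall f in g.2, (f \subset g.1) && (#|f| == 2)].

Record graph (V : finType) := Graph {
  graph_val : {set V} * {set {set V}};
  _ : is_graph graph_val }.

HB.instance Definition _ (V : finType) := [isSub for @graph_val V].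
HB.instance Definition _ (V : finType) := [Finite of graph V by <:].

Definition verts (V : finType) (G : graph V) : {set V} := (graph_val G).1.
Definition edges (V : finType) (G : graph V) : {set {set V}} :=
  (graph_val G).2.

Definition proper_edges (V : finType) (A : {set V}) (F : {set {set V}}) :
    {set {set V}} :=
  [set f in F | (f \subset A) && (#|f| == 2)].

Fact mk_graph_subproof (V : finType) (A : {set V}) (F : {set {set V}}) :
  is_graph (A, proper_edges A F).
Proof. by apply/forall_inP => f; rewrite inE => /andP[]. Qed.

(* The members of [F] that are not two-element subsets of [A] are dropped. *)
Definition mk_graph (V : finType) (A : {set V}) (F : {set {set V}}) : graph V :=
  Graph (mk_graph_subproof A F).

Definition adj (V : finType) (G : graph V) : rel V :=
  fun x y => [set x; y] \in edges G.

Definition subgraph (V : finType) (H G : graph V) : bool :=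
  (verts H \subset verts G) && (edges H \subset edges G).

Definition delete_vertices (V : finType) (G : graph V) (A : {set V}) :
    graph V :=
  mk_graph (verts G :\: A) (edges G).

Definition num_components (V : finType) (G : graph V) : nat :=
  n_comp (adj G) (verts G).

Definition connected (V : finType) (G : graph V) : bool :=
  (verts G != set0) &&
  [forall x in verts G, forall y in verts G, connect (adj G) x y].

Definition cut_vertex (V : finType) (G : graph V) (x : V) : bool :=
  (x \in verts G) &&
  (num_components G < num_components (delete_vertices G [set x])).

Definition biconnected (V : finType) (G : graph V) : bool :=
  connected G && [forall x, ~~ cut_vertex G x].

Definition is_block (V : finType) (G B : graph V) : bool :=
  [&& subgraph B G, biconnected B &
    [forall H : graph V,
      [&& subgraph B H, subgraph H G & biconnected H] ==> (H == B)]].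

Definition bipartite (V : finType) (G : graph V) : bool :=
  [exists A : {set V}, [forall f in edges G, #|f :&: A| == 1]].

Definition graph_iso (V W : finType) (G : graph V) (H : graph W) : Prop :=
  exists f : V -> W,
    [/\ {in verts G &, injective f},
        f @: verts G = verts H &
        [set f @: (e : {set V}) | e in edges G] = edges H].

Definition is_complete (V : finType) (n : nat) (G : graph V) : Prop :=
  #|verts G| = n /\
  edges G = [set f : {set V} | (f \subset verts G) && (#|f| == 2)].

Definition is_complete_bipartite (V : finType) (r s : nat) (G : graph V) :
    Prop :=
  exists A B : {set V},
    [/\ [disjoint A & B], A :|: B = verts G, #|A| = r, #|B| = s &
        edges G = [set [set x; y] | x in A, y in B]].

Definition is_K2 (V : finType) (l : nat) (G : graph V) : Prop :=
  2 <= l /\ is_complete_bipartite 2 l G.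

(* [G] is a non bipartite K_{2,l} u {e}; since [G] is simple and non bipartite
   while K_{2,l} is bipartite, [e] is a new edge. *)
Definition is_K2_plus (V : finType) (l : nat) (e : {set V}) (G : graph V) :
    Prop :=
  ~~ bipartite G /\
  exists H : graph V,
    [/\ is_K2 l H, verts G = verts H & edges G = e |: edges H].

Definition is_double_K2 (V : finType) (r s : nat) (G : graph V) : Prop :=
  exists (G1 G2 : graph V) (e : {set V}),
    [/\ is_K2_plus r e G1,
        is_K2 s G2 /\ e \in edges G2,
        verts G1 :&: verts G2 = e,
        verts G = verts G1 :|: verts G2 &
        edges G = edges G1 :|: edges G2].

(* A block "is a cut edge" when it consists of one edge and its endpoints. *)
Definition is_cut_edge_block (V : finType) (B : graph V) : Prop :=
  exists f : {set V}, verts B = f /\ edges B = [set f].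

Definition block_tree (V : finType) (G : graph V) : graph (graph V + V)%type :=
  mk_graph
    [set z | match z with
             | inl B => is_block G B
             | inr u => cut_vertex G u
             end]
    [set [set inl p.1; inr p.2] | p : graph V * V & p.2 \in verts p.1].

(* [G] is the path visiting the vertices in the order of [s]. *)
Definition is_path_along (V : finType) (G : graph V) (s : seq V) : Prop :=
  [/\ uniq s,
      verts G = [set x in s] &
      edges G = [set [set p.1; p.2] | p in zip s (behead s)]].

(* [bs] lists the blocks of the chain in the order of the path. *)
Definition chain_of_bipartite_blocks (V : finType) (G : graph V)
    (bs : seq (graph V)) : Prop :=
  (forall B, is_block G B -> bipartite B) /\
  exists s : seq (graph V + V)%type,
    is_path_along (block_tree G) s /\
    bs = pmap (fun z => if z is inl B then Some B else None) s.

Definition is_distance (V : finType) (G : graph V) (x y : V) (d : nat) : Prop :=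
  (exists p : seq V, [/\ path (adj G) x p, last x p = y & size p = d]) /\
  (forall p : seq V, path (adj G) x p -> last x p = y -> d <= size p).

(* The identification of [x1] and [x2]; [None] is the new vertex. *)
Definition identify (V : finType) (R : graph V) (x1 x2 : V) :
    graph (option V) :=
  mk_graph
    (None |: Some @: (verts R :\: [set x1; x2]))
    ([set Some @: (f : {set V})
        | f in edges (delete_vertices R [set x1; x2])]
     :|: [set [set Some u; None] | u : V & adj R u x1 || adj R u x2]).

Definition is_necklace_K2 (V : finType) (G : graph V) : Prop :=
  exists (W : finType) (R B1 Bk : graph W) (bs : seq (graph W)) (x1 x2 : W),
    let Bs := B1 :: rcons bs Bk in
    [/\ bipartite R /\ chain_of_bipartite_blocks R Bs,
        forall B, B \in Bs -> (exists n, is_K2 n B) \/ is_cut_edge_block B,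
        [/\ x1 \in verts B1, x2 \in verts Bk,
            ~~ cut_vertex R x1 & ~~ cut_vertex R x2],
        ~~ adj R x1 x2 /\ (exists d, is_distance R x1 x2 d /\ odd d) &
        graph_iso G (identify R x1 x2)].

Local Open Scope ring_scope.

Definition ideal_generated (R : comNzRingType) (S : R -> Prop) : R -> Prop :=
  fun p => exists (k : nat) (c g : 'I_k -> R),
    (forall i, S (g i)) /\ p = \sum_(i < k) c i * g i.

Definition generates (R : comNzRingType) (S I : R -> Prop) : Prop :=
  forall p, ideal_generated S p <-> I p.

Definition is_binomial (K : fieldType) (n : nat) (p : {mpoly K[n]}) : Prop :=
  exists u v : 'X_{1..n}, p = 'X_[u] - 'X_[v].

Definition markov_basis (K : fieldType) (n : nat)
    (I M : {mpoly K[n]} -> Prop) : Prop :=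
  [/\ forall p, M p -> is_binomial p,
      generates M I &
      forall M' : {mpoly K[n]} -> Prop,
        (forall p, M' p -> M p) -> generates M' I -> forall p, M p -> M' p].

Definition universal_markov_basis (K : fieldType) (n : nat)
    (I : {mpoly K[n]} -> Prop) : {mpoly K[n]} -> Prop :=
  fun p => exists M, markov_basis I M /\ M p.

Definition monomial_order (n : nat) (le : rel 'X_{1..n}) : Prop :=
  [/\ total le, antisymmetric le, transitive le,
      forall u, le 0%MM u &
      forall u v w, le u v -> le (u + w)%MM (v + w)%MM].

(* [u] is the leading monomial of the (nonzero) polynomial [p]. *)
Definition is_lead (K : fieldType) (n : nat) (le : rel 'X_{1..n})
    (p : {mpoly K[n]}) (u : 'X_{1..n}) : Prop :=
  u \in msupp p /\ forall v, v \in msupp p -> le v u.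

Definition initial_ideal (K : fieldType) (n : nat) (le : rel 'X_{1..n})
    (S : {mpoly K[n]} -> Prop) : {mpoly K[n]} -> Prop :=
  ideal_generated (fun q => exists p u, [/\ S p, is_lead le p u & q = 'X_[u]]).

Definition groebner_basis (K : fieldType) (n : nat) (le : rel 'X_{1..n})
    (I : {mpoly K[n]} -> Prop) (B : seq {mpoly K[n]}) : Prop :=
  (forall p, p \in B -> I p) /\
  (forall q, initial_ideal le (fun p => p \in B) q <-> initial_ideal le I q).

Definition reduced_groebner_basis (K : fieldType) (n : nat)
    (le : rel 'X_{1..n}) (I : {mpoly K[n]} -> Prop) (B : seq {mpoly K[n]}) :
    Prop :=
  [/\ groebner_basis le I B,
      forall p, p \in B -> exists u, is_lead le p u /\ p@_u = 1 &
      forall p v, p \in B -> v \in msupp p ->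
        ~ initial_ideal le (fun q => q \in B /\ q <> p) 'X_[v]].

Definition universal_groebner_basis (K : fieldType) (n : nat)
    (I : {mpoly K[n]} -> Prop) : {mpoly K[n]} -> Prop :=
  fun p => exists le B,
    [/\ monomial_order le, reduced_groebner_basis le I B & p \in B].

Definition up_to_sign (R : comNzRingType) (S : R -> Prop) : R -> Prop :=
  fun p => S p \/ S (- p).

Definition generalized_robust (K : fieldType) (n : nat)
    (I : {mpoly K[n]} -> Prop) : Prop :=
  forall p, up_to_sign (universal_groebner_basis I) p <->
            up_to_sign (universal_markov_basis I) p.

Definition generated_by_quadrics (K : fieldType) (n : nat)
    (I : {mpoly K[n]} -> Prop) : Prop :=
  exists Q : {mpoly K[n]} -> Prop,
    (forall q, Q q -> q \is 2.-homog) /\ generates Q I.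

(* The variable of index [k] stands for the edge [enum_val k]; the coordinate
   at [x] of the vector of an edge is 1 if [x] is an endpoint, else 0. *)
Definition degA (V : finType) (G : graph V) (u : 'X_{1..#|edges G|}) :
    {ffun V -> nat} :=
  [ffun x => (\sum_(k < #|edges G|) u k * (x \in enum_val k))%N].

Definition toric_ideal (K : fieldType) (V : finType) (G : graph V) :
    {mpoly K[#|edges G|]} -> Prop :=
  ideal_generated (fun p => exists u v : 'X_{1..#|edges G|},
    degA u = degA v /\ p = 'X_[u] - 'X_[v]).

(* Main.v *)
Require Import Defs.
From mathcomp Require Import all_boot.
From mathcomp Require Import zify.

Set Implicit Arguments.
Unset Strict Implicit.
Unset Printing Implicit Defensive.

(** Both sides of the equivalence say the same about the cycles of [G]: every
    even cycle has length four, and any two odd cycles have two common vertices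
    ([good_cycles]).

    Let the ideal be generalized robust and generated by quadrics. A minimal
    generating set of binomials then consists of quadrics ([markov_quadric]), so
    all reduced Groebner bases do. In an order where the variables outside a
    given set of edges weigh more than those inside, this shows that a
    nontrivial relation between monomials in these edges brings along a quadric
    relation in the same edges ([robust_quadric_in_support]), which amounts to a
    four-cycle ([quadric_four_cycle]). Such a relation comes from any closed
    walk of even length that uses some edge an odd number of times
    ([closed_walk_relation]). But the walk around an even cycle of length other
    than four contains no four-cycle, nor does the walk around two odd cycles
    with at most one common vertex and back and forth along a path joining them
    ([good_cycles_of_walks]).

    Conversely, let the cycles be good, and let two distinct monomials have the
    same degree. Colour the edges according to the monomial in which they have
    the larger exponent. A walk with alternating colours never gets stuck, and
    goodness makes it close up to an alternating four-cycle
    ([alternating_square_exists]). Hence every relation contains conformally a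
    quadric one ([conformal_quadric]). It follows that every reduced Groebner
    basis consists of quadric binomials, and that every quadric binomial of the
    ideal occurs in a reduced Groebner basis and in a Markov basis
    ([reduced_basis_quadric], [quadric_universal_groebner],
    [quadric_universal_markov], [conformal_robust]).

    The rest is graph theory ([good_cycles_iff_blocks]). Cycles lie in blocks,
    and two odd cycles with two common vertices lie in the same block, so a
    single block has to be described. A bipartite one with all cycles of length
    four is an edge or a [K_{2,l}], as an ear of a maximal [K_{2,l}] would
    create a longer cycle or a larger [K_{2,l}] ([maximal_K2_spans],
    [bipartite_block_shape]). If a vertex [x] of a non bipartite one lies on all
    its odd cycles, the other vertices can be coloured, and [x] can be split
    into two vertices that receive its neighbours of either colour; the result
    is a bipartite graph whose block tree is a path ([two_ended_chain]), so the
    block is a necklace ([split_necklace]). If there is no such vertex, each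
    vertex of a shortest odd cycle has a twin ([twin]), and the twins force a
    [K_4] ([no_apex_K4]). In the other direction, the parities of the paths
    between the two vertices where the pieces are glued show that the graphs of
    the list have good cycles ([two_sum_good], [identify_good]). *)

(** * Adjacency, subgraphs and induced subgraphs *)

Lemma edgeP (V : finType) (G : graph V) (f : {set V}) :
  f \in edges G -> f \subset verts G /\ #|f| = 2.
Proof.
case: G => [[A F] /= H]; rewrite /edges /verts /= => fF.
by move/forall_inP/(_ f fF)/andP: H => [-> /eqP].
Qed.

Lemma adjC (V : finType) (G : graph V) : symmetric (adj G).
Proof. by move=> x y; rewrite /adj setUC. Qed.

Lemma adj_neq (V : finType) (G : graph V) x y : adj G x y -> x != y.
Proof.
by move/edgeP=> [_]; rewrite cards2; case: (x == y).
Qed.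

Lemma adj_irr (V : finType) (G : graph V) x : adj G x x = false.
Proof. by apply/negP => /adj_neq; rewrite eqxx. Qed.

Lemma adj_vl (V : finType) (G : graph V) x y : adj G x y -> x \in verts G.
Proof. by move/edgeP=> [/subsetP + _]; apply; rewrite !inE eqxx. Qed.

Lemma adj_vr (V : finType) (G : graph V) x y : adj G x y -> y \in verts G.
Proof. by rewrite adjC; apply: adj_vl. Qed.

Lemma edge_adj (V : finType) (G : graph V) f :
  f \in edges G -> exists x y, f = [set x; y] /\ adj G x y.
Proof.
move=> fG; have [_ /eqP/cards2P [x [y [_ fE]]]] := edgeP fG.
by exists x, y; split=> //; rewrite /adj -fE.
Qed.

Lemma graph_eq (V : finType) (G H : graph V) :
  verts G = verts H -> edges G = edges H -> G = H.
Proof.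
move=> e1 e2; apply: val_inj; case: G H e1 e2 => [[A F] ?] [[A' F'] ?] /=.
by rewrite /verts /edges /= => -> ->.
Qed.

Lemma subgraph_refl (V : finType) (G : graph V) : subgraph G G.
Proof. by rewrite /subgraph !subxx. Qed.

Lemma subgraph_trans (V : finType) (F G H : graph V) :
  subgraph F G -> subgraph G H -> subgraph F H.
Proof.
move=> /andP[a b] /andP[c d]; apply/andP; split.
  exact: subset_trans a c.
exact: subset_trans b d.
Qed.

Lemma subgraph_adj (V : finType) (H G : graph V) x y :
  subgraph H G -> adj H x y -> adj G x y.
Proof. by move=> /andP[_ /subsetP + ]; apply. Qed.

Lemma subgraph_vert (V : finType) (H G : graph V) x :
  subgraph H G -> x \in verts H -> x \in verts G.
Proof. by move=> /andP[/subsetP + _]; apply. Qed.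

Lemma subgraphI (V : finType) (H G : graph V) :
  (forall x, x \in verts H -> x \in verts G) ->
  (forall x y, adj H x y -> adj G x y) -> subgraph H G.
Proof.
move=> a b; apply/andP; split; first exact/subsetP.
by apply/subsetP => f /edge_adj [x [y [-> /b]]].
Qed.

Lemma subgraph_anti (V : finType) (H G : graph V) :
  subgraph H G -> subgraph G H -> H = G.
Proof.
move=> /andP[a b] /andP[c d].
by apply: graph_eq; apply/eqP; rewrite eqEsubset ?a ?b ?c ?d.
Qed.

Definition induced (V : finType) (G : graph V) (A : {set V}) : graph V :=
  mk_graph A (edges G).

Lemma adj_induced (V : finType) (G : graph V) (A : {set V}) x y :
  adj (induced G A) x y = [&& x \in A, y \in A & adj G x y].
Proof.
rewrite {1}/adj /edges /= inE subUset !sub1set andbA -!andbA.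
rewrite [X in _ = _ && (_ && X)]/adj.
case: (boolP ([set x; y] \in edges G)) => [h|]; rewrite ?andbF //=.
by have [_ ->] := edgeP h; rewrite eqxx andbT.
Qed.

Lemma subgraph_induced (V : finType) (G : graph V) (A : {set V}) :
  A \subset verts G -> subgraph (induced G A) G.
Proof.
move=> AG; apply: subgraphI => [x /(subsetP AG)//|x y].
by rewrite adj_induced => /and3P[].
Qed.

(** Deleting one vertex is a restriction of the adjacency relation; working
    with this relation avoids building the graph with the vertex removed. *)
Definition off (V : finType) (e : rel V) (u : V) : rel V :=
  [rel x y | [&& x != u, y != u & e x y]].

Lemma adj_delete (V : finType) (G : graph V) (u : V) :
  adj (delete_vertices G [set u]) =2 off (adj G) u.
Proof.
move=> x y; rewrite adj_induced !inE /off /=.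
case h: (adj G x y); rewrite ?andbF //.
by rewrite (adj_vl h) (adj_vr h) !andbT.
Qed.

Lemma off_sym (V : finType) (e : rel V) u : symmetric e -> symmetric (off e u).
Proof. by move=> s x y; rewrite /off /= s andbCA. Qed.

Lemma connect_symG (V : finType) (G : graph V) : connect_sym (adj G).
Proof. by apply: sym_connect_sym; apply: adjC. Qed.

Lemma connect_symO (V : finType) (G : graph V) u :
  connect_sym (off (adj G) u).
Proof. by apply: sym_connect_sym; apply: off_sym; apply: adjC. Qed.

Lemma connect_mono (V : finType) (e e' : rel V) x y :
  subrel e e' -> connect e x y -> connect e' x y.
Proof.
by move=> s; apply: connect_sub => a b /s; apply: connect1.
Qed.

Lemma off_sub (V : finType) (e : rel V) u : subrel (off e u) e.
Proof. by move=> x y /and3P[]. Qed.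

Lemma connect_verts (V : finType) (G : graph V) x y :
  connect (adj G) x y -> x \in verts G -> y \in verts G.
Proof.
move=> /connectP [p]; elim: p x => [|z p IH] x /= => [_ ->//|].
by move=> /andP[xz zp] l _; apply: (IH z) => //; apply: adj_vr xz.
Qed.

Lemma connect_off_neq (V : finType) (e : rel V) u x y :
  connect (off e u) x y -> x != u -> y != u.
Proof.
move=> /connectP [p]; elim: p x => [|z p IH] x /= => [_ ->//|].
by move=> /andP[/and3P[_ zu _] zp] l _; apply: (IH z).
Qed.

Lemma connectedP (V : finType) (G : graph V) :
  reflect (verts G != set0 /\
           (forall x y, x \in verts G -> y \in verts G ->
              connect (adj G) x y))
          (connected G).
Proof.
apply: (iffP andP) => [[a /forall_inP b]|[a b]]; split=> //.
  by move=> x y xG yG; move/forall_inP: (b x xG); apply.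
by apply/forall_inP => x xG; apply/forall_inP => y; apply: b.
Qed.

Lemma n_comp_le1 (V : finType) (e : rel V) (a : {pred V}) :
  connect_sym e -> closed e a ->
  (n_comp e a <= 1) = [forall x in a, forall y in a, connect e x y].
Proof.
move=> es ca; rewrite /n_comp_mem; apply/idP/forall_inP.
  move=> /card_le1_eqP h x xa; apply/forall_inP => y ya.
  have ra z : z \in a -> root e z \in predI (mem (roots e)) (mem a).
    move=> za; rewrite !inE (roots_root es) /=.
    by rewrite -(closed_connect ca (connect_root e z)).
  by apply/(rootP es); apply: h; apply: ra.
move=> h; apply/card_le1_eqP => x y.
rewrite !inE => /andP[/eqP rx xa] /andP[/eqP ry ya].
rewrite -rx -ry; apply/(rootP es); by move/forall_inP: (h y ya); apply.
Qed.

Lemma num_components_connected (V : finType) (G : graph V) :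
  connected G -> num_components G = 1.
Proof.
move=> /connectedP [/set0Pn [x xG] c].
apply/eqP; rewrite eqn_leq; apply/andP; split.
  rewrite /num_components n_comp_le1; last first.
  - by apply: (intro_closed (connect_symG G)) => a b /adj_vr.
  - exact: connect_symG.
  by apply/forall_inP => y yG; apply/forall_inP => z zG; apply: c.
rewrite /num_components /n_comp_mem; apply/card_gt0P; exists (root (adj G) x).
rewrite !inE (roots_root (connect_symG G)) /=.
by apply: connect_verts (connect_root _ _) xG.
Qed.

(** A connected graph has one component, so the number of components grows
    exactly when the remaining vertices are not all connected to each other. *)
Lemma cut_vertexPn (V : finType) (G : graph V) u : connected G ->
  reflect (forall x y, x \in verts G -> y \in verts G -> x != u -> y != u ->
             connect (off (adj G) u) x y)
          (~~ cut_vertex G u).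
Proof.
move=> cG; rewrite /cut_vertex (num_components_connected cG).
case: (boolP (u \in verts G)) => [uG|uG] /=; last first.
  apply: ReflectT => x y xG yG xu yu.
  have /connectedP [_ /(_ _ _ xG yG)] := cG.
  apply: connect_mono => a b ab; rewrite /off /= ab andbT.
  rewrite -(eq_sym u) -(eq_sym u).
  by apply/andP; split; apply: contraNneq uG => ->;
     [apply: adj_vl ab | apply: adj_vr ab].
rewrite -leqNgt /num_components n_comp_le1; last first.
- by apply: (intro_closed (connect_symG _)) => a b /adj_vr.
- exact: connect_symG.
apply: (iffP forall_inP) => h x.
  move=> y xG yG xu yu.
  rewrite -(eq_connect (adj_delete G u)).
  have D z : z \in verts G -> z != u ->
      z \in verts (delete_vertices G [set u]).
    by move=> zG zu; rewrite !inE zu.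
  by move/forall_inP: (h x (D x xG xu)); apply; apply: D.
rewrite !inE => /andP[xu xG]; apply/forall_inP => y.
rewrite !inE => /andP[yu yG]; rewrite (eq_connect (adj_delete G u)).
exact: h.
Qed.

Lemma biconnectedP (V : finType) (G : graph V) :
  reflect (connected G /\
    forall u x y, x \in verts G -> y \in verts G -> x != u -> y != u ->
      connect (off (adj G) u) x y)
    (biconnected G).
Proof.
apply: (iffP andP) => [[c /forallP h]|[c h]]; split=> //.
  by move=> u; apply/cut_vertexPn.
by apply/forallP => u; apply/cut_vertexPn => //; apply: h.
Qed.

(** * Cycles, unions of biconnected graphs, blocks *)

Lemma connect_path (V : finType) (e : rel V) x p y z : connect_sym e ->
  path e x p -> y \in x :: p -> z \in x :: p -> connect e y z.
Proof.
move=> es xp yp zp; apply: (@connect_trans _ _ x).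
  by rewrite es; apply: (path_connect xp).
exact: (path_connect xp).
Qed.

Lemma ucycle_sub (V : finType) (e e' : rel V) c : subrel e e' ->
  ucycle e c -> ucycle e' c.
Proof. by move=> s /andP[a b]; rewrite /ucycle b andbT; apply: sub_cycle a. Qed.

Lemma ucycle_rot (V : finType) (e : rel V) n c :
  ucycle e (rot n c) = ucycle e c.
Proof. by rewrite /ucycle rot_cycle rot_uniq. Qed.

Lemma cycle_verts (V : finType) (G : graph V) c x :
  1 < size c -> cycle (adj G) c -> x \in c -> x \in verts G.
Proof.
move=> s2 cc xc; case/rot_to: xc cc s2 => i c' cE.
rewrite -(rot_cycle i) -(size_rot i) cE; case: c' {cE} => //= y c' /andP[xy _] _.
exact: adj_vl xy.
Qed.

(** Removing one vertex from a Hamiltonian cycle leaves a path through all the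
    others. *)
Lemma cycle_biconnected (V : finType) (G : graph V) c :
  c != [::] -> ucycle (adj G) c -> biconnected (induced G [set x in c]).
Proof.
move=> cn0 /andP[cc uc]; set H := induced G _.
have [z [d cE]] : exists z d, c = z :: d.
  by case: (c) cn0 => // z d _; exists z, d.
have HE x y : x \in c -> y \in c -> adj G x y -> adj H x y.
  by move=> xc yc xy; rewrite adj_induced !inE xc yc.
have conn x y : x \in c -> y \in c -> connect (adj H) x y.
  move: cc; rewrite {1}cE /= rcons_path => /andP[zc _] xc yc.
  have zp : path (adj H) z d.
    apply: (@sub_in_path _ (mem c) (adj G)) zc => [a b ac bc|]; first exact: HE.
    by rewrite cE; apply/allP.
  by apply: (connect_path (connect_symG H) zp); rewrite -cE.
apply/biconnectedP; split.
  apply/connectedP; split; last by move=> x y; rewrite !inE; apply: conn.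
  by apply/set0Pn; exists z; rewrite !inE cE inE eqxx.
move=> u x y; rewrite !inE => xc yc xu yu.
have [uc'|uc'] := boolP (u \in c); last first.
  apply: connect_mono (conn _ _ xc yc) => a b ab; rewrite /off /= ab andbT.
  have := adj_vl ab; have := adj_vr ab; rewrite !inE => bc ac.
  by apply/andP; split; apply: contraNneq uc' => <-.
case/rot_to: (uc') => i {cE}d dE.
have : uniq (u :: d) by rewrite -dE rot_uniq.
move: (cc); rewrite -(rot_cycle i) dE /=; rewrite rcons_path => /andP[ud _].
move=> /andP[und _].
have memd w : w \in c -> w != u -> w \in d.
  by rewrite -(mem_rot i) dE inE => /orP[->|].
case: d dE ud und memd => [|v d] dE /= ud und memd.
  by have := memd _ xc xu.
case/andP: ud => _ vd.
have vp : path (off (adj H) u) v d.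
  apply: (@sub_in_path _ (mem (v :: d)) (adj G)) vd; last exact/allP.
  move=> a b ad bd ab; rewrite /off /=.
  have mc w : w \in v :: d -> w \in c /\ w != u.
    move=> wd; split; last by apply: contraNneq und => <-.
    by rewrite -(mem_rot i) dE inE wd orbT.
  have [a1 ->] := mc _ ad; have [b1 ->] := mc _ bd.
  by rewrite HE.
by apply: (connect_path (connect_symO H u) vp); apply: memd.
Qed.

Definition union_graph (V : finType) (H K : graph V) : graph V :=
  mk_graph (verts H :|: verts K) (edges H :|: edges K).

Lemma adj_union (V : finType) (H K : graph V) x y :
  adj (union_graph H K) x y = adj H x y || adj K x y.
Proof.
rewrite {1}/adj /edges /= !inE -/(edges H) -/(edges K) -/(adj H x y) -/(adj K x y).
apply: andb_idr => /orP h; apply/andP; split.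
  by case: h => /edgeP [h _]; rewrite subsetU ?h ?orbT.
by case: h => /edgeP [_ ->].
Qed.

Lemma union_subl (V : finType) (H K : graph V) : subgraph H (union_graph H K).
Proof.
apply: subgraphI => [x xH|x y xy]; first by rewrite !inE xH.
by rewrite adj_union xy.
Qed.

Lemma union_subr (V : finType) (H K : graph V) : subgraph K (union_graph H K).
Proof.
apply: subgraphI => [x xH|x y xy]; first by rewrite !inE xH orbT.
by rewrite adj_union xy orbT.
Qed.

Lemma union_sub (V : finType) (H K G : graph V) :
  subgraph H G -> subgraph K G -> subgraph (union_graph H K) G.
Proof.
move=> a b; apply: subgraphI => [x|x y].
  by rewrite !inE => /orP[]; apply: subgraph_vert.
by rewrite adj_union => /orP[]; apply: subgraph_adj.
Qed.

(** Two common vertices suffice: after the removal of any vertex one of them is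
    left and still links the two parts. *)
Lemma union_biconnected (V : finType) (H K : graph V) s t :
  biconnected H -> biconnected K -> s != t ->
  s \in verts H -> s \in verts K -> t \in verts H -> t \in verts K ->
  biconnected (union_graph H K).
Proof.
move=> /biconnectedP [cH bH] /biconnectedP [cK bK] st sH sK tH tK.
set U := union_graph H K.
have sub e e' u : subrel e e' -> @subrel V (off e u) (off e' u).
  by move=> s' a b /and3P[h1 h2 /s' h3]; apply/and3P.
have aH : subrel (adj H) (adj U) by move=> a b ab; rewrite adj_union ab.
have aK : subrel (adj K) (adj U) by move=> a b ab; rewrite adj_union ab orbT.
have /connectedP [n0 cH'] := cH; have /connectedP [_ cK'] := cK.
apply/biconnectedP; split.
  apply/connectedP; split.
    by apply/set0Pn; exists s; rewrite !inE sH.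
  have cs x : x \in verts U -> connect (adj U) s x.
    rewrite !inE => /orP[xH|xK].
      exact: connect_mono aH (cH' _ _ sH xH).
    exact: connect_mono aK (cK' _ _ sK xK).
  move=> x y xU yU; apply: (@connect_trans _ _ s); last exact: cs.
  by rewrite connect_symG; apply: cs.
move=> u.
have [w [wu wH wK]] : exists w, [/\ w != u, w \in verts H & w \in verts K].
  by have [su|] := eqVneq s u; [exists t; rewrite -su eq_sym|exists s].
have cs x : x \in verts U -> x != u -> connect (off (adj U) u) w x.
  rewrite !inE => /orP[xH|xK] xu.
    exact: connect_mono (sub _ _ _ aH) (bH _ _ _ wH xH wu xu).
  exact: connect_mono (sub _ _ _ aK) (bK _ _ _ wK xK wu xu).
move=> x y xU yU xu yu; apply: (@connect_trans _ _ w); last exact: cs.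
by rewrite connect_symO; apply: cs.
Qed.

Lemma block_bicon (V : finType) (G B : graph V) :
  is_block G B -> biconnected B.
Proof. by case/and3P. Qed.

Lemma block_sub (V : finType) (G B : graph V) : is_block G B -> subgraph B G.
Proof. by case/and3P. Qed.

Lemma block_max (V : finType) (G B H : graph V) : is_block G B ->
  subgraph B H -> subgraph H G -> biconnected H -> H = B.
Proof.
by case/and3P=> _ _ /forallP/(_ H) /implyP h a b c; apply/eqP/h/and3P.
Qed.

Lemma block_exists (V : finType) (G H : graph V) :
  biconnected H -> subgraph H G ->
  exists B, is_block G B /\ subgraph H B.
Proof.
move=> bH sH.
pose P (B : graph V) := [&& subgraph H B, subgraph B G & biconnected B].
have PH : P H by rewrite /P subgraph_refl sH bH.
case: (arg_maxnP (fun B : graph V => #|verts B| + #|edges B|) PH) => B.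
move=> /and3P[HB BG bB] mx; exists B; split=> //.
rewrite /is_block BG bB /=; apply/forallP => K; apply/implyP => /and3P[BK KG bK].
have /mx : P K by rewrite /P (subgraph_trans HB BK) KG bK.
case/andP: BK => vs es.
move: (subset_leq_card vs) (subset_leq_card es) => c1 c2 c3.
apply/eqP/graph_eq; apply/eqP; rewrite eq_sym eqEcard ?vs ?es /=.
- rewrite -(leq_add2r #|edges B|); apply: leq_trans c3.
  by rewrite leq_add2l.
- rewrite -(leq_add2l #|verts B|); apply: leq_trans c3.
  by rewrite leq_add2r.
Qed.

(** By maximality [B] is equal to its union with [H]. *)
Lemma block_absorb (V : finType) (G B H : graph V) s t :
  is_block G B -> biconnected H -> subgraph H G -> s != t ->
  s \in verts B -> s \in verts H -> t \in verts B -> t \in verts H ->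
  subgraph H B.
Proof.
move=> bB bH HG st sB sH tB tH.
rewrite -(block_max bB (union_subl B H)); first exact: union_subr.
  by apply: union_sub => //; apply: block_sub.
exact: union_biconnected (block_bicon bB) bH st sB sH tB tH.
Qed.

Lemma block_eq (V : finType) (G B B' : graph V) s t :
  is_block G B -> is_block G B' -> s != t ->
  s \in verts B -> s \in verts B' -> t \in verts B -> t \in verts B' ->
  B = B'.
Proof.
move=> bB bB' st sB sB' tB tB'; apply: subgraph_anti.
  by apply: block_absorb bB' (block_bicon bB) (block_sub bB) st _ _ _ _.
by apply: block_absorb bB (block_bicon bB') (block_sub bB') st _ _ _ _.
Qed.

Lemma cycle_in_block (V : finType) (G : graph V) c :
  2 < size c -> ucycle (adj G) c ->
  exists B, is_block G B /\ ucycle (adj B) c.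
Proof.
move=> s2 cc; have c0 : c != [::] by case: c s2 {cc}.
have bi := cycle_biconnected c0 cc.
case: (@block_exists _ G _ bi).
  apply: subgraph_induced; apply/subsetP => x; rewrite inE => xc.
  by apply: (cycle_verts (ltnW s2) _ xc); case/andP: cc.
move=> B [bB /subgraph_adj sB]; exists B; split=> //.
case/andP: cc => cc uc; rewrite /ucycle uc andbT.
case: c {s2 c0 bi uc} cc sB => // z c /= zc sB.
apply: (@sub_in_path _ (mem (z :: c)) (adj G)) zc => [a b ac bc ab|].
  by apply: sB; rewrite adj_induced !inE -!in_cons ac bc.
by apply/allP => w; rewrite in_cons mem_rcons !inE orbA orbb.
Qed.

Lemma connect_exit (V : finType) (e : rel V) (S : {pred V}) x y :
  connect e x y -> x \in S -> y \notin S ->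
  exists a b, [/\ a \in S, b \notin S & e a b].
Proof.
move=> /connectP [p + ->]; elim: p x => [|z p IH] x /=.
  by move=> _ ->.
case/andP=> xz zp xS lS; have [zS|zS] := boolP (z \in S).
  exact: IH zp zS lS.
by exists x, z.
Qed.

Lemma path_first_hit (V : eqType) (e : rel V) (S : {pred V}) x p :
  path e x p -> has S p ->
  exists q t r, [/\ p = rcons q t ++ r, path e x (rcons q t), t \in S &
     all [predC S] q].
Proof.
elim: p x => [|y p IH] x //= /andP[xy yp].
have [yS _|yS /= hp] := boolP (S y).
  by exists [::], y, p; split=> //=; rewrite xy.
have [q [t [r [pE pp tS aq]]]] := IH y yp hp.
by exists (y :: q), t, r; split=> //=; rewrite ?xy ?pE //= yS.
Qed.

Lemma connect_first_hit (V : finType) (e : rel V) (S : {pred V}) x y :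
  connect e x y -> x \notin S -> y \in S ->
  exists q t, [/\ path e x (rcons q t), t \in S, all [predC S] (x :: q) &
    uniq (x :: q)].
Proof.
move=> /connectP [p0 p0P] ->; case/shortenP: p0P => p xp up _ xS lS.
have hp : has S p.
  apply/hasP; exists (last x p) => //.
  case: p lS {xp up} => [|z p] /=; first by rewrite (negPf xS).
  by rewrite mem_last.
have [q [t [r [pE pp tS aq]]]] := path_first_hit xp hp.
exists q, t; split=> //=; first by rewrite xS.
move: up; rewrite pE /= mem_cat mem_rcons inE !negb_or cat_uniq rcons_uniq.
by case/andP => /andP[/andP[_ ->] _] /andP[/andP[_ ->] _].
Qed.

(** Leave [S] along an edge [s d]. As [s] is no cut vertex, [d] is joined to a
    further vertex of [S] without using [s]; stop at the first vertex of [S].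
    *)
Lemma ear (V : finType) (H : graph V) (S : {set V}) s0 s1 v :
  biconnected H -> S \subset verts H -> s0 \in S -> s1 \in S -> s0 != s1 ->
  v \in verts H -> v \notin S ->
  exists s t q, [/\ s \in S, t \in S, s != t, q != [::] &
     [/\ path (adj H) s (rcons q t), uniq q & all [predC S] q]].
Proof.
move=> /biconnectedP [/connectedP [_ cH] bH] SH s0S s1S s01 vH vS.
have [s [d [sS dS sd]]] := connect_exit (cH _ _ (subsetP SH _ s0S) vH) s0S vS.
have [t1 t1S t1s] : exists2 t, t \in S & t != s.
  by have [e|] := eqVneq s0 s; [exists s1; rewrite // -e eq_sym|exists s0].
have ds : d != s by apply: contraNneq dS => ->.
have c := bH s d t1 (adj_vr sd) (subsetP SH _ t1S) ds t1s.
have [q [t [qp tS aq uq]]] := connect_first_hit c dS t1S.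
exists s, t, (d :: q); split=> //.
  rewrite eq_sym; apply: (@connect_off_neq _ (adj H) s d t) => //.
  by apply/connectP; exists (rcons q t); rewrite ?last_rcons.
split=> //=; rewrite sd /=; apply: sub_path qp; exact: off_sub.
Qed.

Lemma connected_nbr (V : finType) (H : graph V) x y :
  connected H -> x \in verts H -> y \in verts H -> x != y ->
  exists z, adj H x z.
Proof.
move=> /connectedP [_ h] xH yH; have /connectP [[|z p] /=] := h _ _ xH yH.
  by move=> _ ->; rewrite eqxx.
by case/andP=> xz _ _ _; exists z.
Qed.

Lemma edge_block (V : finType) (G : graph V) x y :
  adj G x y -> exists B, is_block G B /\ adj B x y.
Proof.
move=> xy; have cc : ucycle (adj G) [:: x; y].
  by rewrite /ucycle /= xy adjC xy inE (adj_neq xy).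
have bi := cycle_biconnected (isT : [:: x; y] != [::]) cc.
have [|B [bB /subgraph_adj sB]] := @block_exists _ G _ bi.
  apply: subgraph_induced; apply/subsetP => z; rewrite !inE.
  by case/orP=> /eqP ->; rewrite ?(adj_vl xy) ?(adj_vr xy).
by exists B; split=> //; apply: sB; rewrite adj_induced !inE !eqxx orbT.
Qed.

(** A block without edges would be a single vertex, and lie in the block of an
    edge at this vertex. *)
Lemma block_has_edge (V : finType) (G B : graph V) x y :
  connected G -> adj G x y -> is_block G B -> exists a b, adj B a b.
Proof.
move=> cG xy bB.
have /andP[cB _] := block_bicon bB.
have /connectedP [/set0Pn [z zB] _] := cB.
have zG := subgraph_vert (block_sub bB) zB.
have [w zw] : exists w, adj G z w.
  have [e|] := eqVneq z x; first by exists y; rewrite e.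
  by move=> zx; apply: connected_nbr cG zG (adj_vl xy) zx.
have [K [bK zwK]] := edge_block zw.
case: (pickP [pred v in verts B | v != z]) => [v /andP[/= vB vz]|h].
  have [|u zu] := connected_nbr cB zB vB; first by rewrite eq_sym.
  by exists z, u.
have BK : subgraph B K.
  apply: subgraphI => [a aB|a b ab].
    have := h a; rewrite /= aB => /negbFE/eqP ->; exact: adj_vl zwK.
  have := h a; have := h b; rewrite /= (adj_vl ab) (adj_vr ab) /=.
  by move=> /negbFE/eqP bz /negbFE/eqP az; move: (adj_neq ab); rewrite az bz eqxx.
exists z, w; rewrite -(block_max bB BK (block_sub bK) (block_bicon bK)).
exact: zwK.
Qed.

(** Two blocks through [x] are joined by a path that avoids [x] unless [x] is a
    cut vertex; closing it up at [x] gives a cycle meeting both in an edge. *)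
Lemma noncut_block_unique (V : finType) (G B B' : graph V) x b b' :
  connected G -> ~~ cut_vertex G x -> is_block G B -> is_block G B' ->
  adj B x b -> adj B' x b' -> B = B'.
Proof.
move=> cG /(cut_vertexPn _ cG) h bB bB' xb xb'.
have [bb|bb] := eqVneq b b'.
  apply: (block_eq bB bB' (adj_neq xb)); rewrite ?(adj_vl xb) ?(adj_vr xb) //.
    exact: adj_vl xb'.
  by rewrite bb; apply: adj_vr xb'.
have Gxb := subgraph_adj (block_sub bB) xb.
have Gxb' := subgraph_adj (block_sub bB') xb'.
have bx : b != x by rewrite eq_sym; apply: adj_neq xb.
have b'x : b' != x by rewrite eq_sym; apply: adj_neq xb'.
have /connectP [p0 p0P l0] := h _ _ (adj_vr Gxb) (adj_vr Gxb') bx b'x.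
case/shortenP: p0P l0 => p bp up _ l.
have xp : x \notin b :: p.
  rewrite inE negb_or eq_sym bx /=; apply/negP => xp.
  have := @path_connect _ _ _ _ bp x; rewrite inE xp orbT => /(_ isT).
  move/connect_off_neq/(_ bx).
  by rewrite eqxx.
have cc : ucycle (adj G) (x :: b :: p).
  rewrite /ucycle [cycle _ _]/= [uniq _]/= xp -[_ && uniq p]/(uniq (b :: p)) up.
  rewrite rcons_path Gxb -l adjC Gxb' !andbT /=; apply: sub_path bp.
  exact: off_sub.
have p0' : 2 < size (x :: b :: p).
  by case: (p) l => //= e; rewrite e eqxx in bb.
have [K [bK cK]] := cycle_in_block p0' cc.
have KV z : z \in x :: b :: p -> z \in verts K.
  by move=> zc; apply: (cycle_verts (ltnW p0') _ zc); case/andP: cK.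
have xK : x \in verts K by apply: KV; rewrite inE eqxx.
rewrite -(block_eq bK bB (adj_neq xb) xK) ?(adj_vl xb) ?(adj_vr xb) //; last first.
  by apply: KV; rewrite !inE eqxx orbT.
rewrite (block_eq bK bB' (adj_neq xb') xK) ?(adj_vl xb') ?(adj_vr xb') //.
by apply: KV; rewrite l in_cons mem_last orbT.
Qed.

(** * Odd cycles and two-colourings *)

Definition colouring (V : eqType) (e : rel V) (f : V -> bool) :=
  forall x y, e x y -> f x != f y.

Lemma colouring_path (V : eqType) (e : rel V) f x p :
  colouring e f -> path e x p -> f (last x p) = f x (+) odd (size p).
Proof.
move=> fP; elim: p x => [|y p IH] x /=; first by rewrite addbF.
case/andP=> /fP xy /IH ->; move: xy.
by case: (f x); case: (f y); case: (odd _).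
Qed.

Lemma colouring_cycle (V : eqType) (e : rel V) f c :
  colouring e f -> cycle e c -> odd (size c) = false.
Proof.
move=> fP; case: c => // x p /= /(colouring_path fP).
rewrite last_rcons size_rcons /=; by case: (f x); case: (odd _).
Qed.

Lemma colouring_path_count (V : eqType) (e : rel V) f x p :
  colouring e f -> path e x p ->
  2 * count f p + f x = size p + f (last x p).
Proof.
move=> fP; elim: p x => [|y p IH] x //=.
case/andP=> /fP xy /IH; move: xy.
by case: (f x); case: (f y) => //= _; lia.
Qed.

Lemma colouring_cycle_count (V : eqType) (e : rel V) f c :
  colouring e f -> cycle e c -> 2 * count f c = size c.
Proof.
move=> fP; case: c => // x p /= /(colouring_path_count fP).
rewrite last_rcons size_rcons -cats1 count_cat /=; lia.
Qed.

Lemma not_uniq_split (T : eqType) (c : seq T) : ~~ uniq c ->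
  exists a y b d, c = a ++ y :: b ++ y :: d.
Proof.
elim: c => //= z c IH; rewrite negb_and negbK => /orP[zc|/IH].
  by case/splitPr: zc => b d; exists [::], z, b, d.
by move=> [a [y [b [d ->]]]]; exists (z :: a), y, b, d.
Qed.

(** A closed walk that visits a vertex twice splits into two shorter ones, and
    one of these is odd. *)
Lemma odd_closed_walk (V : eqType) (e : rel V) c :
  cycle e c -> odd (size c) -> exists d, ucycle e d /\ odd (size d).
Proof.
elim: {c}_.+1 {-2}c (ltnSn (size c)) => // n IH c sn cc oc.
have [uc|/not_uniq_split [a [y [b [d cE]]]]] := boolP (uniq c).
  by exists c; rewrite /ucycle cc uc.
have rE : rot (size a) c = (y :: b) ++ (y :: d ++ a).
  by rewrite cE rot_size_cat /= -catA.
have := cc; rewrite -(rot_cycle (size a)) rE /= rcons_cat cat_path /=.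
move=> /and3P[p1 p2 p3].
have sE : size c = (size b).+1 + (size d + size a).+1.
  by rewrite cE !size_cat /= size_cat /=; lia.
have [ob|ob] := boolP (odd (size b).+1).
  apply: (IH (y :: b)) => //=; first by lia.
  by rewrite rcons_path p1 p2.
apply: (IH (y :: d ++ a)) => /=; rewrite ?size_cat //; first by lia.
by move: oc ob; rewrite sE; lia.
Qed.

(** A state is a vertex together with the parity of the number of steps made,
    so that reachability becomes the existence of a walk of given parity. *)
Definition parity_walk (V : eqType) (e : rel V) : rel (V * bool) :=
  [rel x y | e x.1 y.1 && (y.2 == ~~ x.2)].

Lemma parity_walk_path (V : finType) (e : rel V) x p b : path e x p ->
  connect (parity_walk e) (x, b) (last x p, b (+) odd (size p)).
Proof.
elim: p x b => [|y p IH] x b /=; first by rewrite addbF.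
case/andP=> xy /(IH y (~~ b)); rewrite addNb addbN => c.
by apply: connect_trans (connect1 _) c; apply/andP.
Qed.

Lemma parity_walkP (V : finType) (e : rel V) x y b c :
  connect (parity_walk e) (x, b) (y, c) ->
  exists p, [/\ path e x p, last x p = y & odd (size p) = b (+) c].
Proof.
move=> /connectP [p pP lE].
exists (map fst p); elim: p x b pP lE => [|[z d] p IH] x b /=.
  by move=> _ [-> ->]; rewrite addbb.
case/andP=> /andP[/= -> /eqP dE] /IH h /h [-> -> ->].
by rewrite dE; split=> //; case: (b); case: (c).
Qed.

Lemma closed_walk_cycle (V : eqType) (e : rel V) x p :
  path e x p -> last x p = x -> cycle e p.
Proof.
by case: p => //= y p /andP[xy yp] l; rewrite rcons_path yp l.
Qed.

(** Colour a vertex by the parity of the walks from the root of its component: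
    an edge with ends of the same colour closes up an odd walk. *)
Lemma colouring_or_odd_cycle (V : finType) (e : rel V) : symmetric e ->
  (exists f, colouring e f) \/ (exists c, ucycle e c /\ odd (size c)).
Proof.
move=> es.
pose f x := connect (parity_walk e) (root e x, false) (x, false).
have fP x : connect (parity_walk e) (root e x, false) (x, ~~ f x).
  case fx: (f x) => /=; first exact: fx.
  have : connect e (root e x) x by rewrite (sym_connect_sym es) connect_root.
  move=> /connectP [p pP l]; have := parity_walk_path false pP.
  by rewrite -l; case: (odd _) => //= h; rewrite /f h in fx.
case: (boolP [forall x, forall y, e x y ==> (f x != f y)]) => [h|].
  by left; exists f => x y; apply/implyP; move/forallP/(_ x)/forallP/(_ y): h.
case/forallPn => x /forallPn [y]; rewrite negb_imply negbK => /andP[xy /eqP fxy].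
right.
have rE : root e x = root e y.
  by apply/(rootP (sym_connect_sym es)); apply: connect1.
set r := root e x in rE.
have [b [cx cy]] : exists b, connect (parity_walk e) (r, false) (x, b)
   /\ connect (parity_walk e) (r, false) (y, b).
  by exists (~~ f x); split; [exact: fP | rewrite rE fxy; exact: fP].
have [p [pP lp op]] := parity_walkP cx.
have [q [qP lq oq]] := parity_walkP cy.
have qr : path e y (rev (belast r q)).
  by rewrite -lq rev_path (eq_path (e' := e)) // => a c; rewrite es.
have lr : last y (rev (belast r q)) = r.
  by case: (q) lq => [|z q'] //= _; rewrite rev_cons last_rcons.
have cc : cycle e (p ++ y :: rev (belast r q)).
  apply: (@closed_walk_cycle _ _ r); last by rewrite last_cat /= lr.
  by rewrite cat_path pP /= lp xy qr.
apply: odd_closed_walk cc _; rewrite size_cat /= size_rev size_belast.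
by rewrite oddD /= op oq; case: (b).
Qed.

Lemma bipartiteP (V : finType) (G : graph V) :
  bipartite G <-> exists f, colouring (adj G) f.
Proof.
have card2 (A : {set V}) x y : x != y ->
    (#|[set x; y] :&: A| == 1) = ((x \in A) != (y \in A)).
  move=> xy; rewrite setIUl cardsU -setIIl.
  have s1 z : #|[set z] :&: A| = (z \in A).
    case: (boolP (z \in A)) => zA.
      by rewrite (setIidPl _) ?cards1 ?sub1set.
    by apply/eqP; rewrite cards_eq0 setI_eq0 disjoints1.
  have -> : [set x] :&: [set y] = set0 :> {set V}.
    by apply/eqP; rewrite setI_eq0 disjoints1 inE.
  by rewrite set0I cards0 !s1; case: (_ \in _); case: (_ \in _).
split=> [/existsP [A /forall_inP h]|[f h]].
  exists (fun x => x \in A) => x y xy.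
  by rewrite -card2 ?(adj_neq xy) //; apply: h.
apply/existsP; exists [set x | f x]; apply/forall_inP => g /edge_adj.
by move=> [x [y [-> xy]]]; rewrite card2 ?(adj_neq xy) // !inE; apply: h.
Qed.

Lemma odd_cycle_exists (V : finType) (G : graph V) : ~~ bipartite G ->
  exists c, ucycle (adj G) c /\ odd (size c).
Proof.
have [/bipartiteP -> //|//] := colouring_or_odd_cycle (adjC G).
Qed.

(** * The two conditions on cycles *)

(** An edge traversed back and forth is a [ucycle] of length two, whence the
    lower bound on the length. *)
Definition even_cycles_short (V : finType) (e : rel V) :=
  forall c, ucycle e c -> 2 < size c -> ~~ odd (size c) -> size c = 4.

Definition odd_cycles_meet (V : finType) (e : rel V) :=
  forall c d, ucycle e c -> ucycle e d -> odd (size c) -> odd (size d) ->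
    exists x y, [/\ x != y, x \in c, x \in d, y \in c & y \in d].

Lemma even_cycles_short_sub (V : finType) (e e' : rel V) :
  subrel e' e -> even_cycles_short e -> even_cycles_short e'.
Proof. by move=> s h c /(ucycle_sub s); apply: h. Qed.

Lemma odd_cycles_meet_sub (V : finType) (e e' : rel V) :
  subrel e' e -> odd_cycles_meet e -> odd_cycles_meet e'.
Proof. by move=> s h c d /(ucycle_sub s) + /(ucycle_sub s); apply: h. Qed.

(** The ear and the closing path can only meet in their ends: the former avoids
    [S] in between, and the latter stays in it. *)
Lemma ear_ucycle (V : finType) (e : rel V) (S : {pred V}) s q t r :
  path e s (rcons q t) -> uniq q -> all [predC S] q ->
  path e t (rcons r s) -> uniq (s :: t :: r) -> all [in S] (s :: t :: r) ->
  ucycle e (s :: q ++ t :: r).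
Proof.
move=> p1 uq aq p2 ur ar; rewrite /ucycle; apply/andP; split.
  by rewrite /= -cat_rcons rcons_cat cat_path p1 last_rcons p2.
have dis x : x \in q -> x \in s :: t :: r -> False.
  by move=> /(allP aq) /negP xS /(allP ar).
have := ur; rewrite !cons_uniq cat_uniq uq /= mem_cat negb_or => /and3P[-> -> ->].
rewrite !andbT; apply/andP; split.
  by apply/negP => sq; apply: (dis s sq); rewrite inE eqxx.
rewrite negb_or; apply/andP; split.
  by apply/negP => sq; apply: (dis t sq); rewrite !inE eqxx orbT.
by apply/hasPn => x xr; apply/negP => xq; apply: (dis x xq); rewrite !inE xr !orbT.
Qed.

(** * Biconnected bipartite graphs whose cycles have length four *)

Definition nbrs (V : finType) (G : graph V) (a b : V) : {set V} :=
  [set c | adj G a c && adj G b c].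

Lemma addn_eq2F n k : 0 < n -> n + k.+2 = 2 -> False.
Proof. lia. Qed.

Section BipartiteBlock.
Variables (V : finType) (B : graph V).
Hypotheses (Bbi : biconnected B) (C1 : even_cycles_short (adj B)).
Variables (f : V -> bool).
Hypothesis fP : colouring (adj B) f.

Let cycle4 c : ucycle (adj B) c -> 2 < size c -> size c = 4.
Proof.
move=> uc s2; apply: C1 => //; case/andP: uc => cc _.
by rewrite (colouring_cycle fP cc).
Qed.

Let nbrs_colour a b c : c \in nbrs B a b -> f c = ~~ f a /\ f c = ~~ f b.
Proof.
rewrite inE => /andP[/fP + /fP].
by case: (f a); case: (f b); case: (f c).
Qed.

(** Any ear of a [K_{2,l}] whose two-element side has as many common neighbours
    as possible would give a longer cycle or a larger set of neighbours. *)
Lemma maximal_K2_spans a b :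
  a != b -> 1 < #|nbrs B a b| ->
  (forall a' b', a' != b' -> #|nbrs B a' b'| <= #|nbrs B a b|) ->
  verts B = [set a; b] :|: nbrs B a b.
Proof.
move=> ab T2 mx; set A := [set a; b]; set T := nbrs B a b; set S := A :|: T.
have [x0 [y0 [x0T y0T xy0]]] : exists x y, [/\ x \in T, y \in T & x != y].
  by case/card_gt1P: T2 => x [y []]; exists x, y.
have fT x y : x \in A -> y \in T -> adj B x y.
  by rewrite !inE => /orP[] /eqP -> /andP[].
have aA : a \in A by rewrite !inE eqxx.
have bA : b \in A by rewrite !inE eqxx orbT.
have AT x y : x \in A -> y \in T -> x != y.
  by move=> xA yT; apply: adj_neq (fT _ _ xA yT).
have SB : S \subset verts B.
  apply/subsetP => x; rewrite inE => /orP[xA|xT]; first exact: adj_vl (fT _ _ xA x0T).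
  exact: adj_vr (fT _ _ aA xT).
apply/eqP; rewrite eq_sym eqEsubset SB; apply/subsetP => v vB.
apply/negPn/negP => vS.
have AS x : x \in A -> x \in S by move=> h; rewrite inE h.
have TS x : x \in T -> x \in S by move=> h; rewrite inE h orbT.
have [s [t [q [sS tS st q0 [qp uq aq]]]]] := ear Bbi SB (AS _ aA) (AS _ bA) ab vB vS.
have q1 : 0 < size q by case: (q) q0.
have other_A x : x \in A -> exists2 y, y \in A & y != x.
  by rewrite !inE => /orP[] /eqP ->; [exists b|exists a]; rewrite // eq_sym.
have other_T x : exists2 y, y \in T & y != x.
  by have [<-|] := eqVneq x0 x; [exists y0; rewrite // eq_sym|exists x0].
have fT' x y : x \in T -> y \in A -> adj B x y.
  by move=> xT yA; rewrite adjC; apply: fT.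
have closing r : path (adj B) t (rcons r s) -> uniq (t :: r) -> s \notin r ->
    all [in S] r -> size q + size r = 2.
  move=> p2 ur sr ar.
  have /cycle4 : ucycle (adj B) (s :: q ++ t :: r).
    apply: (ear_ucycle qp uq aq p2); last by rewrite /= sS tS.
    by rewrite cons_uniq ur inE negb_or st sr.
  by rewrite /= size_cat /= !addnS => /(_ (leq_trans q1 (leq_addr _ _))) [].
have SE x : (x \in S) = (x \in A) || (x \in T) by rewrite in_setU.
move: (sS) (tS); rewrite !SE => /orP[sA|sT] /orP[tA|tT].
(* the ear from [a] to [b] has one inner vertex, which is a common neighbour *)
- have q1' : size q + 1 = 2.
    apply: (closing [:: x0]); rewrite /= ?in_cons ?in_nil ?orbF ?andbT.
    + by rewrite fT // fT'.
    + exact: AT.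
    + exact: AT.
    + exact: TS.
  case: q q0 q1 qp uq aq q1' {closing} => [//|d [|? q]] _ _ /=; last first.
    by move=> _ _ _ /eqP; rewrite addn1.
  rewrite andbT => /andP[sd dt] _ /andP[dS _] _.
  case/negP: dS; rewrite SE; apply/orP; right; rewrite inE.
  have := dt; rewrite adjC => td; have := sd; have := td.
  move: sA tA st; rewrite !inE => /orP[]/eqP -> /orP[]/eqP ->; rewrite ?eqxx //.
    by move=> _ -> ->.
  by move=> _ -> ->.
(* ends on different sides: close up through one more vertex of either side *)
- have [a' a'A a's] := other_A s sA; have [c cT ct] := other_T t.
  apply: (addn_eq2F q1 (closing [:: a'; c] _ _ _ _));
    rewrite /= ?in_cons ?in_nil ?orbF ?andbT ?negb_or.
  + by rewrite fT' // fT // fT'.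
  + by rewrite eq_sym (AT a') // eq_sym ct (AT a').
  + by rewrite eq_sym a's AT.
  + by rewrite AS // TS.
- have [a' a'A a's] := other_A t tA; have [c cT ct] := other_T s.
  apply: (addn_eq2F q1 (closing [:: c; a'] _ _ _ _));
    rewrite /= ?in_cons ?in_nil ?orbF ?andbT ?negb_or.
  + by rewrite fT // fT' // fT.
  + by rewrite (AT t) // eq_sym a's eq_sym (AT a').
  + by rewrite eq_sym ct eq_sym AT.
  + by rewrite TS // AS.
(* both ends among the common neighbours: close up through a third one *)
have [/existsP [c /and3P[cT cs ct]]|] :=
    boolP [exists c, [&& c \in T, c != s & c != t]].
  apply: (addn_eq2F q1 (closing [:: a; c; b] _ _ _ _));
    rewrite /= ?in_cons ?in_nil ?orbF ?andbT ?negb_or.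
  + by rewrite fT' // fT // fT' // fT.
  + rewrite eq_sym AT // eq_sym ct eq_sym AT //= AT // ab /=.
    by rewrite eq_sym AT.
  + by rewrite eq_sym AT // eq_sym cs /= eq_sym AT.
  + by rewrite AS // TS // AS.
(* or else [s] and [t] are the only ones, and have three common neighbours *)
rewrite negb_exists => /forallP noT.
have TE : T \subset [set s; t].
  apply/subsetP => c cT; have := noT c; rewrite cT /= !inE -negb_or negbK.
  by [].
have q1' : size q + 1 = 2.
  apply: (closing [:: a]); rewrite /= ?in_cons ?in_nil ?orbF ?andbT.
  + by rewrite fT' // fT.
  + by rewrite eq_sym AT.
  + by rewrite eq_sym AT.
  + exact: AS.
case: q q0 q1 qp uq aq q1' {closing} => [//|d [|? q]] _ _ /=; last first.
  by move=> _ _ _ /eqP; rewrite addn1.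
rewrite andbT => /andP[sd dt] _ /andP[dS _] _.
have := mx s t st; apply/negP; rewrite -ltnNge.
apply: (@leq_ltn_trans 2).
  by rewrite -/T (leq_trans (subset_leq_card TE)) // cards2; case: (_ != _).
have da : d != a by apply: contraNneq dS => ->; apply: AS.
have db : d != b by apply: contraNneq dS => ->; apply: AS.
suff : d |: A \subset nbrs B s t.
  by move/subset_leq_card; apply: leq_trans; rewrite cardsU1 cards2 ab !inE negb_or da db.
by apply/subsetP => x; rewrite !inE => /or3P[] /eqP ->; rewrite ?sd ?[adj B t d]adjC ?dt //
  fT' // fT'.
Qed.

(** Unless [B] is an edge, an ear of an edge yields a four-cycle, hence two
    vertices with two common neighbours. Two vertices with as many common
    neighbours as possible form, with these, the whole of [B], and the colours
    exclude further edges. *)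
Lemma bipartite_block_shape a0 b0 : adj B a0 b0 ->
  (exists l, is_K2 l B) \/ is_cut_edge_block B.
Proof.
move=> e0; have ab0 := adj_neq e0.
have SB : [set a0; b0] \subset verts B.
  apply/subsetP => z; rewrite !inE.
  by case/orP=> /eqP ->; rewrite ?(adj_vl e0) ?(adj_vr e0).
have [/eqP E|] := boolP (verts B == [set a0; b0]).
  right; exists [set a0; b0]; split=> //; apply/setP => g; rewrite inE.
  apply/idP/eqP => [gB|->]; last exact: e0.
  have [gs g2] := edgeP gB; apply/eqP; rewrite eqEcard -E gs /= E cards2 ab0 g2.
  by [].
rewrite eq_sym eqEsubset SB /= => /subsetPn [v vB vS]; left.
have a0S : a0 \in [set a0; b0] by rewrite !inE eqxx.
have b0S : b0 \in [set a0; b0] by rewrite !inE eqxx orbT.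
have [s [t [q [sS tS st q0 [qp uq aq]]]]] := ear Bbi SB a0S b0S ab0 vB vS.
have st' : adj B t s.
  move: sS tS st; rewrite !inE.
  by case/orP=>/eqP-> /orP[]/eqP->; rewrite ?eqxx // adjC.
have uc : ucycle (adj B) (s :: q ++ [:: t]).
  apply: (ear_ucycle qp uq aq) => /=; rewrite ?st' ?inE ?st //.
  by move: sS tS; rewrite !inE => -> ->.
have := cycle4 uc; rewrite /= size_cat /= addn1.
case: q q0 uc {qp uq aq} => [//|d [|d' [|? ?]]] _ uc /=; try by move/(_ isT).
move=> _; case/andP: uc => /= /and5P[sd dd' d't _ _].
rewrite !inE !negb_or => /and4P[/and3P[_ sd' _] /andP[_ dt] _ _].
pose P (p : V * V) := (p.1 != p.2) && (1 < #|nbrs B p.1 p.2|).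
have P0 : P (s, d').
  rewrite /P /= sd'; apply/card_gt1P; exists d, t.
  by rewrite !inE sd d't [adj B s t]adjC st' [adj B d' d]adjC dd'.
case: (arg_maxnP (fun p : V * V => #|nbrs B p.1 p.2|) P0) => [[a b]].
case/andP=> /= ab T2 mx; exists #|nbrs B a b|; split=> //.
have vE : verts B = [set a; b] :|: nbrs B a b.
  apply: maximal_K2_spans => // a' b' ab'.
  have [T2'|T2'] := ltnP 1 #|nbrs B a' b'|; last exact: leq_trans T2' (ltnW T2).
  by apply: (mx (a', b')); rewrite /P /= ab'.
exists [set a; b], (nbrs B a b); split=> //.
- rewrite disjoint_sym disjoints_subset; apply/subsetP => x xT; rewrite !inE.
  move: xT; rewrite inE => /andP[ax bx]; apply/norP.
  by rewrite eq_sym (adj_neq ax) eq_sym (adj_neq bx).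
- by rewrite cards2 ab.
have vS' z : z \in verts B -> z \in [set a; b] \/ z \in nbrs B a b.
  by rewrite vE in_setU => /orP.
have [c cT] : exists c, c \in nbrs B a b by apply/card_gt0P; apply: ltnW.
have [ca cb] := nbrs_colour cT.
have fA z : z \in [set a; b] -> f z = f a.
  by rewrite !inE => /orP[] /eqP -> //; apply/negb_inj; rewrite -ca -cb.
apply/setP => g; apply/idP/imset2P.
  move=> /edge_adj [x [y [-> xy]]]; have fxy := fP xy.
  case: (vS' _ (adj_vl xy)) (vS' _ (adj_vr xy)) => [xA|xT] [yA|yT].
  - by move: fxy; rewrite (fA x xA) (fA y yA) eqxx.
  - by exists x y.
  - by exists y x; rewrite // setUC.
  - have [xa _] := nbrs_colour xT; have [ya _] := nbrs_colour yT.
    by move: fxy; rewrite xa ya eqxx.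
case=> x y; rewrite !inE => xA /andP[ay yb] ->.
by case/orP: xA => /eqP ->.
Qed.

End BipartiteBlock.

(** * Graphs in which no vertex meets all odd cycles *)

(** Cut the walk at its visits to [p]. If every piece had the parity predicted
    by the positions of its ends, the parities would add up along the walk. *)
Lemma parity_breaking_ear (V : eqType) (e : rel V) c0 p y q :
  y \in p -> last y q \in p -> path e y q -> uniq (y :: q) -> c0 \notin q ->
  odd (size q) != odd (index y p + index (last y q) p) ->
  exists y' z q', [/\ y' \in p, z \in p, y' != z &
    [/\ path e y' (rcons q' z), uniq q', all [predC c0 :: p] q' &
     odd (size q').+1 != odd (index y' p + index z p)]].
Proof.
elim: {q}_.+1 {-2}q y (ltnSn (size q)) => // n IH q y sn yp lp yq uq cq od.
have hq : has [in p] q.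
  apply/hasP; exists (last y q) => //.
  case: (q) od => [|x q'] /=; last by rewrite mem_last.
  by rewrite addnn odd_double.
have [q' [t [r [qE qP tp aq]]]] := path_first_hit yq hq.
have yt : y != t.
  apply: contraTneq uq => ->; rewrite qE /= mem_cat mem_rcons inE eqxx //.
have uq' : uniq q'.
  by move: uq; rewrite qE /= cat_uniq rcons_uniq => /and3P[_ /andP[_ ->]].
have [par|par] := boolP (odd (size q').+1 == odd (index y p + index t p)); last first.
  exists y, t, q'; split=> //; split=> //; apply/allP => x xq /=.
  have /= xp := allP aq x xq; rewrite inE negb_or xp andbT.
  by apply: contraNneq cq => <-; rewrite qE mem_cat mem_rcons inE xq orbT.
apply: (IH r t) => //.
- by move: sn; rewrite qE size_cat size_rcons; clear; lia.
- by move: lp; rewrite qE last_cat last_rcons.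
- by move: yq; rewrite qE cat_path last_rcons => /andP[].
- move: uq; rewrite qE /= cat_uniq has_sym => /and3P[_ _ /andP[h ur]].
  rewrite ur andbT; apply/negP => tr; move/hasPn: h => /(_ t).
  by rewrite mem_rcons inE eqxx /= => /(_ isT); rewrite tr.
- by move: cq; rewrite qE mem_cat negb_or => /andP[].
move: od par; rewrite qE last_cat last_rcons size_cat size_rcons /= !oddD /=.
by case: (odd (size q')); case: (odd (size r)); case: (odd (index y p));
  case: (odd (index t p)); case: (odd (index _ p)).
Qed.

Lemma uniq_split2 (V : eqType) (p : seq V) y z : uniq p ->
  y \in p -> z \in p -> index y p < index z p ->
  exists p1 p2 p3, p = p1 ++ y :: p2 ++ z :: p3.
Proof.
move=> up yp; case/splitPr: yp up => p1 p2 up zp.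
rewrite !index_cat /= eqxx.
have yp1 : y \in p1 = false.
  by move: up; rewrite cat_uniq /= => /and3P[_ /norP[/negPf -> _]].
rewrite yp1; case: ifP => zp1.
  by have := zp1; rewrite -index_mem; clear; lia.
move: zp; rewrite mem_cat zp1 /= inE => /orP[/eqP ->|zp2].
  by rewrite eqxx; clear; lia.
by case/splitPr: zp2 => p2' p3 _; exists p1, p2', p3.
Qed.

Section NoApex.
Variables (V : finType) (e : rel V).
Hypothesis es : symmetric e.
Hypotheses (C1 : even_cycles_short e) (C2 : odd_cycles_meet e).

(** The ear closes up to an even cycle with the part of the odd cycle through
    [c0], so this has length four; a chord would shorten the odd cycle. *)
Lemma twin_of_ear c0 p y z q :
  ucycle e (c0 :: p) -> odd (size (c0 :: p)) ->
  (forall d, ucycle e d -> odd (size d) -> size (c0 :: p) <= size d) ->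
  y \in p -> z \in p -> index y p < index z p ->
  path e y (rcons q z) -> uniq q -> all [predC c0 :: p] q ->
  odd (size q).+1 != odd (index y p + index z p) ->
  exists w, [/\ w \notin c0 :: p, e w (head w p) & e w (last w p)].
Proof.
move=> uc oc mn yp zp yz yq uq aq od.
have up : uniq p by case/andP: uc => _ /= /andP[].
have [p1 [p2 [p3 pE]]] := uniq_split2 up yp zp yz.
have iy : index y p = size p1.
  rewrite pE index_cat /= eqxx; case: ifP => [y1|_]; last by rewrite addn0.
  by move: up; rewrite pE cat_uniq => /and3P[_ /hasPn /(_ y)]; rewrite inE eqxx y1 => /(_ isT).
have iz : index z p = (size p1 + size p2).+1.
  have -> : p = (p1 ++ y :: p2) ++ z :: p3 by rewrite pE -catA.
  rewrite index_cat /= eqxx; case: ifP => [z1|_].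
    move: up; rewrite pE -cat_cons catA cat_uniq => /and3P[_ /hasPn /(_ z)].
    by rewrite inE eqxx z1 => /(_ isT).
  by rewrite addn0 size_cat /= addnS.
have [cc uc'] := andP uc.
have subp : {subset p1 ++ y :: z :: p3 <= c0 :: p}.
  by move=> x; rewrite pE !(mem_cat, inE) => /or4P[->|->|->|->]; rewrite ?orbT.
(* the closing path from [z] through [c0] back to [y] *)
have rE : rot (size (c0 :: p1 ++ y :: p2)) (c0 :: p) =
    (z :: p3 ++ c0 :: p1) ++ y :: p2.
  have -> : c0 :: p = (c0 :: p1 ++ y :: p2) ++ z :: p3.
    by rewrite pE /= -catA.
  by rewrite rot_size_cat /= -catA.
have p2P : path e z (rcons (p3 ++ c0 :: p1) y).
  move: cc; rewrite -(rot_cycle (size (c0 :: p1 ++ y :: p2))) rE.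
  by rewrite -cat_rcons /= rcons_cat cat_path => /andP[].
have ur : uniq (y :: z :: p3 ++ c0 :: p1).
  move: uc'; rewrite -(rot_uniq (size (c0 :: p1 ++ y :: p2))) rE uniq_catC.
  move: (z :: _) => r; rewrite cat_cons !cons_uniq mem_cat negb_or.
  by rewrite cat_uniq => /andP[/andP[_ ->] /and3P[_ _ ->]].
have ar : all [in c0 :: p] (y :: z :: p3 ++ c0 :: p1).
  apply/allP => x; rewrite /= pE !(mem_cat, inE).
  by case/or3P => [->|->|/or3P[]->]; rewrite ?orbT.
have uD := ear_ucycle yq uq aq p2P ur ar.
have sD : size (y :: q ++ z :: p3 ++ c0 :: p1) =
    (size q + size p3 + size p1 + 3)%N.
  by rewrite /= size_cat /= size_cat /=; clear; lia.
have sc : size (c0 :: p) = (size p1 + size p2 + size p3).+3.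
  by rewrite pE /= !size_cat /= size_cat /=; clear; lia.
have s4 : size q + size p3 + size p1 + 3 = 4.
  rewrite -sD; apply: C1 => //; rewrite sD; first by clear; lia.
  by move: oc od; rewrite sc iy iz; clear; lia.
case: q yq uq aq od uD sD s4 => [|d [|? ?]] yq uq aq od uD sD s4; last 1 first.
- by move: s4; rewrite /=; clear; lia.
- have uE : ucycle e (y :: p2 ++ [:: z]).
    rewrite /ucycle; apply/andP; split.
      move: cc; rewrite pE /= rcons_cat cat_path /= rcons_cat cat_path /=.
      case/and5P=> _ _ h1 h2 _; rewrite cats1 !rcons_path h1 h2 last_rcons es.
      by move: yq; rewrite /= andbT => ->.
    move: uc'; rewrite pE /= cat_uniq => /and4P[_ _ _].
    by rewrite -cat_rcons -cat_cons cat_uniq cats1 => /andP[].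
  have := mn _ uE; rewrite sc /= size_cat /=.
  by move: oc od s4; rewrite sc iy iz /=; clear; lia.
have p10 : p1 = [::] by apply: size0nil; move: s4 => /=; clear; lia.
have p30 : p3 = [::] by apply: size0nil; move: s4 => /=; clear; lia.
exists d; move: yq aq; rewrite /= pE p10 p30 /= last_cat /= => /and3P[yd dz _].
by case/andP=> [dn _]; rewrite es yd dz.
Qed.

(** The odd cycle [d] avoids [c0] and shares two vertices with the shortest
    one. They cut [d] into two arcs of different parity, so that the parity of
    one arc disagrees with the positions of its ends in [p]; this arc contains
    an ear for [twin_of_ear]. *)
Lemma twin c0 p d :
  ucycle e (c0 :: p) -> odd (size (c0 :: p)) ->
  (forall d, ucycle e d -> odd (size d) -> size (c0 :: p) <= size d) ->
  ucycle (off e c0) d -> odd (size d) ->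
  exists w, [/\ w \notin c0 :: p, e w (head w p) & e w (last w p)].
Proof.
move=> uc oc mn ud od.
have ude : ucycle e d by apply: ucycle_sub ud; apply: off_sub.
have [x [y [xy xc xd yc yd]]] := C2 uc ude oc od.
have dn0 z : z \in d -> z != c0.
  case/andP: ud => /= cd _ zd; have := next_cycle cd zd.
  by case/and3P.
have inp z : z \in c0 :: p -> z \in d -> z \in p.
  by rewrite inE => /orP[/eqP -> /dn0|//]; rewrite eqxx.
case: (rot_to xd) => i d' dE.
move: yd; rewrite -(mem_rot i) dE inE eq_sym (negPf xy) /= => yd.
have := ude; rewrite -(ucycle_rot _ i) dE.
have od' : odd (size (x :: d')) by rewrite -dE size_rot.
have c0d : c0 \notin x :: d'.
  by rewrite -dE mem_rot; apply/negP => /dn0; rewrite eqxx.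
have xp := inp _ xc xd; have {yc} yp : y \in p.
  by apply: inp yc _; rewrite -(mem_rot i) dE inE yd orbT.
case/splitPr: yd od' c0d {dE} => d1 d2 od' c0d ud'.
have [y' [z [q [y'p zp y'z [qP uq aq oq]]]]] :
  exists y' z q', [/\ y' \in p, z \in p, y' != z &
    [/\ path e y' (rcons q' z), uniq q', all [predC c0 :: p] q' &
     odd (size q').+1 != odd (index y' p + index z p)]].
  have [h|h] := boolP (odd (size (rcons d1 y)) == odd (index x p + index y p)).
    apply: (@parity_breaking_ear _ _ c0 p y (rcons d2 x)); rewrite ?last_rcons //.
    - case/andP: ud' => /= + _; rewrite rcons_cat cat_path /= => /and3P[_ _].
      by [].
    - have := ud'; rewrite -(ucycle_rot _ (size (x :: d1))) -cat_cons.
      rewrite rot_size_cat => /andP[_]; rewrite /= => /andP[].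
      rewrite mem_cat negb_or inE negb_or cat_uniq /= => /and3P[h1 h2 h3].
      case/and3P=> ud2 /norP[h4 _] _.
      by rewrite mem_rcons inE negb_or h2 h1 rcons_uniq ud2 h4.
    - by move: c0d; rewrite mem_rcons !(mem_cat, inE) !negb_or =>
        /and4P[-> _ _ ->].
    move: h od'; rewrite !size_rcons /= size_cat /= !oddD.
    by case: (odd (index x p)); case: (odd (index y p)); clear; lia.
  apply: (@parity_breaking_ear _ _ c0 p x (rcons d1 y)); rewrite ?last_rcons //.
  - case/andP: ud' => /= + _; rewrite rcons_cat cat_path /=.
    by case/and3P => h1 h2 _; rewrite rcons_path h1.
  - case/andP: ud' => _; rewrite -cat_rcons -cat_cons cat_uniq.
    by case/andP.
  by move: c0d; rewrite mem_rcons !(mem_cat, inE) !negb_or =>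
    /and4P[_ -> -> _].
have [lt|gt|eq] := ltngtP (index y' p) (index z p).
- exact: (twin_of_ear uc oc mn y'p zp lt qP uq aq oq).
- apply: (@twin_of_ear c0 p z y' (rev q)) => //.
  + have := rev_path e y' (rcons q z).
    rewrite last_rcons belast_rcons rev_cons => ->.
    by rewrite (eq_path (e' := e)) // => a b; rewrite es.
  + by rewrite rev_uniq.
  + by rewrite all_rev.
  by rewrite size_rev addnC.
have := nth_index y' y'p; rewrite eq nth_index // => E.
by rewrite E eqxx in y'z.
Qed.

End NoApex.

(** Proves that explicitly listed vertices are distinct, from hypotheses stating
    each disequality in one order or the other. *)
Ltac distinct :=
  rewrite /= ?in_cons ?in_nil ?orbF ?negb_or;
  repeat (apply/andP; split); first [done | by rewrite eq_sym].

Lemma shortest_odd_cycle (V : finType) (e : rel V) c :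
  ucycle e c -> odd (size c) ->
  exists c, [/\ ucycle e c, odd (size c) &
    forall d, ucycle e d -> odd (size d) -> size c <= size d].
Proof.
move=> uc oc.
pose P n := [exists t : n.-tuple V, ucycleb e t] && odd n.
have PP d : ucycle e d -> odd (size d) -> P (size d).
  by move=> ud od; rewrite /P od andbT; apply/existsP; exists (in_tuple d).
have exP : exists n, P n by exists (size c); apply: PP.
case: (ex_minnP exP) => n /andP[/existsP [t ut] on] mn.
by exists t; rewrite size_tuple; split=> // d ud od; apply: mn; apply: PP.
Qed.

(** A further vertex would yield an ear at two vertices of the [K_4]; according
    to parity it makes an even cycle of length at least six, or an odd cycle
    meeting one of the triangles in a single vertex. *)
Lemma K4_maximal (V : finType) (B : graph V) (S : {set V}) :
  biconnected B -> even_cycles_short (adj B) -> odd_cycles_meet (adj B) ->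
  #|S| = 4 -> (forall x y, x \in S -> y \in S -> x != y -> adj B x y) ->
  is_complete 4 B.
Proof.
move=> Bbi C1 C2 S4 SA.
have [a [b [aS bS ab]]] : exists a b, [/\ a \in S, b \in S & a != b].
  have : 1 < #|S| by rewrite S4.
  by case/card_gt1P => x [y []]; exists x, y.
have SB : S \subset verts B.
  apply/subsetP => x xS; have [e|xa] := eqVneq x a.
    by rewrite e; apply: adj_vl (SA _ _ aS bS ab).
  by apply: adj_vl (SA _ _ xS aS xa).
suff VE : verts B = S.
  split; first by rewrite VE.
  apply/setP => g; rewrite inE VE; apply/idP/andP => [gB|[gS /cards2P]].
    by have [h ->] := edgeP gB; rewrite -VE h.
  move=> [x [y [xy gE]]]; rewrite gE; apply: SA => //.
    by apply: (subsetP gS); rewrite gE !inE eqxx.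
  by apply: (subsetP gS); rewrite gE !inE eqxx orbT.
apply/eqP; rewrite eq_sym eqEsubset SB; apply/subsetP => v vB.
apply/negPn/negP => vS.
have [s [t [q [sS tS st q0 [qp uq aq]]]]] := ear Bbi SB aS bS ab vB vS.
have [u [w [uS wS uw ust wst]]] : exists u w,
    [/\ u \in S, w \in S, u != w, u \notin [:: s; t] & w \notin [:: s; t]].
  have : 1 < #|S :\ s :\ t|.
    have := cardsD1 t (S :\ s); have := cardsD1 s S.
    by rewrite S4 sS !inE tS eq_sym st /=; clear; lia.
  case/card_gt1P => u [w []]; rewrite !inE => /and3P[ut us uS] /and3P[wt ws wS].
  by move=> uw; exists u, w; rewrite !inE (negPf us) (negPf ut) (negPf ws) (negPf wt).
move: ust wst; rewrite !inE !negb_or => /andP[us ut] /andP[ws wt].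
have ts : t != s by rewrite eq_sym.
have qS x : x \in S -> x \notin q.
  by move=> xS; apply/negP => /(allP aq); rewrite /= xS.
have u1 : ucycle (adj B) (s :: q ++ [:: t]).
  by apply: (ear_ucycle qp uq aq); rewrite /= ?inE ?st ?sS ?tS //= SA.
have u2 : ucycle (adj B) (s :: q ++ [:: t; u; w]).
  apply: (ear_ucycle qp uq aq) => /=; last by rewrite sS tS uS wS.
    by rewrite !SA // eq_sym.
  by rewrite !inE !negb_or st (eq_sym s) us (eq_sym s) ws (eq_sym t) ut (eq_sym t) wt uw.
have [oq|oq] := boolP (odd (size q)).
  have ut' : ucycle (adj B) [:: s; u; w].
    rewrite /ucycle /= !inE negb_or (eq_sym s) us (eq_sym s) ws uw !SA //.
    by rewrite eq_sym.
  have [||x [y [xy xc xd yc yd]]] := C2 _ _ u1 ut'; rewrite /= ?size_cat //=.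
    by rewrite addn1 /= oq.
  have only z : z \in s :: q ++ [:: t] -> z \in [:: s; u; w] -> z = s.
    move=> zc; rewrite !inE => /or3P[/eqP//|/eqP zE|/eqP zE]; move: zc;
    by rewrite zE in_cons mem_cat inE ?(negPf us) ?(negPf ut) ?(negPf ws)
      ?(negPf wt) ?(negPf (qS _ uS)) ?(negPf (qS _ wS)).
  by move: xy; rewrite (only x) // (only y) // eqxx.
have := C1 _ u2; rewrite /= size_cat /= !addnS addn0 => /(_ isT) /=.
by rewrite !negbK => /(_ oq) [] /size0nil q0'; rewrite q0' in q0.
Qed.

(** Every vertex of a shortest odd cycle has a twin: a vertex outside the cycle
    with the same two neighbours on it. If the cycle is a triangle, two equal
    twins complete it to a [K_4], while three distinct ones alternate with its
    vertices in a six-cycle. On a longer cycle the twins of two consecutive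
    vertices [c0] and [c1] differ, as there is no triangle, and occur in the
    six-cycle that goes from the neighbours of [c0] and [c1] outside through
    both vertices and both twins. *)
Lemma no_apex_K4 (V : finType) (B : graph V) c :
  biconnected B -> even_cycles_short (adj B) -> odd_cycles_meet (adj B) ->
  ucycle (adj B) c -> odd (size c) ->
  (forall x, x \in verts B -> exists d, ucycle (off (adj B) x) d /\ odd (size d)) ->
  is_complete 4 B.
Proof.
move=> Bbi C1 C2 uc' oc' noap.
have [{uc' oc'}c [uc oc mn]] := shortest_odd_cycle uc' oc'.
have irr := adj_irr B.
have sc : 1 < size c.
  case: c uc oc mn => [//|x [|//]] /andP[] /=; by rewrite irr.
have tw i x p : rot i c = x :: p ->
    exists w, [/\ w \notin c, adj B w (head w p) & adj B w (last w p)].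
  move=> cE; have uxp : ucycle (adj B) (x :: p) by rewrite -cE ucycle_rot.
  have oxp : odd (size (x :: p)) by rewrite -cE size_rot.
  have xc : x \in c by rewrite -(mem_rot i) cE inE eqxx.
  have xB : x \in verts B by apply: cycle_verts sc _ xc; case/andP: uc.
  have [d [ud od]] := noap x xB.
  have [|w [wn wh wl]] := twin (adjC B) C1 C2 uxp oxp _ ud od.
    by rewrite -cE size_rot.
  by exists w; split=> //; rewrite -(mem_rot i) cE.
case: c uc oc mn sc tw => [//|c0 [//|c1 [//|c2 p]]] uc oc mn _ tw.
have [d0 [d0n d01 d0l]] := tw 0 c0 [:: c1, c2 & p] (rot0 _).
have [d1 [d1n d12 d1l]] := tw 1 c1 (rcons (c2 :: p) c0) (rot1_cons _ _).
case: p uc oc mn tw d0n d01 d0l d1n d12 d1l => [|c3 p] uc oc mn tw.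
  move=> /= d0n d01 d02 d1n d12 d10.
  have [d2 [d2n d20 d21]] := tw 2 c2 [:: c0; c1] erefl.
  move: uc d0n d1n d2n d20 d21 => /andP[/= /and4P[a01 a12 a20 _]].
  rewrite /= !inE !negb_or => /and3P[/andP[n01 n02] n12 _].
  move=> /and3P[m00 m01 m02] /and3P[m10 m11 m12] /and3P[m20 m21 m22] d20 d21.
  have K4 d : d != c0 -> d != c1 -> d != c2 -> adj B d c0 -> adj B d c1 ->
      adj B d c2 -> is_complete 4 B.
    move=> e0 e1 e2 f0 f1 f2.
    apply: (@K4_maximal _ B [set x in [:: d; c0; c1; c2]]) => //.
      rewrite cardsE; apply/card_uniqP.
      by rewrite /= !inE !negb_or e0 e1 e2 n01 n02 n12.
    move=> x y; rewrite !inE.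
    by case/or4P => /eqP -> /or4P[] /eqP ->; rewrite ?eqxx // => _; rewrite // adjC.
  have [e01|e01] := eqVneq d0 d1; first by apply: (K4 d0) => //; rewrite e01.
  have [e02|e02] := eqVneq d0 d2; first by apply: (K4 d0) => //; rewrite e02.
  have [e12|e12] := eqVneq d1 d2; first by apply: (K4 d1) => //; rewrite e12.
  have u6 : ucycle (adj B) [:: c0; d2; c1; d0; c2; d1].
    rewrite /ucycle; apply/andP; split; last by distinct.
    by rewrite /= adjC d20 d21 adjC d01 d02 adjC d12 d10.
  by have := C1 _ u6 isT isT.
set cl := last c3 p; rewrite /= -/cl last_rcons => d0n d01 d0l d1n d12 d1l.
have clc : cl \in c3 :: p by rewrite /cl mem_last.
have [cc uuc] := andP uc.
have clc0 : adj B cl c0.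
  by move: cc; rewrite /= rcons_path => /and4P[_ _ _ /andP[]].
have c12 : adj B c1 c2 by move: cc => /= /and3P[].
have nb x y : x \in [:: c0, c1, c2, c3 & p] -> y \notin [:: c0, c1, c2, c3 & p] -> x != y.
  by move=> xc; apply: contraNneq => <-.
have c0c : c0 \in [:: c0, c1, c2, c3 & p] by rewrite inE eqxx.
have c1c : c1 \in [:: c0, c1, c2, c3 & p] by rewrite !inE eqxx orbT.
have c2c : c2 \in [:: c0, c1, c2, c3 & p] by rewrite !inE eqxx !orbT.
have clc' : cl \in [:: c0, c1, c2, c3 & p] by rewrite 3!in_cons clc !orbT.
have [n01 n02 n12 [n0l n1l n2l]] : [/\ c0 != c1, c0 != c2, c1 != c2 &
    [/\ cl != c0, cl != c1 & cl != c2]].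
  move: uuc; rewrite -[uniq _]/(uniq ([:: c0; c1; c2] ++ c3 :: p)) cat_uniq.
  case/and3P=> + /hasPn h _; have := h cl clc => /=.
  by rewrite !inE !negb_or !andbT => /and3P[-> -> ->] /andP[/andP[-> ->] ->].
have d01' : d0 != d1.
  apply/negP => /eqP e; have u3 : ucycle (adj B) [:: d0; cl; c0].
    have [m0l m00] := conj (nb _ _ clc' d0n) (nb _ _ c0c d0n).
    rewrite /ucycle; apply/andP; split; last by distinct.
    by rewrite /= d0l clc0 adjC e d1l.
  have := mn _ u3 isT; rewrite /=; by [].
have u6 : ucycle (adj B) [:: cl; d0; c1; c2; d1; c0].
  have [m0l m00 m01 m02] := And4 (nb _ _ clc' d0n) (nb _ _ c0c d0n)
    (nb _ _ c1c d0n) (nb _ _ c2c d0n).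
  have [m1l m10 m11 m12] := And4 (nb _ _ clc' d1n) (nb _ _ c0c d1n)
    (nb _ _ c1c d1n) (nb _ _ c2c d1n).
  rewrite /ucycle; apply/andP; split; last by distinct.
  by rewrite /= adjC d0l d01 c12 adjC d12 d1l adjC clc0.
by have := C1 _ u6 isT isT.
Qed.

(** * Graphs whose block tree is a path *)

Section Separation.
Variables (W : finType) (R : graph W) (V1 V2 : {set W}) (u : W).

Definition separation :=
  [/\ V1 :&: V2 = [set u], V1 :|: V2 = verts R &
      forall x y, adj R x y ->
        (x \in V1 /\ y \in V1) \/ (x \in V2 /\ y \in V2)].

Hypotheses (cR : connected R) (sep : separation).

Lemma sep_u : u \in V1 /\ u \in V2.
Proof.
case: sep => /setP/(_ u); rewrite !inE eqxx => /andP[-> ->] _ _; by [].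
Qed.

Lemma sep_both x : x \in V1 -> x \in V2 -> x = u.
Proof. by case: sep => /setP/(_ x) + _ _ x1 x2; rewrite !inE x1 x2 => /esym/eqP. Qed.

Lemma sep_sub1 x : x \in V1 -> x \in verts R.
Proof. by case: sep => _ <- _ x1; rewrite inE x1. Qed.

Lemma sub_part1 : subgraph (induced R V1) R.
Proof. by apply: subgraph_induced; apply/subsetP => x; apply: sep_sub1. Qed.

(** Only [u] gives access to the other part. *)
Lemma follow (e : rel W) x y : subrel e (adj R) ->
  x \in V1 -> connect e x y ->
  let e1 := [rel a b | [&& e a b, a \in V1 & b \in V1]] in
  (y \in V1 /\ connect e1 x y) \/ connect e1 x u.
Proof.
move=> eR + /connectP [p + ->] e1.
elim: p x => [|z p IH] x xV /=; first by left.
case/andP=> xz zp; have [zV|zV] := boolP (z \in V1).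
  have xz1 : connect e1 x z by apply: connect1; rewrite /= xz xV zV.
  case: (IH z zV zp) => [[lV c]|c]; last by right; apply: connect_trans xz1 c.
  by left; split=> //; apply: connect_trans xz1 c.
right; case: sep => _ _ /(_ _ _ (eR _ _ xz)) [[_ h]|[x2 _]].
  by rewrite h in zV.
by rewrite (sep_both xV x2).
Qed.

Lemma part_to_u v x : x \in V1 -> connect (off (adj R) v) x u ->
  connect (off (adj (induced R V1)) v) x u.
Proof.
move=> xV c; have h : connect
    [rel a b | [&& off (adj R) v a b, a \in V1 & b \in V1]] x u.
  by case: (follow (@off_sub _ (adj R) v) xV c) => [[]|].
apply: connect_mono h => a b /= /and3P[/and3P[av bv ab] aV bV].
by rewrite /off /= av bv adj_induced aV bV ab.
Qed.

Lemma part_connected : connected (induced R V1).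
Proof.
have [u1 _] := sep_u; have /connectedP [_ c] := cR.
apply/connectedP; split; first by apply/set0Pn; exists u.
have cu x : x \in V1 -> connect (adj (induced R V1)) x u.
  move=> xV; have h : connect [rel a b | [&& adj R a b, a \in V1 & b \in V1]] x u.
    by case: (follow (fun a b ab => ab) xV (c _ _ (sep_sub1 xV) (sep_sub1 u1))) => [[]|].
  by apply: connect_mono h => a b /= /and3P[ab aV bV]; rewrite adj_induced aV bV ab.
move=> x y xV yV; apply: connect_trans (cu x xV) _.
by rewrite connect_symG; apply: cu.
Qed.

Lemma part_noncut v : v != u -> ~~ cut_vertex R v ->
  ~~ cut_vertex (induced R V1) v.
Proof.
move=> vu /(cut_vertexPn _ cR) h; apply/cut_vertexPn; first exact: part_connected.
have [u1 _] := sep_u; have uv : u != v by rewrite eq_sym.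
move=> x y xV yV xv yv; apply: (@connect_trans _ _ u).
  by apply: part_to_u => //; apply: h => //; apply: sep_sub1.
rewrite connect_symO.
by apply: part_to_u => //; apply: h => //; apply: sep_sub1.
Qed.

Lemma off_stay x y : connect (off (adj R) u) x y -> x \in V1 -> x != u -> y \in V1.
Proof.
move=> /connectP [p + ->]; elim: p x => [|z p IH] x //= /andP[/and3P[_ zu xz] zp].
move=> xV xu; apply: (IH z) => //; case: sep => _ _ /(_ _ _ xz) [[]//|[x2 _]].
by rewrite (sep_both xV x2) eqxx in xu.
Qed.

End Separation.

Lemma separation_sym (W : finType) (R : graph W) V1 V2 u :
  separation R V1 V2 u -> separation R V2 V1 u.
Proof.
case=> h1 h2 h3; split; rewrite 1?setIC 1?setUC // => x y /h3 [].
  by right.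
by left.
Qed.

Section SeparationBlocks.
Variables (W : finType) (R : graph W) (V1 V2 : {set W}) (u x1 x2 : W).
Hypotheses (cR : connected R) (sep : separation R V1 V2 u).
Hypotheses (x1V : x1 \in V1) (x1u : x1 != u) (x2V : x2 \in V2) (x2u : x2 != u).

Let sep' := separation_sym sep.
Let R1 := induced R V1.
Let R2 := induced R V2.

Lemma sep_cut v :
  cut_vertex R v = [|| v == u, cut_vertex R1 v | cut_vertex R2 v].
Proof.
have [->|vu] /= := eqVneq v u.
  apply/negPn; apply/(cut_vertexPn _ cR) => h.
  have c := h _ _ (sep_sub1 sep x1V) (sep_sub1 sep' x2V) x1u x2u.
  have := off_stay sep c x1V x1u => x2V1.
  by have := x2u; rewrite (sep_both sep x2V1 x2V) eqxx.
apply/idP/idP => [|/orP[]]; last first.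
- by apply: contraTT => h; apply: (part_noncut cR sep').
- by apply: contraTT => h; apply: (part_noncut cR sep).
apply: contraTT; rewrite negb_or => /andP[/cut_vertexPn h1 /cut_vertexPn h2].
have {}h1 := h1 (part_connected cR sep).
have {}h2 := h2 (part_connected cR sep').
have [u1 u2] := sep_u sep; have uv : u != v by rewrite eq_sym.
apply/(cut_vertexPn _ cR).
have sub V : subrel (off (adj (induced R V)) v) (off (adj R) v).
  by move=> a b /and3P[av bv]; rewrite adj_induced /off /= av bv => /and3P[].
have cu x : x \in verts R -> x != v -> connect (off (adj R) v) x u.
  case: (sep) => _ <- _; rewrite inE => /orP[xV|xV] xv.
    by apply: connect_mono (sub V1) _; apply: h1.
  by apply: connect_mono (sub V2) _; apply: h2.
move=> x y xR yR xv yv; apply: connect_trans (cu x xR xv) _.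
by rewrite connect_symO; apply: cu.
Qed.

(** Vertices on both sides would be separated by [u]. *)
Lemma sep_bicon H : biconnected H -> subgraph H R ->
  subgraph H R1 \/ subgraph H R2.
Proof.
move=> /biconnectedP [_ bH] HR.
have side (V : {set W}) : verts H \subset V -> subgraph H (induced R V).
  move=> HV; apply: subgraphI => [x /(subsetP HV)//|x y xy].
  rewrite adj_induced (subsetP HV _ (adj_vl xy)) (subsetP HV _ (adj_vr xy)).
  exact: subgraph_adj HR xy.
have [h|/subsetPn [x xH xV]] := boolP (verts H \subset V1); first by left; apply: side.
right; apply: side; apply/subsetP => y yH; apply/negPn/negP => yV.
have [u1 u2] := sep_u sep.
have xu : x != u by apply: contraNneq xV => ->.
have yu : y != u by apply: contraNneq yV => ->.
have c : connect (off (adj R) u) y x.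
  apply: connect_mono (bH u y x yH xH yu xu) => a b /and3P[au bu ab].
  by rewrite /off /= au bu (subgraph_adj HR ab).
have yV1 : y \in V1.
  by have := subgraph_vert HR yH; case: (sep) => _ <- _; rewrite inE (negPf yV) orbF.
by rewrite (off_stay sep c yV1 yu) in xV.
Qed.

Lemma sep_block_of B : is_block R B -> is_block R1 B \/ is_block R2 B.
Proof.
move=> bB.
have bl V : subgraph (induced R V) R -> subgraph B (induced R V) ->
    is_block (induced R V) B.
  move=> VR BV; rewrite /is_block BV (block_bicon bB) /=.
  apply/forallP => H; apply/implyP => /and3P[BH HV bH]; apply/eqP.
  exact: block_max bB BH (subgraph_trans HV VR) bH.
case: (sep_bicon (block_bicon bB) (block_sub bB)) => h; [left|right].
  by apply: bl h; apply: sub_part1 sep.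
by apply: bl h; apply: sub_part1 sep'.
Qed.

End SeparationBlocks.

(** A biconnected graph containing [B] lies in one part. It cannot be the other
    one, which has only [u] in common with this part, as [B] has an edge. *)
Lemma sep_block_part (W : finType) (R : graph W) V1 V2 u x1 B :
  connected R -> separation R V1 V2 u -> x1 \in V1 -> x1 != u ->
  is_block (induced R V1) B -> is_block R B.
Proof.
move=> cR sep x1V x1u bB.
have [u1 u2] := sep_u sep; have sep' := separation_sym sep.
have cR1 := part_connected cR sep.
rewrite /is_block (subgraph_trans (block_sub bB) (sub_part1 sep)).
rewrite (block_bicon bB) /=; apply/forallP => H; apply/implyP => /and3P[BH HR bH].
apply/eqP; case: (sep_bicon sep bH HR) => h.
  exact: block_max bB BH h bH.
have [z uz] := connected_nbr cR1 x1V u1 x1u.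
have [a [b ab]] := block_has_edge cR1 uz bB.
have inu c : c \in verts B -> c = u.
  move=> cB; apply: (sep_both sep); first exact: subgraph_vert (block_sub bB) cB.
  exact: subgraph_vert h (subgraph_vert BH cB).
by move: (adj_neq ab); rewrite (inu a (adj_vl ab)) (inu b (adj_vr ab)) eqxx.
Qed.

(** The edge [ab] would make [R] biconnected. Equivalently, the block tree of
    [R] is a path, and [a] and [b] lie in the blocks at its two ends and are no
    cut vertices; the present form passes to the two sides of a cut vertex. *)
Definition two_ended (W : finType) (R : graph W) (a b : W) :=
  [/\ connected R, a \in verts R, b \in verts R, a != b &
      forall u w, w \in verts R -> w != u ->
        connect (off (adj R) u) w a \/ connect (off (adj R) u) w b].

Lemma two_ended_sym (W : finType) (R : graph W) a b :
  two_ended R a b -> two_ended R b a.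
Proof.
case=> c aR bR ab h; split; rewrite 1?eq_sym // => u w wR wu.
by case: (h u w wR wu); [right|left].
Qed.

Lemma two_ended_noncut (W : finType) (R : graph W) a b :
  two_ended R a b -> ~~ cut_vertex R a.
Proof.
case=> c aR bR ab h; apply/(cut_vertexPn _ c).
have cb x : x \in verts R -> x != a -> connect (off (adj R) a) x b.
  move=> xR xa; case: (h a x xR xa) => // /connect_off_neq /(_ xa).
  by rewrite eqxx.
move=> x y xR yR xa ya; apply: connect_trans (cb x xR xa) _.
by rewrite connect_symO; apply: cb.
Qed.

Definition side (W : finType) (R : graph W) (u a : W) : {set W} :=
  u |: [set w | connect (off (adj R) u) a w].

(** Without [u] every vertex is still connected to [a] or to [b], but [a] and
    [b] are not connected to each other, or [u] would not be a cut vertex. *)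
Lemma two_ended_separation (W : finType) (R : graph W) a b u :
  two_ended R a b -> cut_vertex R u ->
  [/\ a != u, b != u & separation R (side R u a) (side R u b) u].
Proof.
move=> te cu; have [c aR bR ab h] := te.
have au : a != u by apply: contraTneq cu => <-; apply: two_ended_noncut te.
have bu : b != u.
  by apply: contraTneq cu => <-; apply: two_ended_noncut (two_ended_sym te).
have nab : ~~ connect (off (adj R) u) a b.
  apply: contraL cu => cab; apply/(cut_vertexPn _ c).
  have cb x : x \in verts R -> x != u -> connect (off (adj R) u) x b.
    by move=> xR xu; case: (h u x xR xu) => // xa; apply: connect_trans xa cab.
  move=> x y xR yR xa ya; apply: connect_trans (cb x xR xa) _.
  by rewrite connect_symO; apply: cb.
have uR : u \in verts R by case/andP: cu.
split=> //; split.
- apply/setP => x; rewrite !inE; have [//|xu] /= := eqVneq x u.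
  apply/negP => /andP[ca cb]; case/negP: nab; apply: connect_trans ca _.
  by rewrite connect_symO.
- apply/setP => x; rewrite !inE; have [->|xu] /= := eqVneq x u; first by rewrite uR.
  apply/orP/idP => [|xR].
    by case=> cx; apply: (connect_verts (connect_mono (@off_sub _ _ u) cx)).
  by rewrite !(connect_symO R u _ x); apply: h.
move=> x y xy; have xR := adj_vl xy; have yR := adj_vr xy; rewrite !inE.
have go a' : x != u -> y != u -> connect (off (adj R) u) a' x ->
    connect (off (adj R) u) a' y.
  by move=> xu yu cx; apply: connect_trans cx (connect1 _); rewrite /off /= xu yu.
have [xu|xu] /= := eqVneq x u.
  have [yu|yu] /= := eqVneq y u; first by left.
  by rewrite !(connect_symO R u _ y); case: (h u y yR yu) => ->; [left|right].
have [yu|yu] /= := eqVneq y u.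
  by rewrite !(connect_symO R u _ x); case: (h u x xR xu) => ->; [left|right].
by case: (h u x xR xu); rewrite connect_symO => hx; rewrite hx (go _ xu yu hx);
  [left|right].
Qed.

(** A walk towards [b] has to leave the part through [u]. *)
Lemma two_ended_part (W : finType) (R : graph W) a b u :
  two_ended R a b -> cut_vertex R u ->
  two_ended (induced R (side R u a)) a u.
Proof.
move=> te cu; have [au bu sep] := two_ended_separation te cu.
have [c aR bR ab h] := te.
split; rewrite ?inE ?eqxx ?connect0 ?orbT //; first exact: part_connected sep.
move=> v w wV wv; have wR := sep_sub1 sep wV.
have inV e' : subrel e' (off (adj R) v) -> forall x y,
   connect [rel p q | [&& e' p q, p \in side R u a & q \in side R u a]] x y ->
   connect (off (adj (induced R (side R u a))) v) x y.
  move=> s x y; apply: connect_mono => p q /= /and3P[/s/and3P[pv qv pq] pV qV].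
  by rewrite /off /= pv qv adj_induced pV qV.
case: (h v w wR wv) => cw.
  case: (follow sep (@off_sub _ (adj R) v) wV cw) => [[_ cw']|cw'].
    by left; apply: inV cw'.
  by right; apply: inV cw'.
right; case: (follow sep (@off_sub _ (adj R) v) wV cw) => [[bV _]|cw'].
  have b2 : b \in side R u b by rewrite !inE connect0 orbT.
  by rewrite (sep_both sep bV b2) eqxx in bu.
by apply: inV cw'.
Qed.

Definition tree_node (W : finType) (R : graph W) (z : graph W + W) : bool :=
  match z with inl B => is_block R B | inr u => cut_vertex R u end.

Definition tree_link (W : finType) (z w : graph W + W) : bool :=
  match z, w with
  | inl B, inr u | inr u, inl B => u \in verts B
  | _, _ => false
  end.

(** The block tree of [R] is the path [inl Bf :: t], from the only block
    containing [a] to the only block containing [b]. *)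
Definition block_chain (W : finType) (R : graph W) a b Bf t Bl :=
  [/\ uniq (inl Bf :: t),
      forall z, (z \in inl Bf :: t) = tree_node R z,
      forall z w, (z, w) \in zip (inl Bf :: t) t -> tree_link z w,
      forall z w, tree_node R z -> tree_node R w -> tree_link z w ->
        ((z, w) \in zip (inl Bf :: t) t) || ((w, z) \in zip (inl Bf :: t) t) &
      [/\ last (inl Bf) t = inl Bl,
          a \in verts Bf, b \in verts Bl,
          forall B, is_block R B -> a \in verts B -> B = Bf &
          forall B, is_block R B -> b \in verts B -> B = Bl]].

Lemma zip_behead_cat (T : Type) (x : T) t y t' :
  zip (x :: t ++ y :: t') (t ++ y :: t') =
  zip (x :: t) t ++ (last x t, y) :: zip (y :: t') t'.
Proof. by elim: t x => [//|z t IH] x; rewrite /= -IH. Qed.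

Lemma block_chain_single (W : finType) (R : graph W) a b :
  connected R -> (forall u, ~~ cut_vertex R u) ->
  a \in verts R -> b \in verts R -> block_chain R a b R [::] R.
Proof.
move=> cR nc aR bR.
have bicR : biconnected R by rewrite /biconnected cR; apply/forallP.
have bR' : is_block R R.
  rewrite /is_block subgraph_refl bicR /=; apply/forallP => H.
  by apply/implyP => /and3P[h1 h2 _]; apply/eqP; apply: subgraph_anti.
have only B : is_block R B -> B = R.
  by move=> bB; rewrite (block_max bB (block_sub bB) (subgraph_refl R) bicR).
split=> //.
- move=> [B|v]; rewrite inE /=; last by rewrite (negPf (nc v)).
  by apply/eqP/idP => [[->]//|/only ->].
- move=> [B|v] [B'|v'] //= h1 h2; last by rewrite (negPf (nc v)) in h1.
  by rewrite (negPf (nc v')) in h2.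
by split=> // B /only.
Qed.

(** The blocks and cut vertices of [R] are those of its two parts, together
    with [u]. Only the last block of the first chain and the first block of the
    second one contain [u]. *)
Lemma block_chain_join (W : finType) (R : graph W) V1 V2 u a b B1 t1 C1 B2 t2 C2 :
  connected R -> separation R V1 V2 u ->
  a \in V1 -> a != u -> b \in V2 -> b != u ->
  ~~ cut_vertex (induced R V1) u -> ~~ cut_vertex (induced R V2) u ->
  block_chain (induced R V1) a u B1 t1 C1 ->
  block_chain (induced R V2) u b B2 t2 C2 ->
  block_chain R a b B1 (t1 ++ inr u :: inl B2 :: t2) C2.
Proof.
move=> cR sep aV au bV bu nc1 nc2.
move=> [u1 n1 l1 k1 [la1 af1 bl1 fa1 lb1]] [u2 n2 l2 k2 [la2 af2 bl2 fa2 lb2]].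
have sep' := separation_sym sep.
have [uV1 uV2] := sep_u sep.
have cutE := sep_cut cR sep aV au bV bu.
have blockE B : is_block R B = is_block (induced R V1) B || is_block (induced R V2) B.
  apply/idP/orP => [/(sep_block_of sep)//|[]].
    exact: sep_block_part cR sep aV au.
  exact: sep_block_part cR sep' bV bu.
have v1 B x : is_block (induced R V1) B -> x \in verts B -> x \in V1.
  by move=> bB; apply: subgraph_vert (block_sub bB).
have v2 B x : is_block (induced R V2) B -> x \in verts B -> x \in V2.
  by move=> bB; apply: subgraph_vert (block_sub bB).
have cv1 v : cut_vertex (induced R V1) v -> v \in V1 by case/andP.
have cv2 v : cut_vertex (induced R V2) v -> v \in V2 by case/andP.
have disj z : tree_node (induced R V1) z -> tree_node (induced R V2) z -> False.
  case: z => [B|v] /= h1 h2; last first.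
    have e := sep_both sep (cv1 _ h1) (cv2 _ h2).
    by rewrite e (negPf nc1) in h1.
  have [z uz] := connected_nbr (part_connected cR sep) aV uV1 au.
  have [p [q pq]] := block_has_edge (part_connected cR sep) uz h1.
  have inu c : c \in verts B -> c = u.
    by move=> cB; apply: (sep_both sep); [apply: v1 h1 cB|apply: v2 h2 cB].
  by move: (adj_neq pq); rewrite (inu p (adj_vl pq)) (inu q (adj_vr pq)) eqxx.
have bB1 : is_block (induced R V1) B1.
  by have := mem_head (inl B1) t1; rewrite n1.
have bC1 : is_block (induced R V1) C1.
  by have := mem_last (inl B1) t1; rewrite la1 n1.
have bB2 : is_block (induced R V2) B2.
  by have := mem_head (inl B2) t2; rewrite n2.
have sE : inl B1 :: t1 ++ inr u :: inl B2 :: t2 =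
   (inl B1 :: t1) ++ inr u :: (inl B2 :: t2) by [].
have nE z : tree_node R z = [|| tree_node (induced R V1) z, z == inr u |
     tree_node (induced R V2) z].
  case: z => [B|v] /=; first by rewrite blockE.
  by rewrite cutE orbCA.
have zE z w : (z, w) \in zip (inl B1 :: t1 ++ inr u :: inl B2 :: t2)
       (t1 ++ inr u :: inl B2 :: t2) =
   [|| (z, w) \in zip (inl B1 :: t1) t1, (z, w) == (inl C1, inr u),
       (z, w) == (inr u, inl B2) | (z, w) \in zip (inl B2 :: t2) t2].
  by rewrite zip_behead_cat mem_cat la1 in_cons [zip (inr u :: _) _]/= in_cons.
split.
- have nu : inr u \notin inl B2 :: t2 by rewrite n2 /= nc2.
  rewrite sE cat_uniq u1 cons_uniq u2 nu !andbT andTb; apply/hasPn => z.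
  rewrite in_cons => /orP[/eqP ->|]; first by rewrite n1 /= nc1.
  by rewrite n2 n1 => h2; apply/negP => h1; apply: disj h1 h2.
- by move=> z; rewrite sE mem_cat n1 in_cons n2 nE.
- move=> z w; rewrite zE => /or4P[/l1//|/eqP[-> ->]//|/eqP[-> ->]//|/l2//].
- have half B v : is_block R B -> cut_vertex R v -> v \in verts B ->
      let s := inl B1 :: t1 ++ inr u :: inl B2 :: t2 in
      ((inl B, inr v) \in zip s (behead s)) || ((inr v, inl B) \in zip s (behead s)).
    rewrite /= !zE blockE cutE => hB hv vB.
    case/or3P: hv => [/eqP ve|hv|hv].
    + rewrite ve in vB *; case/orP: hB => hB.
        by rewrite (lb1 _ hB vB) eqxx !orbT.
      by rewrite (fa2 _ hB vB) eqxx !orbT.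
    + case/orP: hB => hB.
        have := k1 (inl B) (inr v) hB hv vB.
        by case/orP=> ->; rewrite ?orbT.
      have e := sep_both sep (cv1 _ hv) (v2 _ _ hB vB).
      by rewrite e (negPf nc1) in hv.
    + case/orP: hB => hB; last first.
        have := k2 (inl B) (inr v) hB hv vB.
        by case/orP=> ->; rewrite ?orbT.
      have e := sep_both sep (v1 _ _ hB vB) (cv2 _ hv).
      by rewrite e (negPf nc2) in hv.
  move=> [B|v] [B'|v'] //= h1 h2 h3; first exact: half.
  by rewrite orbC; apply: half.
split=> //.
- by rewrite last_cat.
- move=> B; rewrite blockE => /orP[/fa1//|hB] aB.
  by have := sep_both sep aV (v2 _ _ hB aB) => e; rewrite e eqxx in au.
- move=> B; rewrite blockE => /orP[hB|/lb2//] bB.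
  by have := sep_both sep (v1 _ _ hB bB) bV => e; rewrite e eqxx in bu.
Qed.

(** Cutting at a cut vertex leaves two graphs of the same kind. *)
Lemma two_ended_chain (W : finType) (R : graph W) a b :
  two_ended R a b -> exists Bf t Bl, block_chain R a b Bf t Bl.
Proof.
elim: {R}_.+1 {-2}R a b (ltnSn #|verts R|) => // n IH R a b sn te.
have [cR aR bR ab h] := te.
have [/existsP [u cu]|] := boolP [exists u, cut_vertex R u]; last first.
  rewrite negb_exists => /forallP nc.
  by exists R, [::], R; apply: block_chain_single.
have [au bu sep] := two_ended_separation te cu.
have sep' := separation_sym sep.
have te1 := two_ended_part te cu.
have te2 := two_ended_part (two_ended_sym te) cu.
have aS : a \in side R u a by rewrite !inE connect0 orbT.
have bS : b \in side R u b by rewrite !inE connect0 orbT.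
have lt1 : #|side R u a| < #|verts R|.
  apply: proper_card; apply/properP; split.
    by apply/subsetP => x; apply: sep_sub1 sep _.
  exists b => //; apply/negP => bS'.
  by rewrite (sep_both sep bS' bS) eqxx in bu.
have lt2 : #|side R u b| < #|verts R|.
  apply: proper_card; apply/properP; split.
    by apply/subsetP => x; apply: sep_sub1 sep' _.
  exists a => //; apply/negP => aS'.
  by rewrite (sep_both sep aS aS') eqxx in au.
have [B1 [t1 [C1 ch1]]] := IH (induced R (side R u a)) a u (leq_trans lt1 sn) te1.
have [B2 [t2 [C2 ch2]]] := 
  IH (induced R (side R u b)) u b (leq_trans lt2 sn) (two_ended_sym te2).
exists B1, (t1 ++ inr u :: inl B2 :: t2), C2.
apply: (block_chain_join cR sep aS au bS bu _ _ ch1 ch2).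
  exact: two_ended_noncut (two_ended_sym te1).
exact: two_ended_noncut (two_ended_sym te2).
Qed.

(** * Presenting a chain of blocks as in the definition of the block tree *)

Lemma set2_eq (T : finType) (a b c d : T) :
  [set a; b] = [set c; d] -> (a = c /\ b = d) \/ (a = d /\ b = c).
Proof.
move=> E; have : a \in [set c; d] by rewrite -E !inE eqxx.
have : b \in [set c; d] by rewrite -E !inE eqxx orbT.
have : c \in [set a; b] by rewrite E !inE eqxx.
have : d \in [set a; b] by rewrite E !inE eqxx orbT.
rewrite !inE => dab cab bcd acd.
case/orP: acd => /eqP ac; case/orP: bcd => /eqP bd; first 1 last.
- by left.
- by right.
- by right; split=> //; case/orP: cab => /eqP cE; rewrite cE ?ac ?bd.
by left; split=> //; case/orP: dab => /eqP dE; rewrite dE ?ac ?bd.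
Qed.

Lemma adj_block_tree (W : finType) (R : graph W) z w :
  adj (block_tree R) z w = [&& tree_node R z, tree_node R w & tree_link z w].
Proof.
rewrite /adj /edges /= inE subUset !sub1set !inE.
have nodeE y : (match y with inl B => is_block R B | inr v => cut_vertex R v end)
    = tree_node R y by case: y.
rewrite !nodeE cards2; apply/andP/and3P.
  case=> /imsetP [[B v]]; rewrite inE /= => vB /set2_eq E.
  case/andP=> /andP[nz nw] _; split=> //.
  by case: E => [[-> ->]|[-> ->]].
case=> nz nw lk; split.
  apply/imsetP; case: z w nz nw lk => [B|v] [B'|v'] // _ _ lk.
    by exists (B, v'); rewrite ?inE.
  by exists (B', v); rewrite ?inE // setUC.
rewrite nz nw /=; case: z w lk {nz nw} => [B|v] [B'|v'] //.
Qed.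

Lemma block_chain_path_along (W : finType) (R : graph W) a b Bf t Bl :
  block_chain R a b Bf t Bl -> is_path_along (block_tree R) (inl Bf :: t).
Proof.
case=> us n l k _; split=> //.
  by apply/setP => z; rewrite !inE -in_cons n; case: z.
apply/setP => f; apply/idP/imsetP.
  move/edge_adj=> [z [w [-> ]]]; rewrite adj_block_tree => /and3P[nz nw lk].
  case/orP: (k z w nz nw lk) => h; first by exists (z, w).
  by exists (w, z); rewrite // setUC.
case=> [[z w]] /= h ->.
have /andP[zs ws] : (z \in inl Bf :: t) && (w \in inl Bf :: t).
  move: h; elim: {us n l k}t (inl Bf : graph W + W) => [//|y t IH] x /=.
  rewrite in_cons => /orP[/eqP [-> ->]|/IH]; first by rewrite !inE !eqxx ?orbT.
  by case/andP=> h1 h2; rewrite in_cons h1 in_cons h2 !orbT.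
have := adj_block_tree R z w; rewrite /adj => ->.
by rewrite -!n zs ws (l _ _ h).
Qed.

(** * Splitting a vertex that meets all odd cycles gives a necklace *)

Definition rel_graph (V : finType) (A : {set V}) (e : rel V) : graph V :=
  mk_graph A [set [set p.1; p.2] | p : V * V & e p.1 p.2].

Lemma adj_rel_graph (V : finType) (A : {set V}) (e : rel V) :
  symmetric e -> irreflexive e -> (forall x y, e x y -> x \in A) ->
  adj (rel_graph A e) =2 e.
Proof.
move=> es ei eA x y; rewrite /adj /edges /= inE subUset !sub1set cards2.
apply/andP/idP => [[/imsetP [[a b]]]|xy].
  by rewrite inE /= => ab /set2_eq [[-> ->]|[-> ->]] _ //; rewrite es.
split; first by apply/imsetP; exists (x, y); rewrite ?inE.
rewrite (eA x y xy) (eA y x) ?[e y x]es //=.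
by rewrite eqSS eqb1; apply: contraTneq xy => ->; rewrite ei.
Qed.

Lemma imset_set2 (V W : finType) (f : V -> W) x y :
  f @: [set x; y] = [set f x; f y].
Proof. by rewrite imsetU1 imset_set1. Qed.

Lemma graph_isoI (V W : finType) (G : graph V) (H : graph W) (f : V -> W) :
  {in verts G &, injective f} -> f @: verts G = verts H ->
  {in verts G &, forall x y, adj G x y = adj H (f x) (f y)} -> graph_iso G H.
Proof.
move=> inj vE aE; exists f; split=> //; apply/setP => g; apply/imsetP/idP.
  case=> e /edge_adj [x [y [-> xy]]] ->; rewrite imset_set2.
  by move: (xy); rewrite aE ?(adj_vl xy) ?(adj_vr xy).
move/edge_adj => [a [b [-> ab]]].
have := adj_vl ab; have := adj_vr ab; rewrite -vE.
move=> /imsetP [y yG bE] /imsetP [x xG aE']; exists [set x; y].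
  by rewrite -[_ \in _]/(adj G x y) aE // -aE' -bE.
by rewrite imset_set2 aE' bE.
Qed.

Lemma mem_Some_imset (V : finType) (A : {set V}) x :
  (Some x \in Some @: A) = (x \in A).
Proof. by rewrite mem_imset //; apply: Some_inj. Qed.

Lemma mem_None_imset (V : finType) (A : {set V}) :
  (None \in Some @: A) = false.
Proof. by apply/negP => /imsetP [x _]. Qed.

Lemma verts_identify (W : finType) (R : graph W) x1 x2 :
  verts (identify R x1 x2) = None |: Some @: (verts R :\: [set x1; x2]).
Proof. by []. Qed.

Lemma adj_identify_Some (W : finType) (R : graph W) x1 x2 a b :
  adj (identify R x1 x2) (Some a) (Some b) =
  [&& a \notin [set x1; x2], b \notin [set x1; x2] & adj R a b].
Proof.
have E : Some @: [set a; b] = [set Some a; Some b] by apply: imset_set2.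
set r := RHS; rewrite /adj /edges /= !inE subUset !sub1set !inE /= !mem_Some_imset.
have dE : ([set Some a; Some b] \in
    [set Some @: (f : {set W}) | f in edges (delete_vertices R [set x1; x2])]) =
    r.
  rewrite /r -E mem_imset; last by apply: imset_inj; apply: Some_inj.
  have -> : ([set a; b] \in edges (delete_vertices R [set x1; x2])) =
      adj (induced R (verts R :\: [set x1; x2])) a b by [].
  rewrite adj_induced !in_setD; case ab: (adj R a b); rewrite ?andbF //.
  by rewrite (adj_vl ab) (adj_vr ab) !andbT.
rewrite dE.
have -> : ([set Some a; Some b] \in
    [set [set Some u; None] | u : W & adj R u x1 || adj R u x2]) = false.
  apply/negP => /imsetP [u _] /setP/(_ None).
  by rewrite !inE orbT.
rewrite orbF; apply: andb_idr => /and3P[ha hb ab].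
rewrite !in_setD (negPf ha) (negPf hb) (adj_vl ab) (adj_vr ab) /=.
by rewrite cards2 (inj_eq Some_inj) (adj_neq ab).
Qed.

Lemma adj_identify_None (W : finType) (R : graph W) x1 x2 a :
  adj (identify R x1 x2) None (Some a) =
  (a \notin [set x1; x2]) && (adj R a x1 || adj R a x2).
Proof.
set r := RHS; rewrite /adj /edges /= !inE subUset !sub1set !inE /= !mem_Some_imset.
have -> : ([set None; Some a] \in
    [set Some @: (f : {set W}) | f in edges (delete_vertices R [set x1; x2])])
    = false.
  apply/negP => /imsetP [u _] /setP/(_ None).
  by rewrite !inE eqxx mem_None_imset.
have -> : ([set None; Some a] \in
    [set [set Some u; None] | u : W & adj R u x1 || adj R u x2]) =
    (adj R a x1 || adj R a x2).
  apply/imsetP/idP => [[u]|h]; last by exists a; rewrite ?inE // setUC.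
  by rewrite inE => h /set2_eq [[]//|[_ [->]]].
rewrite orFb cards2 /= andbT in_setD /r [RHS]andbC; case: (boolP (_ || _)) => h; rewrite ?andbF //.
rewrite !andTb; apply: andb_idr => _.
by case/orP: h; apply: adj_vl.
Qed.

Lemma distance_exists (V : finType) (G : graph V) x y :
  connect (adj G) x y -> exists d, is_distance G x y d.
Proof.
move=> /connectP [p pP lp].
pose P n := [exists t : n.-tuple V, path (adj G) x t && (last x t == y)].
have PP q : path (adj G) x q -> last x q = y -> P (size q).
  by move=> qP lq; apply/existsP; exists (in_tuple q); rewrite /= qP lq eqxx.
have exP : exists n, P n by exists (size p); apply: PP.
case: (ex_minnP exP) => n /existsP [t /andP[tP /eqP lt]] mn; exists n; split.
  by exists t; rewrite size_tuple.
by move=> q qP lq; apply: mn; apply: PP.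
Qed.

Section Split.
Variables (V : finType) (B : graph V) (x : V) (f : V -> bool).
Hypotheses (Bbi : biconnected B) (xB : x \in verts B) (nb : ~~ bipartite B).
Hypotheses (C1 : even_cycles_short (adj B)) (C2 : odd_cycles_meet (adj B)).
Hypothesis fP : colouring (off (adj B) x) f.

Definition split_rel : rel (option V) := fun a b =>
  match a, b with
  | Some y, Some z => adj B y z && (if y == x then f z else (z == x) ==> f y)
  | Some y, None | None, Some y => adj B x y && ~~ f y
  | None, None => false
  end.

(** Each of the two copies of [x] gets the neighbours of one colour, so that
    the result is bipartite: [Some x] those of colour [true], and the new
    vertex [None] the others. *)
Definition split_graph := rel_graph (None |: Some @: verts B) split_rel.

Lemma adj_split : adj split_graph =2 split_rel.
Proof.
apply: adj_rel_graph => [[a|] [b|]|[a|]|[a|] [b|]] //=.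
- rewrite adjC; case: eqP => [->|_]; case: eqP => [->|_] //=.
  by rewrite adj_irr.
- by case/andP=> /adj_vl aB _; rewrite !inE /= mem_Some_imset.
- by case/andP=> /adj_vr aB _; rewrite !inE /= mem_Some_imset.
by rewrite !inE.
Qed.

Definition split_colour (a : option V) : bool :=
  if a is Some y then (y != x) && f y else true.

Lemma split_colouring : colouring (adj split_graph) split_colour.
Proof.
move=> a b; rewrite adj_split; case: a b => [y|] [z|] //=; last first.
- by case/andP=> xz fz; rewrite (negPf fz) andbF.
- by case/andP=> xz fz; rewrite (negPf fz) andbF.
case/andP=> yz; have := adj_neq yz.
have [->|yx] /= := eqVneq y x; first by rewrite eq_sym => -> /= ->.
have [->|zx] //= := eqVneq z x; first by move=> _ ->.
by move=> _ _; apply: fP; rewrite /off /= yx zx yz.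
Qed.

(** If all neighbours of [x] had the same colour, then [x] could be given the
    other one. *)
Lemma split_nbr b : exists y, adj B x y && (f y == b).
Proof.
apply/existsP; apply: contraNT nb; rewrite negb_exists => /forallP h.
apply/bipartiteP; exists (fun z => if z == x then b else f z) => y z yz.
have H w : adj B x w -> f w = ~~ b.
  by move=> xw; have := h w; rewrite xw /=; case: (f w); case: (b).
have [yx|yx] := eqVneq y x; have [zx|zx] := eqVneq z x.
- by move: (adj_neq yz); rewrite yx zx eqxx.
- by rewrite yx in yz; rewrite (H _ yz); case: (b).
- by rewrite zx adjC in yz; rewrite (H _ yz); case: (b).
by apply: fP; rewrite /off /= yx zx yz.
Qed.

Lemma split_lift_off_x u y z : u = None \/ u = Some x ->
  connect (off (adj B) x) y z -> y != x ->
  connect (off (adj split_graph) u) (Some y) (Some z).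
Proof.
move=> uE c yx; move: c => /connectP [p + ->]; elim: p y yx => [|w p IH] y yx /=.
  by rewrite connect0.
case/andP=> /and3P[_ wx yw] wp; apply: connect_trans (IH w wx wp); apply: connect1.
rewrite /off /= adj_split /= yw (negPf yx) (negPf wx).
by case: uE => ->; rewrite //= !(inj_eq Some_inj) yx wx.
Qed.

Lemma off_x_connect y z : y \in verts B -> z \in verts B -> y != x -> z != x ->
  connect (off (adj B) x) y z.
Proof. by have /biconnectedP [_ h] := Bbi; apply: h. Qed.

(** A path of [B] to [x] becomes a path to one of the copies of [x]. When one
    of the copies is deleted, the paths of [B] avoiding [x] lead to a neighbour
    of the other one. *)
Lemma split_two_ended : two_ended split_graph (Some x) None.
Proof.
have [n1 /andP[xn1 /eqP f1]] := split_nbr true.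
have [n2 /andP[xn2 /eqP f2]] := split_nbr false.
have n1x : n1 != x by rewrite eq_sym; apply: adj_neq xn1.
have n2x : n2 != x by rewrite eq_sym; apply: adj_neq xn2.
have vS y : (Some y \in verts split_graph) = (y \in verts B).
  by rewrite !inE mem_Some_imset.
have cN y : y \in verts B ->
    connect (off (adj split_graph) None) (Some y) (Some x).
  move=> yB; have [->|yx] := eqVneq y x; first by rewrite connect0.
  have c := off_x_connect yB (adj_vr xn1) yx n1x.
  apply: connect_trans (split_lift_off_x (or_introl erefl) c yx) (connect1 _).
  by rewrite /off /= adj_split /= adjC xn1 (negPf n1x) eqxx f1.
have cR : connected split_graph.
  have all w : w \in verts split_graph -> connect (adj split_graph) w (Some x).
    case: w => [y|_]; first by rewrite vS => /cN; apply: connect_mono; apply: off_sub.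
    apply: (@connect_trans _ _ (Some n2)).
      by apply: connect1; rewrite adj_split /= xn2 f2.
    by apply: connect_mono (cN _ (adj_vr xn2)); apply: off_sub.
  apply/connectedP; split; first by apply/set0Pn; exists None; rewrite !inE.
  move=> a b aR bR; apply: connect_trans (all a aR) _.
  by rewrite connect_symG; apply: all.
split=> //; first by rewrite vS.
  by rewrite !inE.
move=> u [y|]; last by move=> _ _; right; rewrite connect0.
rewrite vS => yB yu; case: u yu => [v|] yu; last by left; apply: cN.
have [->|yx] := eqVneq y x; first by left; rewrite connect0.
have [vx|vx] := eqVneq v x.
  right; rewrite vx; have c := off_x_connect yB (adj_vr xn2) yx n2x.
  apply: connect_trans (split_lift_off_x (or_intror erefl) c yx) (connect1 _).
  by rewrite /off /= adj_split /= xn2 f2 (inj_eq Some_inj) n2x.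
have yv : y != v by rewrite -(inj_eq Some_inj).
have /biconnectedP [_ bi] := Bbi.
have xv : x != v by rewrite eq_sym.
have /connectP [p] := bi v y x yB xB yv xv.
elim: p y yx yv {yB yu} => [|z p IH] y yx yv /=.
  by move=> _ xy; rewrite xy eqxx in yx.
case/andP=> /and3P[_ zv yz] zp lx.
have [zx|zx] := eqVneq z x.
  rewrite zx in yz; have xy : adj B x y by rewrite adjC.
  case fy: (f y); [left|right]; apply: connect1.
    rewrite /off /= adj_split /= !(inj_eq Some_inj) yv xv yz (negPf yx) eqxx.
    by rewrite fy.
  by rewrite /off /= adj_split /= !(inj_eq Some_inj) yv xy fy.
have st : connect (off (adj split_graph) (Some v)) (Some y) (Some z).
  apply: connect1; rewrite /off /= adj_split /= !(inj_eq Some_inj) yv zv yz.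
  by rewrite (negPf yx) (negPf zx).
by case: (IH z zx zv zp lx) => c; [left|right]; apply: connect_trans st c.
Qed.

Definition unsplit (a : option V) : V := odflt x a.

Lemma adj_unsplit a b : adj split_graph a b -> adj B (unsplit a) (unsplit b).
Proof.
rewrite adj_split; case: a b => [y|] [z|] //=; case/andP=> // h _.
by rewrite adjC.
Qed.

Lemma path_unsplit a p : path (adj split_graph) a p ->
  path (adj B) (unsplit a) (map unsplit p).
Proof. by elim: p a => //= b p IH a /andP[/adj_unsplit -> /IH ->]. Qed.

(** Such a cycle would be made of two odd cycles of [B] sharing only [x]. *)
Lemma split_no_common_cycle c : ucycle (adj split_graph) c ->
  Some x \in c -> None \in c -> False.
Proof.
move=> uc /rot_to [i d dE] nc.
have : None \in d by move: nc; rewrite -(mem_rot i) dE inE.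
have {i c uc nc dE} : ucycle (adj split_graph) (Some x :: d).
  by rewrite -dE ucycle_rot.
move=> uc nd; case/splitPr: nd uc => a b /andP[cc].
move: cc; rewrite [cycle _ _]/= rcons_cat cat_path /=.
case/and3P => pa la pb.
rewrite mem_cat inE cat_uniq /= negb_or => /and3P[/andP[xa xb] ua].
rewrite negb_or => /andP[/andP[na dis] /andP[nb' ub]].
have pa' : path (adj split_graph) (Some x) (rcons a None) by rewrite rcons_path pa.
have sub1 w : w \in a -> w != Some x /\ w != None.
  by move=> wa; split; [apply: contraNneq xa|apply: contraNneq na] => <-.
have sub2 w : w \in b -> w != Some x /\ w != None.
  move=> wb; split; last by apply: contraNneq nb' => <-.
  by apply: contraNneq xb => <-.
have inj w w' : w != Some x -> w != None -> w' != Some x -> w' != None ->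
    unsplit w = unsplit w' -> w = w'.
  by case: w w' => [w|] [w'|] //= _ _ _ _ ->.
have nx w : w != Some x -> w != None -> unsplit w != x.
  by case: w => //= w; rewrite (inj_eq Some_inj).
have mk l e1 e2 : unsplit e1 = x -> unsplit e2 = x -> split_colour e1 != split_colour e2 ->
   path (adj split_graph) e1 (rcons l e2) -> uniq l ->
   (forall w, w \in l -> w != Some x /\ w != None) ->
   ucycle (adj B) (x :: map unsplit l) /\ odd (size (x :: map unsplit l)).
  move=> u1 u2 ce pl ul sl; split.
    rewrite /ucycle; apply/andP; split.
      by have := path_unsplit pl; rewrite map_rcons u1 u2.
    rewrite /= map_inj_in_uniq ?ul ?andbT.
      by apply/mapP => -[w /sl [h1 h2]] /esym/eqP; apply/negP; apply: nx.
    by move=> w w' /sl [? ?] /sl [? ?]; apply: inj.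
  have := colouring_path split_colouring pl; rewrite last_rcons size_rcons /= size_map.
  by move: ce; case: (split_colour e1); case: (split_colour e2); case: (odd _).
have [|||u1 o1] := mk a (Some x) None _ _ _ pa' ua sub1; rewrite //= ?eqxx //.
have [|||u2 o2] := mk b None (Some x) _ _ _ pb ub sub2; rewrite //= ?eqxx //.
have [p [q [pq p1 p2 q1 q2]]] := C2 u1 u2 o1 o2.
have [w [w1 w2 wx]] : exists w, [/\ w \in x :: map unsplit a,
    w \in x :: map unsplit b & w != x].
  by have [e|] := eqVneq p x; [exists q; split=> //; rewrite -e eq_sym|exists p].
move: w1 w2; rewrite !inE (negPf wx) /= => /mapP [s sa sE] /mapP [t tb tE].
have [s1 s2] := sub1 _ sa; have [t1 t2] := sub2 _ tb.
have st : s = t by apply: inj => //; rewrite -sE -tE.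
by move/hasPn/(_ t tb): dis; rewrite /= -st sa.
Qed.

(** No cycle passes through both copies of [x], so cycles keep their length in
    [B]. *)
Lemma split_even_cycles : even_cycles_short (adj split_graph).
Proof.
move=> c uc s2 ev; have [cc uu] := andP uc.
rewrite -(size_map unsplit); apply: C1; rewrite ?size_map //.
rewrite /ucycle; apply/andP; split.
  by rewrite cycle_map; apply: sub_cycle cc => a b /adj_unsplit.
rewrite map_inj_in_uniq // => -[a|] [b|] ac bc //= e; rewrite ?e //.
  by rewrite e in ac; case: (split_no_common_cycle uc ac bc).
by rewrite -e in bc; case: (split_no_common_cycle uc bc ac).
Qed.

Lemma split_block_shape H : is_block split_graph H ->
  (exists l, is_K2 l H) \/ is_cut_edge_block H.
Proof.
move=> bH; have [cR xR nR xn _] := split_two_ended.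
have [z xz] := connected_nbr cR xR nR xn.
have [a [b ab]] := block_has_edge cR xz bH.
have sub : subrel (adj H) (adj split_graph).
  by move=> p q; apply: subgraph_adj; apply: block_sub.
apply: (bipartite_block_shape (block_bicon bH) _ _ ab).
  exact: even_cycles_short_sub sub split_even_cycles.
by move=> p q /sub; apply: split_colouring.
Qed.

(** In a [K_{2,l}] any two vertices of different colours are adjacent, but the
    two copies of [x] are not. *)
Lemma split_not_block : ~ is_block split_graph split_graph.
Proof.
move=> bR; have [_ xR nR xn _] := split_two_ended.
have nadj : ~~ adj split_graph (Some x) None.
  by rewrite adj_split /= adj_irr.
case: (split_block_shape bR) => [[l [l2 [P [Q [_ vE cP cQ eE]]]]]|[g [vE eE]]].
  have PQ p q : p \in P -> q \in Q -> adj split_graph p q.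
    by move=> pP qQ; rewrite /adj eE; apply: imset2_f.
  have same w w' z : adj split_graph w z -> adj split_graph w' z ->
      split_colour w = split_colour w'.
    move=> /split_colouring + /split_colouring.
    by case: (split_colour w); case: (split_colour w'); case: (split_colour z).
  have diff : split_colour (Some x) != split_colour None by rewrite /= eqxx.
  have [p pP] : exists p, p \in P by apply/card_gt0P; rewrite cP.
  have [q qQ] : exists q, q \in Q by apply/card_gt0P; rewrite cQ ltnW.
  have side w : w \in verts split_graph -> w \in P \/ w \in Q.
    by rewrite -vE inE => /orP.
  case: (side _ xR) => hx; case: (side _ nR) => hn.
  - by case/negP: diff; apply/eqP; apply: (same _ _ q); apply: PQ.
  - by rewrite PQ in nadj.
  - by rewrite adjC PQ in nadj.
  by case/negP: diff; apply/eqP; apply: (same _ _ p); rewrite adjC; apply: PQ.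
have [cR _ _ _ _] := split_two_ended.
have [n xn'] := connected_nbr cR xR nR xn.
have gE : [set Some x; n] = g by apply/set1P; rewrite -eE.
have : None \in [set Some x; n] by rewrite gE -vE.
by rewrite !inE /= => /eqP nE; rewrite nE xn' in nadj.
Qed.

Lemma split_identify : graph_iso B (identify split_graph (Some x) None).
Proof.
have vS y : (Some y \in verts split_graph) = (y \in verts B).
  by rewrite !inE mem_Some_imset.
apply: (@graph_isoI _ _ _ _ (fun y => if y == x then None else Some (Some y))).
- move=> y z _ _; case: eqP => [->|_]; case: eqP => [->|_] //; by case.
- apply/setP => -[[y|]|]; rewrite verts_identify !inE /= ?mem_Some_imset.
  + rewrite in_setD vS !inE (inj_eq Some_inj) orbF.
    apply/imsetP/andP => [[z zB]|[yx yB]].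
      by case: eqP => // zx [->]; split=> //; apply/eqP.
    by exists y; rewrite // (negPf yx).
  + by rewrite in_setD !inE /=; apply/imsetP => -[z _]; case: eqP.
  + by rewrite ?inE; apply/imsetP; exists x; rewrite // eqxx.
move=> y z yB zB.
have [yx|yx] := eqVneq y x; have [zx|zx] := eqVneq z x.
- by rewrite yx zx !adj_irr.
- rewrite adj_identify_None !inE (inj_eq Some_inj) (negPf zx) orbF /= !adj_split /=.
  by rewrite (negPf zx) eqxx yx [adj B z x]adjC -andb_orr orbN andbT.
- rewrite adjC [RHS]adjC adj_identify_None !inE (inj_eq Some_inj) (negPf yx) orbF /=.
  rewrite !adj_split /= (negPf yx) eqxx zx [adj B y x]adjC.
  by rewrite -andb_orr orbN andbT.
rewrite adj_identify_Some !inE !(inj_eq Some_inj) (negPf yx) (negPf zx) /=.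
by rewrite adj_split /= (negPf yx) (negPf zx) andbT.
Qed.

(** The split graph is a chain of blocks between the two copies of [x]. These
    have different colours, hence odd distance. *)
Lemma split_necklace : is_necklace_K2 B.
Proof.
have te := split_two_ended; have [cR xR nR xn _] := te.
have [Bf [t [Bl ch]]] := two_ended_chain te.
have pa := block_chain_path_along ch.
have [us nd lk kl [la xBf nBl fa lb]] := ch.
have bip H : is_block split_graph H -> bipartite H.
  move=> bH; apply/bipartiteP; exists split_colour => a b ab.
  by apply: split_colouring; apply: subgraph_adj (block_sub bH) ab.
case/lastP: t => [|t z] in ch pa us nd lk kl la.
  case: split_not_block; have nc u : ~~ cut_vertex split_graph u.
    by have := nd (inr u); rewrite /= inE => <-.
  have bi : biconnected split_graph by rewrite /biconnected cR; apply/forallP.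
  have bBf : is_block split_graph Bf by have := nd (inl Bf); rewrite inE eqxx.
  by rewrite {2}(block_max bBf (block_sub bBf) (subgraph_refl _) bi).
move: la; rewrite last_rcons => zE; rewrite {z}zE in ch pa us nd lk kl.
pose pr (z : graph (option V) + option V) := if z is inl B then Some B else None.
exists (option V : finType), split_graph, Bf, Bl, (pmap pr t), (Some x), None.
have bsE : Bf :: rcons (pmap pr t) Bl = pmap pr (inl Bf :: rcons t (inl Bl)).
  by rewrite /= -!cats1 pmap_cat.
split.
- split; first by apply/bipartiteP; exists split_colour; apply: split_colouring.
  by split=> //; exists (inl Bf :: rcons t (inl Bl)).
- move=> H; rewrite bsE mem_pmap => /mapP [[H'|//] /= hs [->]].
  by apply: split_block_shape; have := nd (inl H'); rewrite hs.
- split=> //; first exact: two_ended_noncut te.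
  exact: two_ended_noncut (two_ended_sym te).
- split; first by rewrite adj_split /= adj_irr.
  have /connectedP [_ c] := cR.
  have [d dd] := distance_exists (c _ _ xR nR); exists d; split=> //.
  case: dd => [[p [pP lp <-]] _].
  have := colouring_path split_colouring pP; rewrite lp /= eqxx /=.
  by case: (odd _).
exact: split_identify.
Qed.

End Split.

(** * Cycles in the graphs of the classification *)

Definition good_cycles (V : finType) (e : rel V) :=
  even_cycles_short e /\ odd_cycles_meet e.

Lemma uniq_count_le (V : finType) (A : {set V}) c :
  uniq c -> count [in A] c <= #|A|.
Proof.
move=> uc; rewrite -size_filter -(card_uniqP (filter_uniq _ uc)).
by apply: subset_leq_card; apply/subsetP => x; rewrite mem_filter => /andP[].
Qed.

Lemma complete_bipartite_colouring (V : finType) r s (B : graph V) :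
  is_complete_bipartite r s B ->
  exists A : {set V}, #|A| = r /\ colouring (adj B) [in A].
Proof.
move=> [A [C [dis _ cA _ eE]]]; exists A; split=> // x y; rewrite /adj eE.
move=> /imset2P [a c aA cC /set2_eq E].
have cA' : c \in A = false by apply/negP => h; move/pred0P/(_ c): dis; rewrite /= h cC.
by case: E => [[-> ->]|[-> ->]]; rewrite /= aA cA'.
Qed.

(** Half of the vertices of a cycle lie on the side with two vertices. *)
Lemma K2_cycles (V : finType) l (B : graph V) : is_K2 l B ->
  exists f, colouring (adj B) f /\
    forall c, ucycle (adj B) c -> size c <= 4.
Proof.
move=> [_ /complete_bipartite_colouring [A [cA fP]]]; exists [in A].
split=> // c /andP[cc uc]; rewrite -(colouring_cycle_count fP cc).
by have := uniq_count_le A uc; rewrite cA => h; apply: (leq_mul (leqnn 2) h).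
Qed.

Lemma K2_cycle4 (V : finType) l (B : graph V) c : is_K2 l B ->
  ucycle (adj B) c -> 2 < size c -> size c = 4.
Proof.
move=> /K2_cycles [f [fP h]] uc; have := h c uc; case/andP: uc => cc _.
by have := colouring_cycle fP cc; clear; lia.
Qed.

Lemma small_block_cycle4 (V : finType) (B : graph V) c :
  (exists l, is_K2 l B) \/ is_cut_edge_block B ->
  ucycle (adj B) c -> 2 < size c -> size c = 4.
Proof.
case=> [[l /K2_cycle4 h]|[g [vE eE]]]; first exact: h.
move=> /andP[cc uc] s2; 
have gB : g \in edges B by rewrite eE inE.
have [_ g2] := edgeP gB.
suff : size c <= 2 by rewrite leqNgt s2.
rewrite -g2 -vE -(card_uniqP uc).
by apply: subset_leq_card; apply/subsetP => x xc; apply: cycle_verts (ltnW s2) cc xc.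
Qed.

Lemma small_block_edge (V : finType) (B : graph V) :
  (exists l, is_K2 l B) \/ is_cut_edge_block B -> exists a b, adj B a b.
Proof.
case=> [[l [l2 [P [Q [_ _ cP cQ eE]]]]]|[g [vE eE]]].
  have [p pP] : exists p, p \in P by apply/card_gt0P; rewrite cP.
  have [q qQ] : exists q, q \in Q by apply/card_gt0P; rewrite cQ ltnW.
  by exists p, q; rewrite /adj eE; apply: imset2_f.
have : g \in edges B by rewrite eE inE.
by move/edge_adj => [a [b [_ ab]]]; exists a, b.
Qed.

Lemma complete4_good (V : finType) (B : graph V) :
  is_complete 4 B -> good_cycles (adj B).
Proof.
move=> [c4 _].
have sub c : ucycle (adj B) c -> 1 < size c -> [set x in c] \subset verts B.
  move=> /andP[cc uc] s1; apply/subsetP => x; rewrite inE.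
  exact: cycle_verts s1 cc.
have sz c : ucycle (adj B) c -> #|[set x in c]| = size c.
  by move=> /andP[_ uc]; rewrite cardsE; apply/card_uniqP.
split=> [c uc s2 ev|c d uc ud oc od].
  have := subset_leq_card (sub c uc (ltnW s2)); rewrite sz // c4.
  by move: s2 ev; clear; lia.
have big c' : ucycle (adj B) c' -> odd (size c') -> 2 < size c'.
  case: c' => [|a [|b [|? ?]]] //= /andP[]; by rewrite /= adj_irr.
have c1 := big c uc oc; have d1 := big d ud od.
have : 1 < #|[set x in c] :&: [set x in d]|.
  have := cardsUI [set x in c] [set x in d]; rewrite !sz //.
  have : #|[set x in c] :|: [set x in d]| <= 4.
    rewrite -c4; apply: subset_leq_card; rewrite subUset !sub //; exact: ltnW.
  by move: c1 d1; clear; lia.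
case/card_gt1P => x [y []]; rewrite !inE => /andP[xc xd] /andP[yc yd] xy.
by exists x, y.
Qed.

(** Two graphs glued at two vertices [p] and [q]: a cycle lies in one of them,
    or consists of a path from [p] to [q] in each. *)
Section TwoSum.
Variables (V : finType) (h d : rel V) (VH VD : {set V}) (p q : V).
Hypotheses (hV : forall x y, h x y -> x \in VH /\ y \in VH).
Hypotheses (dV : forall x y, d x y -> x \in VD /\ y \in VD).
Hypothesis meet : forall z, z \in VH -> z \in VD -> (z == p) || (z == q).

Let e : rel V := relU h d.

(** The walk could change sides only at [p] or [q]. *)
Lemma arc_one_side y a z : path e y (rcons a z) -> p \notin a -> q \notin a ->
  path h y (rcons a z) \/ path d y (rcons a z).
Proof.
elim: a y => [|w a IH] y /=.
  by rewrite !andbT => /orP.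
case/andP=> yw wP; rewrite !inE !negb_or => /andP[pw pa] /andP[qw qa].
have nw : w \in VH -> w \in VD -> False.
  move=> w1 w2; have := meet w1 w2.
  by rewrite eq_sym (negPf pw) eq_sym (negPf qw).
case: (IH w wP pa qa) => W; rewrite W andbT.
- case/orP: yw => [->|/dV [_ w2]]; first by left.
  exfalso; case: a {IH wP pa qa} W => [|w' a] /= /andP[/hV [w1 _] _]; exact: nw w1 w2.
- case/orP: yw => [/hV [_ w1]|->]; last by right.
  exfalso; case: a {IH wP pa qa} W => [|w' a] /= /andP[/dV [w2 _] _]; exact: nw w1 w2.
Qed.

Lemma two_sum_cycle c : p != q -> ucycle e c ->
  [\/ cycle h c, cycle d c |
   [/\ p \in c, q \in c & exists a b, size c = (size a + size b).+2 /\
     ((path h p (rcons a q) /\ path d q (rcons b p)) \/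
      (path d p (rcons a q) /\ path h q (rcons b p)))]].
Proof.
move=> pq uc; have [cc _] := andP uc.
have one y t i : rot i c = y :: t -> p \notin t -> q \notin t -> cycle h c \/ cycle d c.
  move=> cE pt qt; move: cc; rewrite -(rot_cycle i) cE => /arc_one_side.
  by move/(_ pt qt); rewrite -(rot_cycle i h c) -(rot_cycle i d c) cE.
have one' : cycle h c \/ cycle d c -> [\/ cycle h c, cycle d c |
   [/\ p \in c, q \in c & exists a b, size c = (size a + size b).+2 /\
     ((path h p (rcons a q) /\ path d q (rcons b p)) \/
      (path d p (rcons a q) /\ path h q (rcons b p)))]].
  by case=> ?; [constructor 1|constructor 2].
have /orP[pc|pc] := orbN (p \in c); last first.
  apply: one'; have /orP[qc|qc] := orbN (q \in c).
    case/rot_to: (qc) => i t tE; apply: (one _ _ _ tE).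
      by apply: contra pc; rewrite -(mem_rot i c) tE inE => ->; rewrite orbT.
    by case/andP: uc => _; rewrite -(rot_uniq i) tE => /andP[].
  case: c {uc cc} one pc qc => [|y t] one; first by left.
  rewrite !inE !negb_or => /andP[_ pt] /andP[_ qt].
  exact: (one y t 0 (rot0 _)).
case/rot_to: (pc) => i t tE.
have : uniq (p :: t) by rewrite -tE rot_uniq; case/andP: uc.
rewrite cons_uniq => /andP[pt ut]; have [qt|qt] := boolP (q \in t); last first.
  by apply: one'; apply: (one _ _ _ tE).
have ct : cycle e (p :: t) by rewrite -tE rot_cycle.
have qc : q \in c by rewrite -(mem_rot i) tE inE qt orbT.
case/splitPr: qt tE pt ut ct => a b tE.
rewrite mem_cat inE !negb_or cat_uniq /= => /and3P[pa _ pb] /and3P[_ qa' /andP[qb _]].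
have qa : q \notin a by move: qa'; rewrite negb_or => /andP[].
rewrite rcons_cat cat_path /= => /and3P[aP aq bP].
have aP' : path e p (rcons a q) by rewrite rcons_path aP.
have cyc r : path r p (rcons a q) -> path r q (rcons b p) -> cycle r c.
  move=> h1 h2; rewrite -(rot_cycle i) tE /= rcons_cat cat_path /=.
  have /andP[-> ->] : path r p a && r (last p a) q by rewrite -rcons_path.
  by [].
have sz : size c = (size a + size b).+2.
  by rewrite -(size_rot i) tE /= size_cat /= addnS.
case: (arc_one_side aP' pa qa) (arc_one_side bP pb qb) => ha [hb|hb].
- by constructor 1; apply: cyc.
- by constructor 3; split=> //; exists a, b; split=> //; left.
- by constructor 3; split=> //; exists a, b; split=> //; right.
- by constructor 2; apply: cyc.
Qed.

(** Both sides are bipartite, so the odd cycles use both. A cycle using both is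
    odd, since the colourings make paths from [p] to [q] even in one side and
    odd in the other; and all these cycles contain [p] and [q]. *)
Lemma two_sum_good f g : p != q ->
  colouring h f -> f p = f q -> colouring d g -> g p != g q ->
  (forall c, ucycle h c -> size c <= 4) -> (forall c, ucycle d c -> size c <= 4) ->
  good_cycles e.
Proof.
move=> pq fP fpq gP gpq h4 d4.
(* [a] lists the inner vertices: the number of steps is larger by one *)
have par a : path h p (rcons a q) \/ path h q (rcons a p) -> odd (size a).
  by case=> /(colouring_path fP); rewrite last_rcons size_rcons fpq /=;
    case: (f q); case: (odd _).
have pard a : path d p (rcons a q) \/ path d q (rcons a p) -> ~~ odd (size a).
  by case=> /(colouring_path gP); rewrite last_rcons size_rcons; move: gpq;
    case: (g p); case: (g q); rewrite //=; case: (odd _).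
have mixed c a b : size c = (size a + size b).+2 ->
     ((path h p (rcons a q) /\ path d q (rcons b p)) \/
      (path d p (rcons a q) /\ path h q (rcons b p))) -> odd (size c).
  move=> -> /=; rewrite negbK oddD.
  case=> [[h1 h2]|[h1 h2]].
    by rewrite (par a (or_introl h1)) (negPf (pard b (or_intror h2))).
  by rewrite (negPf (pard a (or_introl h1))) (par b (or_intror h2)).
have key c : ucycle e c -> (size c <= 4 /\ ~~ odd (size c)) \/
    [/\ p \in c, q \in c & odd (size c)].
  move=> uc; have [_ uu] := andP uc.
  case: (two_sum_cycle pq uc) => [cc|cc|[pc qc [a [b [sE hE]]]]].
  - by left; rewrite (colouring_cycle fP cc); split=> //; apply: h4; apply/andP.
  - by left; rewrite (colouring_cycle gP cc); split=> //; apply: d4; apply/andP.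
  - by right; split=> //; apply: mixed hE.
split=> [c /key [[s4 _] s2 ev|[_ _ ->]]//|c d' /key [[_ /negPf ->]//|[pc qc _]]].
  by move: s4 s2 ev; clear; lia.
by move=> /key [[_ /negPf ->]//|[pd qd _]] _ _; exists p, q.
Qed.

End TwoSum.

(** If the ends of [e] had different colours, the graph would be bipartite. *)
Lemma K2_plus_data (V : finType) l e (B : graph V) : is_K2_plus l e B ->
  exists (H : graph V) p q f, [/\ p != q, e = [set p; q], verts B = verts H,
    edges B = e |: edges H &
    [/\ colouring (adj H) f, f p = f q &
        forall c, ucycle (adj H) c -> size c <= 4]].
Proof.
move=> [nb [H [kH vE eE]]]; have [f [fP h4]] := K2_cycles kH.
have : e \in edges B by rewrite eE !inE eqxx.
move/edge_adj => [p [q [epq pq]]]; exists H, p, q, f; split=> //.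
  exact: adj_neq pq.
split=> //; apply/eqP; apply: contraNT nb => fpq; apply/bipartiteP; exists f.
move=> x y; rewrite /adj eE !inE => /orP[/eqP|/fP//]; rewrite epq.
by case/set2_eq=> [[-> ->]|[-> ->]] //; rewrite eq_sym.
Qed.

Lemma good_cycles_eq (V : finType) (e e' : rel V) : e =2 e' ->
  good_cycles e' -> good_cycles e.
Proof.
move=> E [h1 h2]; have s : subrel e e' by move=> x y; rewrite E.
by split; [apply: even_cycles_short_sub h1|apply: odd_cycles_meet_sub h2].
Qed.

(** A two-sum with the single edge [e]. *)
Lemma K2_plus_good (V : finType) l e (B : graph V) :
  is_K2_plus l e B -> good_cycles (adj B).
Proof.
move=> kB; have [H [p [q [f [pq eE vB eB [fP fpq h4]]]]]] := K2_plus_data kB.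
have eB' : e \in edges B by rewrite eB !inE eqxx.
have [eV _] := edgeP eB'.
pose d : rel V := [rel x y | [set x; y] == e].
have dE x y : d x y -> (x = p /\ y = q) \/ (x = q /\ y = p).
  by move=> /eqP; rewrite eE; apply: set2_eq.
have qp : (q == p) = false by rewrite eq_sym; apply: negPf.
have gP : colouring d (fun x => x == p).
  by move=> x y /dE [[-> ->]|[-> ->]]; rewrite eqxx qp.
apply: (@good_cycles_eq _ _ (relU (adj H) d)).
  by move=> x y; rewrite /adj eB !inE orbC.
apply: (@two_sum_good _ (adj H) d (verts H) e p q _ _ _ f (fun x => x == p)) => //.
- by move=> x y xy; rewrite (adj_vl xy) (adj_vr xy).
- by move=> x y /dE; rewrite eE !inE => -[[-> ->]|[-> ->]]; rewrite !eqxx orbT.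
- by move=> z _; rewrite eE !inE.
- by rewrite eqxx qp.
move=> c /andP[cc uc]; apply: (@leq_trans 2) => //; rewrite -(card_uniqP uc).
apply: (@leq_trans #|[set p; q]|); last by rewrite cards2 pq.
apply: subset_leq_card; apply/subsetP => x xc.
have := next_cycle cc xc; case/dE=> [[-> _]|[-> _]]; by rewrite !inE eqxx ?orbT.
Qed.

(** The edge [e] belongs to the second summand, so that the first one can be
    taken without it. *)
Lemma double_K2_good (V : finType) r s (B : graph V) :
  is_double_K2 r s B -> good_cycles (adj B).
Proof.
move=> [G1 [G2 [e [k1 [k2 e2] meet vB eB]]]].
have [H [p [q [f [pq eE v1 e1 [fP fpq h4]]]]]] := K2_plus_data k1.
have [g [gP d4]] := K2_cycles k2.
apply: (@good_cycles_eq _ _ (relU (adj H) (adj G2))).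
  move=> x y; rewrite /adj eB e1 !inE /=; case: eqP => [->|//].
  by rewrite e2 !orbT.
apply: (@two_sum_good _ (adj H) (adj G2) (verts H) (verts G2) p q _ _ _ f g) => //.
- by move=> x y xy; rewrite (adj_vl xy) (adj_vr xy).
- by move=> x y xy; rewrite (adj_vl xy) (adj_vr xy).
- move=> z z1 z2; have : z \in e by rewrite -meet v1 inE z1.
  by rewrite eE !inE.
by apply: gP; rewrite /adj -eE.
Qed.

Lemma graph_iso_good (V W : finType) (G : graph V) (H : graph W) :
  graph_iso G H -> good_cycles (adj H) -> good_cycles (adj G).
Proof.
move=> [f [inj vE eE]] [C1 C2].
have fadj x y : adj G x y -> adj H (f x) (f y).
  by move=> xy; rewrite /adj -eE -imset_set2; apply: imset_f.
have inG c x : ucycle (adj G) c -> x \in c -> x \in verts G.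
  move=> /andP[cc _] xc; exact: adj_vl (next_cycle cc xc).
have fc c : ucycle (adj G) c -> ucycle (adj H) (map f c).
  move=> uc; have [cc uu] := andP uc; rewrite /ucycle; apply/andP; split.
    by rewrite cycle_map; apply: sub_cycle cc => x y /fadj.
  by rewrite map_inj_in_uniq // => x y /(inG _ _ uc) xG /(inG _ _ uc) yG; apply: inj.
split=> [c uc s2 ev|c d uc ud oc od].
  by rewrite -(size_map f); apply: C1; rewrite ?size_map //; apply: fc.
have [||x [y [xy xc xd yc yd]]] := C2 _ _ (fc c uc) (fc d ud); rewrite ?size_map //.
move/mapP: xc => [a ac xE]; move/mapP: xd => [a' ad xE'].
move/mapP: yc => [b bc yE]; move/mapP: yd => [b' bd yE'].
have aa : a = a' 
  by apply: inj; [apply: inG uc ac|apply: inG ud ad|rewrite -xE].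
have bb : b = b' 
  by apply: inj; [apply: inG uc bc|apply: inG ud bd|rewrite -yE].
exists a, b; split=> //; rewrite ?aa ?bb //.
by apply: contraNneq xy => ab; rewrite xE' yE' ab.
Qed.

Lemma singleton_biconnected (V : finType) (G : graph V) v :
  biconnected (induced G [set v]).
Proof.
have cs x y e : x \in [set v] -> y \in [set v] -> connect e x y.
  by rewrite !inE => /eqP -> /eqP ->; apply: connect0.
apply/biconnectedP; split; last by move=> u x y xv yv _ _; apply: cs.
apply/connectedP; split; last by move=> x y xv yv; apply: cs.
by apply/set0Pn; exists v; rewrite !inE.
Qed.

Lemma zip_behead_path (T : eqType) (r : rel T) z t :
  (forall p, p \in zip (z :: t) t -> r p.1 p.2) -> path r z t.
Proof.
elim: t z => [//|w t IH] z h /=; rewrite (h (z, w)) ?mem_head //=.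
by apply: IH => p hp; apply: h; rewrite [zip _ _]/= in_cons hp orbT.
Qed.

Definition node_verts (W : finType) (z : graph W + W) : {set W} :=
  match z with inl B => verts B | inr u => [set u] end.

(** Blocks are connected, and neighbouring nodes of the block tree share a
    vertex. *)
Lemma block_tree_connected (W : finType) (R : graph W) z t :
  is_path_along (block_tree R) (z :: t) ->
  forall x y, x \in verts R -> y \in verts R -> connect (adj R) x y.
Proof.
case=> us vE eE.
have node w : (w \in z :: t) = tree_node R w.
  by have /setP/(_ w) := vE; rewrite !inE => <-; case: w.
have inner w x y : tree_node R w -> x \in node_verts w -> y \in node_verts w ->
    connect (adj R) x y.
  case: w => [B|v] /=; last first.
    by rewrite !inE => _ /eqP -> /eqP ->; apply: connect0.
  move=> bB xB yB; have /andP[/connectedP [_ c] _] := block_bicon bB.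
  by apply: connect_mono (c x y xB yB) => a b; apply: subgraph_adj (block_sub bB).
have link : path (@tree_link W) z t.
  apply: zip_behead_path => -[a b] /= ab.
  have : adj (block_tree R) a b.
    by rewrite /adj eE; apply/imsetP; exists (a, b).
  by rewrite adj_block_tree => /and3P[].
have go w x y : w \in z :: t -> x \in node_verts z -> y \in node_verts w ->
    connect (adj R) x y.
  have nd v : v \in z :: t -> tree_node R v by rewrite node.
  elim: t z nd link {us vE eE node} x => [|z' t IH] z0 nd link x.
    by rewrite inE => /eqP ->; apply: inner; apply: nd; apply: mem_head.
  rewrite in_cons => /orP[/eqP -> |wt] xz yw.
    by apply: inner xz yw; apply: nd; apply: mem_head.
  case/andP: link => zz' link.
  have [u uz uz'] : exists2 u, u \in node_verts z0 & u \in node_verts z'.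
    by case: z0 z' zz' {nd IH link wt xz} => [B|v] [B'|v'] //= h;
      [exists v'|exists v]; rewrite ?inE.
  apply: (@connect_trans _ _ u).
    by apply: inner xz uz; apply: nd; apply: mem_head.
  by apply: (IH z') => // v vt; apply: nd; rewrite in_cons vt orbT.
have [r rz] : exists r, r \in node_verts z.
  have : tree_node R z by rewrite -node mem_head.
  case: z {us vE eE node link go} => [B|v] /=; last by exists v; rewrite inE.
  by move=> /block_bicon/andP[/connectedP [/set0Pn]].
have all x : x \in verts R -> connect (adj R) r x.
  move=> xR; have [|B [bB /subgraph_vert sB]] :=
    @block_exists _ R _ (singleton_biconnected R x).
    by apply: subgraph_induced; rewrite sub1set.
  apply: (go (inl B)); rewrite ?node //=.
  by apply: sB; rewrite /= inE.
move=> x y xR yR; apply: connect_trans (all y yR).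
by rewrite connect_symG; apply: all.
Qed.

Section Necklace.
Variables (W : finType) (R B1 Bk : graph W) (bs : seq (graph W)) (x1 x2 : W).
Let Bs := B1 :: rcons bs Bk.
Hypotheses (bip : bipartite R) (chain : chain_of_bipartite_blocks R Bs).
Hypothesis shape : forall B, B \in Bs -> (exists n, is_K2 n B) \/ is_cut_edge_block B.
Hypotheses (x1B : x1 \in verts B1) (x2B : x2 \in verts Bk).
Hypotheses (nc1 : ~~ cut_vertex R x1) (nc2 : ~~ cut_vertex R x2).
Hypotheses (dist : exists d, is_distance R x1 x2 d /\ odd d).

Let mem_blocks B : (B \in Bs) = is_block R B.
Proof.
case: chain => _ [s [[us vE _] ->]].
have : (inl B \in s) = is_block R B 
  by have /setP/(_ (inl B)) := vE; rewrite !inE => <-.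
move=> <-; rewrite mem_pmap; apply/mapP/idP => [[[B'|//] hs [->]]//|hs].
by exists (inl B).
Qed.

Let blocks_neq : B1 != Bk.
Proof.
case: chain => _ [s [[us _ _] sE]].
have : uniq Bs.
  by rewrite sE; apply: (pmap_uniq (g := inl)) us => -[].
by rewrite /= mem_rcons inE negb_or => /andP[/andP[]].
Qed.

Let R_connected : connected R.
Proof.
have B1b : is_block R B1 by rewrite -mem_blocks mem_head.
case: chain => _ [s [pa sE]]; apply/connectedP; split.
  by apply/set0Pn; exists x1; apply: subgraph_vert (block_sub B1b) x1B.
by case: s pa sE => [//|z t] pa _; apply: block_tree_connected pa.
Qed.

Let cycle_R c : ucycle (adj R) c -> 2 < size c -> size c = 4.
Proof.
move=> uc s2; have [B [bB uB]] := cycle_in_block s2 uc.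
by apply: small_block_cycle4 uB s2; apply: shape; rewrite mem_blocks.
Qed.

(** The ends lie in different blocks, so no cycle passes through both. *)
Let no_common_cycle c : ucycle (adj R) c -> x1 \in c -> x2 \in c -> 2 < size c ->
  False.
Proof.
move=> uc x1c x2c s2; have [B [bB uB]] := cycle_in_block s2 uc.
have nbr H x : is_block R H -> x \in verts H -> exists y, adj H x y.
  move=> bH xH; have [a [b ab]] : exists a b, adj H a b.
    by apply: small_block_edge; apply: shape; rewrite mem_blocks.
  have /andP[cH _] := block_bicon bH.
  have [e|xa] := eqVneq x a; first by exists b; rewrite e.
  exact: connected_nbr cH xH (adj_vl ab) xa.
have vB x : x \in c -> x \in verts B.
  by move=> xc; case/andP: uB => cc _; apply: cycle_verts (ltnW s2) cc xc.
have b1 : is_block R B1 by rewrite -mem_blocks mem_head.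
have bk : is_block R Bk by rewrite -mem_blocks !inE mem_rcons inE eqxx orbT.
have [y1 a1] := nbr _ _ b1 x1B; have [y1' a1'] := nbr _ _ bB (vB _ x1c).
have [y2 a2] := nbr _ _ bk x2B; have [y2' a2'] := nbr _ _ bB (vB _ x2c).
have e1 := noncut_block_unique R_connected nc1 b1 bB a1 a1'.
have e2 := noncut_block_unique R_connected nc2 bk bB a2 a2'.
by move: blocks_neq; rewrite e1 e2 eqxx.
Qed.

Let e : rel (option W) := adj (identify R x1 x2).

Lemma path_identify a p : path e (Some a) (map Some p) ->
  path (adj R) a p.
Proof.
elim: p a => //= b p IH a /andP[]; rewrite /e adj_identify_Some.
by case/and3P=> _ _ -> /IH.
Qed.

Lemma map_Some_of (p : seq (option W)) : None \notin p ->
  exists q, p = map Some q.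
Proof.
elim: p => [|[a|] p IH]; first by exists [::].
  by rewrite inE /= => /IH [q ->]; exists (a :: q).
by rewrite inE.
Qed.

(** A cycle through the new vertex uses one end twice, and comes from a cycle
    of [R], or uses both ends, and comes from a path between them. *)
Lemma identify_cycle c : ucycle e c -> 2 < size c ->
  (exists c', ucycle (adj R) c' /\ size c' = size c) \/
  (exists p, [/\ path (adj R) x1 (rcons p x2), x1 \notin p, x2 \notin p, uniq p &
     [/\ size c = (size p).+1, None \in c & forall w, w \in p -> Some w \in c]]).
Proof.
move=> uc s2; have [cc uu] := andP uc.
have [nc|nc] := boolP (None \in c); last first.
  left; have [q qE] := map_Some_of nc; exists q.
  rewrite qE size_map; split=> //; rewrite /ucycle.
  move: uu; rewrite qE (map_inj_uniq Some_inj) => ->; rewrite andbT.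
  move: cc; rewrite qE; case: (q) => //= a q' h; apply: path_identify.
  by rewrite map_rcons.
case/rot_to: (nc) => i t tE.
have ut : uniq (None :: t) by rewrite -tE rot_uniq.
have ct : cycle e (None :: t) by rewrite -tE rot_cycle.
have st : size c = (size t).+1 by rewrite -(size_rot i) tE.
have mt w : w \in t -> w \in c by move=> wt; rewrite -(mem_rot i) tE inE wt orbT.
have [p pE] : exists q, t = map Some q by apply: map_Some_of; case/andP: ut.
move: ct st mt ut; rewrite pE size_map [uniq _]/= (map_inj_uniq Some_inj).
move=> + st mt /andP[_ up].
have [a [l [b [pE1 pE2]]]] : exists a l b, p = a :: l /\ rcons l b = rcons l (last a l)
    by case: (p) st s2 => [|a l] -> // _; exists a, l, (last a l).
move=> ct; have {b pE2} : [/\ e None (Some a), path e (Some a) (map Some l) &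
    e (Some (last a l)) None].
  move: ct; rewrite pE1 /= rcons_path => /and3P[-> -> ].
  by rewrite last_map => ->.
case=> ea /path_identify lP; rewrite /e adjC => eb.
move: ea eb; rewrite /e !adj_identify_None !inE !negb_or.
case/andP=> /andP[a1 a2] ea /andP[/andP[b1 b2] eb].
have np x : x = x1 \/ x = x2 -> x \notin p.
  move=> xE; rewrite pE1; have : path e (Some a) (map Some l).
    by move: ct; rewrite pE1 /= rcons_path => /and3P[].
  have : Some a != Some x by rewrite (inj_eq Some_inj); case: xE => ->.
  elim: (l) (a) => [|y l' IH] a' /=; first by rewrite inE (inj_eq Some_inj) eq_sym.
  rewrite (inj_eq Some_inj) => ax /andP[]; rewrite {1}/e adj_identify_Some !inE !negb_or.
  case/and3P=> _ /andP[y1 y2] _ h.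
  have h' : x \notin y :: l'.
    by apply: IH h; rewrite (inj_eq Some_inj); case: xE => ->.
  by move: h'; rewrite in_cons negb_or [x == a']eq_sym ax => ->.
have p1 := np x1 (or_introl erefl); have p2 := np x2 (or_intror erefl).
have same x : x \notin p -> adj R a x -> adj R (last a l) x ->
    exists c', ucycle (adj R) c' /\ size c' = size c.
  move=> xp ax bx; exists (x :: p); split; last by rewrite st.
  rewrite /ucycle [uniq _]/= xp up pE1 /= adjC ax rcons_path lP bx.
  by [].
have memc w : w \in p -> Some w \in c by move=> wp; apply: mt; apply: map_f.
have diff x y : adj R a x -> adj R (last a l) y -> path (adj R) x (rcons p y).
  by move=> ax bx; rewrite pE1 /= adjC ax rcons_path lP bx.
case/orP: ea => ea; case/orP: eb => eb.
- by left; apply: same ea eb.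
- right; exists p; split=> //; exact: diff.
- right; exists (rev p); split; rewrite ?mem_rev ?rev_uniq //.
    have := diff x2 x1 ea eb; rewrite -[X in X -> _]/(is_true _).
    have -> : rcons (rev p) x2 = rev (belast x2 (rcons p x1)).
      by rewrite belast_rcons rev_cons.
    have {2}-> : x1 = last x2 (rcons p x1) by rewrite last_rcons.
    by rewrite rev_path; congr is_true; apply: eq_path => u v; rewrite adjC.
  by rewrite size_rev; split=> // w; rewrite mem_rev; apply: memc.
by left; apply: same ea eb.
Qed.

(** The ends have different colours, so the odd cycles are those that come from
    a path between the ends. Two such cycles share the new vertex, and a
    further one because two disjoint paths would make a cycle of [R] through
    both ends. *)
Lemma identify_good : good_cycles (adj (identify R x1 x2)).
Proof.
have /bipartiteP [g gP] := bip.
have gx : g x1 != g x2.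
  case: dist => d [[[p [pP lp sp]] _] od].
  have := colouring_path gP pP; rewrite lp sp od => ->.
  by case: (g x1).
have par p : path (adj R) x1 (rcons p x2) -> ~~ odd (size p).
  move=> /(colouring_path gP); rewrite last_rcons size_rcons /=; move: gx.
  by case: (g x1); case: (g x2); case: (odd _).
split=> [c uc s2 ev|c d uc ud oc od].
  case: (identify_cycle uc s2) => [[c' [uc' sE]]|].
    by rewrite -sE; apply: cycle_R; rewrite ?sE.
  move=> [p [/par pp _ _ _ [sE _ _]]].
  by rewrite sE /= pp in ev.
have big c' : ucycle e c' -> odd (size c') -> 2 < size c'.
  by case: c' => [|a [|b [|? ?]]] //= /andP[]; rewrite /= /e adj_irr.
have odd_path c' : ucycle e c' -> odd (size c') ->
   exists p, [/\ path (adj R) x1 (rcons p x2), x1 \notin p, x2 \notin p, uniq p &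
     [/\ size c' = (size p).+1, None \in c' & forall w, w \in p -> Some w \in c']].
  move=> uc' oc'; case: (identify_cycle uc' (big _ uc' oc')) => [[c'' [uc'' sE]]|//].
  by move: oc'; rewrite -sE (colouring_cycle gP) //; case/andP: uc''.
have [p [pP p1 p2 up [sp nc mp]]] := odd_path c uc oc.
have [q [qP q1 q2 uq [sq nd mq]]] := odd_path d ud od.
have [/hasP [w wp wq]|dis] := boolP (has [in p] q).
  by exists None, (Some w); split; rewrite ?mp ?mq.
have uC : ucycle (adj R) (x1 :: p ++ x2 :: rev q).
  rewrite /ucycle; apply/andP; split.
    rewrite /= -cat_rcons rcons_cat cat_path pP last_rcons /=.
    have := qP; rewrite -[X in X -> _]/(is_true _).
    have -> : rcons (rev q) x1 = rev (belast x1 (rcons q x2)).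
      by rewrite belast_rcons rev_cons.
    have {2}-> : x2 = last x1 (rcons q x2) by rewrite last_rcons.
    by rewrite rev_path; congr is_true; apply: eq_path => u v; rewrite adjC.
  have x12 : x1 != x2 by apply: contraNneq gx => ->.
  rewrite cons_uniq mem_cat inE mem_rev !negb_or p1 q1 x12 cat_uniq up /=.
  rewrite mem_rev q2 rev_uniq uq negb_or p2 /= andbT.
  by apply/hasPn => w; rewrite mem_rev => wq; apply: (hasPn dis).
case: (no_common_cycle uC).
- by rewrite mem_head.
- by rewrite in_cons mem_cat mem_head !orbT.
have := big _ uc oc; rewrite sp /= size_cat /=.
by move=> h; apply: leq_trans h _; rewrite addnS !ltnS leqW ?leq_addr.
Qed.

End Necklace.

Lemma necklace_good (V : finType) (B : graph V) :
  is_necklace_K2 B -> good_cycles (adj B).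
Proof.
move=> [W [R [B1 [Bk [bs [x1 [x2 [[bip ch] sh [x1B x2B nc1 nc2] [_ ds] iso]]]]]]]].
by apply: graph_iso_good iso _; apply: (identify_good bip ch sh).
Qed.

(** * The classification of graphs by their cycles *)

(** If some vertex meets all odd cycles, splitting it gives a necklace. *)
Lemma nonbipartite_block_shape (V : finType) (B : graph V) :
  biconnected B -> ~~ bipartite B -> good_cycles (adj B) ->
  is_complete 4 B \/ is_necklace_K2 B.
Proof.
move=> Bbi nb [C1 C2].
have [x /andP[/= xB bx]|none] :=
    pickP [pred x in verts B | bipartite (delete_vertices B [set x])].
  right; have /bipartiteP [f fP] := bx.
  apply: (@split_necklace _ _ x f) => // y z yz; apply: fP.
  by rewrite adj_delete.
left; have [c [uc oc]] := odd_cycle_exists nb.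
apply: (no_apex_K4 Bbi C1 C2 uc oc) => x xB.
have := none x; rewrite /= xB /= => /negbT /odd_cycle_exists [d [ud od]].
by exists d; split=> //; apply: ucycle_sub ud => y z; rewrite adj_delete.
Qed.

Lemma bipartite_no_odd_cycle (V : finType) (B : graph V) c :
  bipartite B -> ucycle (adj B) c -> ~~ odd (size c).
Proof. by move=> /bipartiteP [f fP] /andP[/(colouring_cycle fP) ->]. Qed.

(** Each cycle lies in a block, and two odd cycles with two common vertices lie
    in the same block. *)
Theorem good_cycles_iff_blocks (V : finType) (G : graph V) :
  connected G -> edges G != set0 ->
  good_cycles (adj G) <->
  [/\ #|[set B | is_block G B && ~~ bipartite B]| <= 1,
      forall B, is_block G B -> ~~ bipartite B ->
        [\/ is_complete 4 B,
            exists l e, is_K2_plus l e B,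
            exists r s, is_double_K2 r s B |
            is_necklace_K2 B] &
      forall B, is_block G B -> bipartite B ->
        (exists l, is_K2 l B) \/ is_cut_edge_block B].
Proof.
move=> cG /set0Pn [g /edge_adj [a0 [b0 [_ e0]]]].
have vB (B : graph V) c x : ucycle (adj B) c -> x \in c -> x \in verts B.
  by move=> /andP[cc _] xc; apply: adj_vl (next_cycle cc xc).
have big (B : graph V) c : ucycle (adj B) c -> odd (size c) -> 2 < size c.
  by case: c => [|a [|b [|? ?]]] //= /andP[]; rewrite /= adj_irr.
split=> [[C1 C2]|[one nonb bip]].
  have sub B : is_block G B -> subrel (adj B) (adj G).
    by move=> bB x y; apply: subgraph_adj (block_sub bB).
  have C1B B : is_block G B -> even_cycles_short (adj B).
    by move=> bB; apply: even_cycles_short_sub (sub B bB) C1.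
  split.
  - apply/card_le1_eqP => B B'; rewrite !inE => /andP[bB nB] /andP[bB' nB'].
    have [c [uc oc]] := odd_cycle_exists nB; have [d [ud od]] := odd_cycle_exists nB'.
    have uc' := ucycle_sub (sub B bB) uc; have ud' := ucycle_sub (sub B' bB') ud.
    have [x [y [xy xc xd yc yd]]] := C2 c d uc' ud' oc od.
    by apply: (block_eq bB' bB xy); [apply: vB ud xd|apply: vB uc xc|
      apply: vB ud yd|apply: vB uc yc].
  - move=> B bB nB.
    have gB : good_cycles (adj B).
      by split; [apply: C1B|apply: odd_cycles_meet_sub (sub B bB) C2].
    by case: (nonbipartite_block_shape (block_bicon bB) nB gB) => ?;
      [constructor 1|constructor 4].
  move=> B bB /bipartiteP [f fP]; have [a [b ab]] := block_has_edge cG e0 bB.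
  exact: (bipartite_block_shape (block_bicon bB) (C1B B bB) fP ab).
have nongood B : is_block G B -> ~~ bipartite B -> good_cycles (adj B).
  move=> bB nB; case: (nonb B bB nB).
  - exact: complete4_good.
  - by case=> l [e]; apply: K2_plus_good.
  - by case=> r [s]; apply: double_K2_good.
  - exact: necklace_good.
split=> [c uc s2 ev|c d uc ud oc od].
  have [B [bB uB]] := cycle_in_block s2 uc.
  have [biB|nB] := boolP (bipartite B).
    exact: small_block_cycle4 (bip B bB biB) uB s2.
  by have [C1 _] := nongood B bB nB; apply: C1.
have [B [bB uB]] := cycle_in_block (big _ _ uc oc) uc.
have [B' [bB' uB']] := cycle_in_block (big _ _ ud od) ud.
have nB : ~~ bipartite B.
  by apply/negP => /bipartite_no_odd_cycle /(_ uB); rewrite oc.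
have nB' : ~~ bipartite B'.
  by apply/negP => /bipartite_no_odd_cycle /(_ uB'); rewrite od.
have BB : B = B'.
  by move/card_le1_eqP: one; apply; rewrite inE ?bB ?bB'.
have [_ C2] := nongood B bB nB; apply: C2 => //.
by rewrite BB.
Qed.

(** * Closed walks and the four-cycles among their edges *)

Fixpoint walk_edges (V : finType) (x : V) (p : seq V) : seq {set V} :=
  if p is y :: p' then [set x; y] :: walk_edges y p' else [::].

Lemma walk_edges_cat (V : finType) (x : V) p q :
  walk_edges x (p ++ q) = walk_edges x p ++ walk_edges (last x p) q.
Proof. by elim: p x => //= y p IH x; rewrite IH. Qed.

Lemma walk_edges_rcons (V : finType) (x : V) p y :
  walk_edges x (rcons p y) = rcons (walk_edges x p) [set last x p; y].
Proof. by rewrite -cats1 walk_edges_cat cats1. Qed.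

Lemma walk_edges_rel (V : finType) (r : rel V) x p f : path r x p ->
  f \in walk_edges x p ->
  exists a b, [/\ r a b, a \in x :: p, b \in x :: p & f = [set a; b]].
Proof.
elim: p x => //= y p IH x /andP[xy yp]; rewrite inE => /orP[/eqP ->|/(IH y yp)].
  by exists x, y; rewrite !inE !eqxx !orbT.
case=> a [b [ab ap bp ->]]; exists a, b; split=> //.
  by rewrite inE ap orbT.
by rewrite inE bp orbT.
Qed.

Lemma walk_edges_sub (V : finType) (x : V) p f z :
  f \in walk_edges x p -> z \in f -> z \in x :: p.
Proof.
have xp : path [rel _ _ | true] x p by elim: p x => //=.
by move=> /(walk_edges_rel xp) [a [b [_ ap bp ->]]]; rewrite !inE => /orP[] /eqP ->.
Qed.

Lemma walk_edges_rev (V : finType) (x : V) p :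
  walk_edges (last x p) (rev (belast x p)) =i walk_edges x p.
Proof.
elim: p x => [|y p IH] x f //=; rewrite rev_cons walk_edges_rcons mem_rcons !inE IH.
have -> : last (last y p) (rev (belast y p)) = y.
  by case: p {IH} => //= z p; rewrite rev_cons last_rcons.
by rewrite setUC.
Qed.

Definition four_cycle_in (V : finType) (E : pred {set V}) :=
  exists a b c d, [/\ uniq [:: a; b; c; d], E [set a; b], E [set b; c],
    E [set c; d] & E [set d; a]].

(** At [v0] both edges of the four-cycle are edges of [c], so that it runs
    along [c] on both sides. At most one of its vertices is the junction [j],
    and the others force the remaining edges as well. *)
Lemma four_cycle_absorbed (V : finType) (r : rel V) (E : pred {set V}) c j v0 v1 v2 v3 :
  ucycle r c -> uniq [:: v0; v1; v2; v3] ->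
  E [set v0; v1] -> E [set v1; v2] -> E [set v2; v3] -> E [set v3; v0] ->
  (forall v w, v \in c -> v != j -> E [set v; w] ->
     w \in c /\ (w = next c v \/ v = next c w)) ->
  v0 \in c -> v0 != j -> size c = 4.
Proof.
move=> uc; have [_ uu] := andP uc.
wlog n01 : v1 v3 / v1 = next c v0.
  move=> W u4 e01 e12 e23 e30 loc v0c v0j.
  have [_ [e|e]] := loc _ _ v0c v0j e01; first exact: (W v1 v3 e u4).
  have e03 : E [set v0; v3] by rewrite setUC.
  have [_ [e'|e']] := loc _ _ v0c v0j e03.
    apply: (W v3 v1 e') => //; try by rewrite setUC.
    move: u4; rewrite /= !inE !negb_or.
    case/and4P=> /and3P[h1 h2 h3] /andP[h4 h5] h6 _.
    by rewrite h1 h2 h3 (eq_sym v3) h6 (eq_sym v3) h5 (eq_sym v2) h4.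
  have e13 : v1 = v3.
    by rewrite -(prev_next uu v1) -(prev_next uu v3) -e -e'.
  by move: u4; rewrite e13 /= !inE eqxx !orbT andbF.
move=> u4 e01 e12 e23 e30 loc v0c v0j.
move: u4; rewrite /= !inE !negb_or.
case/and4P=> /and3P[h01 h02 h03] /andP[h12 h13] h23 _.
have [v3c n30] : v3 \in c /\ v0 = next c v3.
  have e03 : E [set v0; v3] by rewrite setUC.
  have [v3c [e|//]] := loc _ _ v0c v0j e03.
  by case/negP: h13; rewrite n01 e.
have v1c : v1 \in c by rewrite n01 mem_next.
have e10 : E [set v1; v0] by rewrite setUC.
have e21 : E [set v2; v1] by rewrite setUC.
have e32 : E [set v3; v2] by rewrite setUC.
have inj x y : next c x = next c y -> x = y.
  by move=> e; rewrite -(prev_next uu x) e prev_next.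
have f1 : v1 != j -> v2 = next c v1.
  move=> v1j; have [_ [//|e]] := loc _ _ v1c v1j e12.
  by case/negP: h02; rewrite (inj v2 v0) // -e n01.
have f3 : v3 != j -> v3 = next c v2 /\ v2 \in c.
  move=> v3j; have [v2c [e|//]] := loc _ _ v3c v3j e32.
  by case/negP: h02; rewrite n30 e.
have [n12 n23] : v2 = next c v1 /\ v3 = next c v2.
  have [v1j|v1j] := eqVneq v1 j.
    have v3j : v3 != j by rewrite -v1j eq_sym.
    have [n23 v2c] := f3 v3j; split=> //.
    have v2j : v2 != j by rewrite -v1j eq_sym.
    have [_ [e|//]] := loc _ _ v2c v2j e21.
    by case/negP: h13; rewrite e n23.
  split; first exact: f1.
  have v2c : v2 \in c by rewrite (f1 v1j) mem_next.
  have [v3j|v3j] := eqVneq v3 j; last by case: (f3 v3j).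
  have v2j : v2 != j by rewrite -v3j.
  have [_ [//|e]] := loc _ _ v2c v2j e23.
  by case/negP: h02; rewrite n30 e.
have closed z : z \in [:: v0; v1; v2; v3] -> next c z \in [:: v0; v1; v2; v3].
  rewrite !inE => /or4P[] /eqP ->; rewrite -?n01 -?n12 -?n23 -?n30 !eqxx ?orbT //.
have sub : {subset c <= [:: v0; v1; v2; v3]}.
  case/rot_to: (v0c) => i t tE z; rewrite -(mem_rot i) tE => zt.
  have fc : path (frel (next c)) v0 t.
    have := cycle_next uu; rewrite -(rot_cycle i) tE /= rcons_path.
    by case/andP.
  have go s b : b \in [:: v0; v1; v2; v3] -> path (frel (next c)) b s ->
      z \in b :: s -> z \in [:: v0; v1; v2; v3].
    elim: s b => [|a s IH] b bD /=; first by move=> _; rewrite inE => /eqP ->.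
    case/andP=> /eqP ba as'; rewrite in_cons => /orP[/eqP -> //|].
    by apply: IH => //; rewrite -ba; apply: closed.
  by apply: go fc zt; rewrite inE eqxx.
have sup : {subset [:: v0; v1; v2; v3] <= c}.
  move=> z; rewrite !inE => /or4P[] /eqP -> //; first by rewrite n12 mem_next.
have u4 : uniq [:: v0; v1; v2; v3].
  by rewrite /= !inE !negb_or h01 h02 h03 h12 h13 h23.
have := uniq_leq_size uu sub; have := uniq_leq_size u4 sup.
by rewrite /= => a b; apply/eqP; rewrite eqn_leq a b.
Qed.

Lemma cycle_walk_local (V : finType) (x : V) p v w : uniq (x :: p) ->
  [set v; w] \in walk_edges x (rcons p x) ->
  [/\ v \in x :: p, w \in x :: p & w = next (x :: p) v \/ v = next (x :: p) w].
Proof.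
move=> uc; set c := x :: p in uc *.
have fc : path (frel (next c)) x (rcons p x) by apply: (cycle_next uc).
move=> /(walk_edges_rel fc) [a [b [/eqP ab ac bc E]]].
have mc z : (z \in x :: rcons p x) = (z \in c).
  by rewrite !inE mem_rcons inE orbA orbb.
move: ac bc; rewrite !mc => ac bc.
by case: (set2_eq E) => [[-> ->]|[-> ->]]; split=> //; [left|right].
Qed.

(** The positions of adjacent vertices on a path differ by one, and four
    distinct positions cannot be arranged cyclically in this way. *)
Lemma path_no_four_cycle (V : finType) (x : V) p : uniq (x :: p) ->
  ~ four_cycle_in [in walk_edges x p].
Proof.
move=> up [a [b [c [d [u4 ab bc cd da]]]]].
have idx v w : [set v; w] \in walk_edges x p ->
    [/\ v \in x :: p, w \in x :: p & index w (x :: p) = (index v (x :: p)).+1 \/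
      index v (x :: p) = (index w (x :: p)).+1].
  elim: p x up {ab bc cd da} => //= y p IH x /andP[xp up].
  rewrite in_cons => /orP[/eqP /set2_eq E|/(IH y up) [vp wp h]].
    have xy : x == y = false.
      by apply/negP => /eqP e; rewrite e mem_head in xp.
    by case: E => [[-> ->]|[-> ->]]; rewrite !eqxx xy !inE !eqxx ?orbT; split=> //;
      [left|right].
  have nx z : z \in y :: p -> (x == z) = false.
    by move=> zp; apply/negP => /eqP e; rewrite e zp in xp.
  rewrite !(nx _ vp) !(nx _ wp); split; first by rewrite in_cons vp orbT.
    by rewrite in_cons wp orbT.
  by case: h => /= ->; [left|right].
have [ap bp iab] := idx _ _ ab; have [_ cp ibc] := idx _ _ bc.
have [_ dp icd] := idx _ _ cd; have [_ _ ida] := idx _ _ da.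
have neq v w : v \in x :: p -> w \in x :: p -> v != w ->
    index v (x :: p) != index w (x :: p).
  move=> vp wp; apply: contra => /eqP e.
  by rewrite -(nth_index x vp) -(nth_index x wp) e.
move: u4; rewrite /= !inE !negb_or => /and4P[/and3P[_ hac _] /andP[_ hbd] _ _].
have := neq _ _ ap cp hac; have := neq _ _ bp dp hbd.
move: iab ibc icd ida; clear; lia.
Qed.

(** Provides the edge of odd multiplicity that makes the relation of a closed
    walk nontrivial. *)
Lemma cycle_walk_first (V : finType) (x y : V) r : uniq [:: x, y & r] -> r != [::] ->
  count_mem [set x; y] (walk_edges x (rcons (y :: r) x)) = 1.
Proof.
move=> u r0; rewrite /= eqxx walk_edges_rcons -cats1 count_cat /= addn0.
have -> : count_mem [set x; y] (walk_edges y r) = 0.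
  apply/eqP; rewrite -leqn0 leqNgt -has_count has_pred1; apply/negP => h.
  have : x \in y :: r by apply: (walk_edges_sub h); rewrite !inE eqxx.
  by move=> xr; move: u; rewrite cons_uniq xr.
case: eqP => // /set2_eq [[e1 e2]|[e1 _]].
  by move: u; rewrite e2 /= inE eqxx.
have : last y r \in r by case: (r) r0 => //= z r' _; apply: mem_last.
by rewrite e1 => yr; move: u; rewrite /= yr andbF.
Qed.

(** A shortest path from [c] to [d] has these properties; by minimality it is
    trivial if [c] and [d] meet. *)
Lemma dumbbell (V : finType) (G : graph V) c d : connected G ->
  ucycle (adj G) c -> ucycle (adj G) d -> c != [::] -> d != [::] ->
  (forall z w, z \in c -> z \in d -> w \in c -> w \in d -> z = w) ->
  exists x q, [/\ path (adj G) x q, uniq (x :: q), x \in c, last x q \in d &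
    [/\ forall z, z \in c -> z \in x :: q -> z = x,
        forall z, z \in d -> z \in x :: q -> z = last x q &
        forall z, z \in c -> z \in d -> z = x /\ z = last x q]].
Proof.
move=> /connectedP [_ cG] uc ud c0 d0 one.
have inG e x : ucycle (adj G) e -> x \in e -> x \in verts G.
  by move=> /andP[ce _] xe; apply: adj_vl (next_cycle ce xe).
pose P n := [exists x in c, exists t : n.-tuple V, path (adj G) x t && (last x t \in d)].
have PP x q : x \in c -> path (adj G) x q -> last x q \in d -> P (size q).
  move=> xc qP ld; apply/existsP; exists x; rewrite xc /=.
  by apply/existsP; exists (in_tuple q); rewrite /= qP ld.
have exP : exists n, P n.
  have [x xc] : exists x, x \in c by case: (c) c0 => // x e _; exists x; apply: mem_head.
  have [y yd] : exists y, y \in d by case: (d) d0 => // y e _; exists y; apply: mem_head.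
  have /connectP [q qP l] := cG x y (inG _ _ uc xc) (inG _ _ ud yd).
  by exists (size q); apply: (PP x); rewrite // -l.
case: (ex_minnP exP) => n /existsP [x /andP[xc /existsP [t /andP[tP lt]]]] mn.
have mn' y q : y \in c -> path (adj G) y q -> last y q \in d -> size t <= size q.
  by move=> yc qP lq; rewrite size_tuple; apply: mn; apply: PP yc qP lq.
move: (tval t) tP lt mn' => q {t mn}; case/shortenP => q' qP' uq' sub lq mn.
have suffix z q2 : z \in c -> path (adj G) z q2 -> last z q2 \in d ->
    size q2 < size q' -> False.
  move=> zc q2P lq2; have := mn z q2 zc q2P lq2.
  have /andP[_ uq] := uq'; have := uniq_leq_size uq sub.
  by move=> h1 h2; rewrite ltnNge (leq_trans h1 h2).
exists x, q'; split=> //; split.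
- move=> z zc; rewrite inE => /orP[/eqP //|zq].
  case/splitPr: zq qP' lq suffix {uq' sub mn} => q1 q2.
  rewrite cat_path last_cat /= => /and3P[_ _ q2P] lq suffix.
  by case: (suffix z q2 zc q2P lq); rewrite size_cat /= addnS ltnS leq_addl.
- move=> z zd; rewrite inE => /orP[/eqP zx|zq].
    rewrite {z}zx in zd *; case: q' {qP' uq' sub lq mn} suffix => //= a q' suffix.
    by case: (suffix x [::] xc isT zd).
  case/splitPr: zq qP' uq' suffix {sub lq mn} => q1 q2.
  rewrite -cat_rcons cat_path last_cat last_rcons => /andP[q1P _] _ suffix.
  case: q2 suffix => [//|a q2] suffix; case: (suffix x (rcons q1 z) xc q1P).
    by rewrite last_rcons.
  by rewrite size_cat /= -addSnnS ltnS leq_addr.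
move=> z zc zd; have q'0 : q' = [::].
  by case: q' {qP' uq' sub lq mn} suffix => // a q' /(_ z [::] zc isT zd isT).
rewrite q'0 /= in lq *; have e := one z x zc zd xc lq.
by rewrite e.
Qed.

Lemma cycle_no_four_cycle (V : finType) (r : rel V) x p :
  ucycle r (x :: p) -> size (x :: p) != 4 ->
  ~ four_cycle_in [in walk_edges x (rcons p x)].
Proof.
move=> uc s4 [a [b [c [d [u4 ab bc cd da]]]]]; have [_ uu] := andP uc.
have [ac _ _] := cycle_walk_local uu ab.
case/negP: s4; apply/eqP.
apply: (four_cycle_absorbed (j := b) uc u4 ab bc cd da) => //.
  by move=> v w _ _ /(cycle_walk_local uu) [].
by apply: contraTneq u4 => ->; rewrite /= inE eqxx.
Qed.

(** [four_cycle_absorbed] keeps the four-cycle away from the two odd cycles, so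
    all its edges would lie on the path. *)
Lemma dumbbell_no_four_cycle (V : finType) (r : rel V) x p q y p' :
  ucycle r (x :: p) -> ucycle r (y :: p') -> odd (size (x :: p)) -> odd (size (y :: p')) ->
  uniq (x :: q) -> last x q = y ->
  (forall z, z \in x :: p -> z \in x :: q -> z = x) ->
  (forall z, z \in y :: p' -> z \in x :: q -> z = y) ->
  (forall z, z \in x :: p -> z \in y :: p' -> z = x /\ z = y) ->
  ~ four_cycle_in [pred f | [|| f \in walk_edges x (rcons p x),
       f \in walk_edges x q | f \in walk_edges y (rcons p' y)]].
Proof.
move=> uc ud oc od uq lq cq dq cd; set E := [pred f | _].
have [_ uuc] := andP uc; have [_ uud] := andP ud.
have sq v w : [set v; w] \in walk_edges x q -> v \in x :: q.
  by move=> h; apply: (walk_edges_sub h); rewrite !inE eqxx.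
have key1 a b c d : uniq [:: a; b; c; d] -> E [set a; b] -> E [set b; c] ->
    E [set c; d] -> E [set d; a] -> a \in x :: p -> a = x.
  move=> u4 ab bc cd' da ac; apply/eqP/negPn/negP => ax.
  have s4 : size (x :: p) = 4; last by rewrite s4 in oc.
  apply: (four_cycle_absorbed uc u4 ab bc cd' da _ ac ax) => v w vc vx /or3P[h|h|h].
  - by have [_ wc h'] := cycle_walk_local uuc h.
  - by rewrite (cq v vc (sq _ _ h)) eqxx in vx.
  - have [vd _ _] := cycle_walk_local uud h.
    by have [e _] := cd v vc vd; rewrite e eqxx in vx.
have key2 a b c d : uniq [:: a; b; c; d] -> E [set a; b] -> E [set b; c] ->
    E [set c; d] -> E [set d; a] -> a \in y :: p' -> a = y.
  move=> u4 ab bc cd' da ac; apply/eqP/negPn/negP => ay.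
  have s4 : size (y :: p') = 4; last by rewrite s4 in od.
  apply: (four_cycle_absorbed ud u4 ab bc cd' da _ ac ay) => v w vd vy /or3P[h|h|h].
  - have [vc _ _] := cycle_walk_local uuc h.
    by have [_ e] := cd v vc vd; rewrite e eqxx in vy.
  - by rewrite (dq v vd (sq _ _ h)) eqxx in vy.
  - by have [_ wc h'] := cycle_walk_local uud h.
have key a b c d : uniq [:: a; b; c; d] -> E [set a; b] -> E [set b; c] ->
    E [set c; d] -> E [set d; a] -> [set a; b] \in walk_edges x q.
  move=> u4 ab bc cd' da.
  have u4' : uniq [:: b; c; d; a] by rewrite -(rot_uniq 1) in u4.
  have nab : a <> b by move=> e; rewrite e /= inE eqxx in u4.
  case/or3P: (ab) => [h|//|h].
  - have [ac bc' _] := cycle_walk_local uuc h.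
    by case: nab; rewrite (key1 a b c d) // (key1 b c d a).
  - have [ac bc' _] := cycle_walk_local uud h.
    by case: nab; rewrite (key2 a b c d) // (key2 b c d a).
move=> [a [b [c [d [u4 ab bc cd' da]]]]].
have u4' : uniq [:: b; c; d; a] by rewrite -(rot_uniq 1) in u4.
have u4'' : uniq [:: c; d; a; b] by rewrite -(rot_uniq 2) in u4.
have u4''' : uniq [:: d; a; b; c] by rewrite -(rot_uniq 3) in u4.
apply: (path_no_four_cycle uq); exists a, b, c, d; split=> //.
- exact: (key a b c d).
- exact: (key b c d a).
- exact: (key c d a b).
- exact: (key d a b c).
Qed.

(** The edges at even and at odd positions of a closed walk of even length
    cover each vertex equally often. An edge of odd multiplicity occurs
    differently often among them, so the walk then carries a nontrivial
    relation. *)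
Definition closed_walks_have_four_cycles (V : finType) (G : graph V) :=
  forall x w e, path (adj G) x w -> last x w = x -> ~~ odd (size w) ->
    odd (count_mem e (walk_edges x w)) -> four_cycle_in [in walk_edges x w].

(** The walks used: around an even cycle; or around an odd cycle, along a path
    to another odd cycle, around this one, and back. *)
Lemma good_cycles_of_walks (V : finType) (G : graph V) : connected G ->
  closed_walks_have_four_cycles G -> good_cycles (adj G).
Proof.
move=> cG H; split=> [c uc s2 ev|c d uc ud oc od].
  apply/eqP/negPn/negP => s4.
  case: c uc s2 ev s4 => [//|x [//|y [//|z r]]] uc _ ev s4.
  have [cc uu] := andP uc; apply: (cycle_no_four_cycle uc s4).
  apply: (H x _ [set x; y]) => //; first by rewrite last_rcons.
    by rewrite size_rcons.
  by rewrite cycle_walk_first.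
case: (boolP [exists x, exists y, [&& x != y, x \in c, x \in d, y \in c & y \in d]]).
  by case/existsP=> x /existsP [y /and5P[*]]; exists x, y.
rewrite negb_exists => /forallP no.
have one z w : z \in c -> z \in d -> w \in c -> w \in d -> z = w.
  move=> zc zd wc wd; apply/eqP; have := no z.
  by rewrite negb_exists => /forallP /(_ w); rewrite zc zd wc wd !andbT negbK.
have nil e : odd (size e) -> e != [::] :> seq V by case: e.
have [x [q [qP uq xc ld [cq dq cd]]]] := dumbbell cG uc ud (nil c oc) (nil d od) one.
case/rot_to: xc => i p cE; case/rot_to: ld => i' p' dE.
have mc z : (z \in c) = (z \in x :: p) by rewrite -cE mem_rot.
have md z : (z \in d) = (z \in last x q :: p') by rewrite -dE mem_rot.
have {}uc : ucycle (adj G) (x :: p) by rewrite -cE ucycle_rot.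
have {}ud : ucycle (adj G) (last x q :: p') by rewrite -dE ucycle_rot.
have {}oc : odd (size (x :: p)) by rewrite -cE size_rot.
have {}od : odd (size (last x q :: p')) by rewrite -dE size_rot.
have {}cq z : z \in x :: p -> z \in x :: q -> z = x by rewrite -mc; apply: cq.
have {}dq z : z \in last x q :: p' -> z \in x :: q -> z = last x q.
  by rewrite -md; apply: dq.
have {}cd z : z \in x :: p -> z \in last x q :: p' -> z = x /\ z = last x q.
  by rewrite -mc -md; apply: cd.
case: (dumbbell_no_four_cycle uc ud oc od uq erefl cq dq cd).
have [y [r [pE r0]]] : exists y r, p = y :: r /\ r != [::].
  case: p uc oc {cE mc cq cd} => [|y [|z r]] // uc _; last by exists y, (z :: r).
  by have [/= ] := andP uc; rewrite adj_irr.
pose back := rev (belast x q).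
pose w := rcons p x ++ q ++ rcons p' (last x q) ++ back.
have EE : walk_edges x w = walk_edges x (rcons p x) ++ walk_edges x q ++
    walk_edges (last x q) (rcons p' (last x q)) ++ walk_edges (last x q) back.
  by rewrite /w !walk_edges_cat !last_rcons.
have mE f : (f \in walk_edges x w) = [|| f \in walk_edges x (rcons p x),
    f \in walk_edges x q | f \in walk_edges (last x q) (rcons p' (last x q))].
  rewrite EE !mem_cat walk_edges_rev.
  by case: (f \in walk_edges x q); rewrite ?orbT ?orbF.
have [a [b [c' [d' [u4 h1 h2 h3 h4]]]]] : four_cycle_in [in walk_edges x w].
  apply: (H x w [set x; y]).
  - have [pc _] := andP uc; have [pd _] := andP ud.
    rewrite /w !cat_path !last_rcons; apply/and4P; split=> //.
    rewrite /back rev_path; apply: sub_path qP => s t; rewrite adjC.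
    by [].
  - rewrite /w !last_cat !last_rcons /back; case: (q) => //= a q'.
    by rewrite rev_cons last_rcons.
  - rewrite /w !size_cat !size_rcons size_rev size_belast.
    by move: oc od => /=; clear; lia.
  have yc : y \in x :: p by rewrite pE !inE eqxx orbT.
  have yx : y <> x.
    move=> e; have [_] := andP uc; by rewrite pE e /= inE eqxx.
  have zero z s : y \notin z :: s -> count_mem [set x; y] (walk_edges z s) = 0.
    move=> yz; apply/eqP; rewrite -leqn0 leqNgt -has_count has_pred1.
    by apply: contra yz => h; apply: (walk_edges_sub h); rewrite !inE eqxx orbT.
  have yq : y \notin x :: q by apply/negP => h; apply: yx; apply: cq.
  have yd : y \notin last x q :: p'.
    by apply/negP => h; apply: yx; case: (cd y yc h).
  rewrite EE !count_cat (zero x q yq).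
  rewrite (zero (last x q) (rcons p' (last x q))); last by rewrite in_cons mem_rcons in_cons orbA orbb -in_cons.
  have -> : count_mem [set x; y] (walk_edges (last x q) back) = 0.
    apply/eqP; rewrite -leqn0 leqNgt -has_count has_pred1 walk_edges_rev.
    by apply: contra yq => h; apply: (walk_edges_sub h); rewrite !inE eqxx orbT.
  rewrite pE cycle_walk_first //; have [_] := andP uc; by rewrite pE.
by exists a, b, c', d'; split=> //; move: h1 h2 h3 h4; rewrite /= !mE.
Qed.

(** * Alternating cycles in two-coloured graphs *)

Section Alternating.
Variables (V : finType) (r : bool -> rel V).
Hypotheses (rs : forall b, symmetric (r b)).
Hypothesis disj : forall b x y, r b x y -> ~~ r (~~ b) x y.
Hypothesis switch : forall b x y, r b x y -> exists z, r (~~ b) y z.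

Let e : rel V := relU (r true) (r false).
Hypothesis good : good_cycles e.

Let re b : subrel (r b) e.
Proof. by case: b => x y h; rewrite /e /= h ?orbT. Qed.

Fixpoint alternating b x p :=
  if p is y :: p' then r b x y && alternating (~~ b) y p' else true.

Lemma alternating_path b x p : alternating b x p -> path e x p.
Proof.
elim: p b x => //= y p IH b x /andP[/re xy yp].
by rewrite xy; apply: IH yp.
Qed.

Lemma alternating_cat b x p q : alternating b x (p ++ q) =
  alternating b x p && alternating (b (+) odd (size p)) (last x p) q.
Proof.
elim: p b x => [|y p IH] b x /=; first by rewrite addbF.
by rewrite IH andbA addNb addbN.
Qed.

Lemma alternating_rcons b x p y : alternating b x (rcons p y) =
  alternating b x p && r (b (+) odd (size p)) (last x p) y.
Proof. by rewrite -cats1 alternating_cat /= andbT. Qed.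

Lemma alternating_rev b x p y : alternating b x (rcons p y) ->
  alternating (b (+) odd (size p)) y (rcons (rev p) x).
Proof.
elim: p b x => [|z p IH] b x /=; first by rewrite addbF !andbT rs.
case/andP=> xz /IH h; rewrite rev_cons alternating_rcons size_rcons size_rev.
rewrite last_rcons rs; move: h; rewrite addNb addbN => ->.
by rewrite /= !addbN addNb negbK -addbA addbb addbF xz.
Qed.

Definition alternating_square := exists a b c d,
  [/\ uniq [:: a; b; c; d], r true a b, r false b c, r true c d & r false d a].

Lemma even_alternating_cycle b x p : alternating b x (rcons p x) ->
  uniq (x :: p) -> odd (size p) -> alternating_square.
Proof.
move=> ap up op; have uc : ucycle e (x :: p).
  by rewrite /ucycle up andbT; apply: alternating_path ap.
have [C1 _] := good.
case: p ap up op uc => [//|y [|z p]] ap up op uc.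
  by move: ap; rewrite /= andbT rs => /andP[h]; rewrite (negPf (disj h)).
have := C1 _ uc isT; rewrite /= negbK in op *; rewrite op => /(_ isT) [].
case: p ap up {op uc} => [//|t [|//]] ap up _.
move: ap; rewrite /= !andbT negbK; case: b => /and4P[h1 h2 h3 h4].
  by exists x, y, z, t.
by exists y, z, t, x; split=> //; move: up; rewrite -(rot_uniq 1).
Qed.

(** Walk on with alternating colours until the walk meets [A] or itself. *)
Lemma lasso (A : {pred V}) b y : (exists z, r b y z) ->
  exists p z, [/\ alternating b y (rcons p z), uniq p, all [predC A] p &
    (z \in A) || (z \in p)].
Proof.
move=> st.
(* [k] bounds the number of vertices that the walk has not used yet *)
have go k p : #|V| - size p <= k -> alternating b y p -> uniq p -> all [predC A] p ->
    (exists z, r (b (+) odd (size p)) (last y p) z) ->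
  exists p z, [/\ alternating b y (rcons p z), uniq p, all [predC A] p &
    (z \in A) || (z \in p)].
  elim: k p => [|k IH] p sk ap up Ap [z hz].
    have [zA|zA] := boolP ((z \in A) || (z \in p)).
      by exists p, z; split=> //; rewrite alternating_rcons ap hz.
    move: zA; rewrite negb_or => /andP[_ zp].
    have : uniq (z :: p) by rewrite /= zp.
    move/card_uniqP => /= su; have := max_card [in z :: p]; rewrite su.
    by move: sk; clear; lia.
  have [zA|zA] := boolP ((z \in A) || (z \in p)).
    by exists p, z; split=> //; rewrite alternating_rcons ap hz.
  move: zA; rewrite negb_or => /andP[zA zp]; apply: (IH (rcons p z)).
  - by move: sk; rewrite size_rcons; clear; lia.
  - by rewrite alternating_rcons ap hz.
  - by rewrite rcons_uniq zp.
  - by rewrite all_rcons /= zA.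
  by have [w hw] := switch hz; exists w; rewrite last_rcons size_rcons /= addbN.
by apply: (go #|V| [::]); rewrite ?leq_subr //= addbF.
Qed.

Lemma alternating_loop b y s z t : alternating b y (rcons (s ++ z :: t) z) ->
  alternating (b (+) odd (size s).+1) z (rcons t z).
Proof.
rewrite rcons_cat -cat_rcons alternating_cat last_rcons size_rcons.
by case/andP.
Qed.

(** A first walk closes up to an even alternating cycle, or to an odd cycle
    with both edges at [y] of the same colour.  A second walk leaves the odd
    cycle at [y] in the other colour.  If it closes up on its own, the result is
    an even cycle, since odd cycles share two vertices.  Otherwise it comes back
    to the odd cycle at another vertex, and forms an even alternating cycle with
    one of its two arcs. *)
Theorem alternating_square_exists x0 x1 : r true x0 x1 -> alternating_square.
Proof.
move=> h01; have [_ C2] := good.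
have [sq|[b [y [p [ap up ep]]]]] : alternating_square \/ exists b y p,
    [/\ alternating b y (rcons p y), uniq (y :: p) & ~~ odd (size p)].
  have [|p [z [ap up Ap zP]]] := @lasso (pred1 x0) true x0; first by exists x1.
  have fin b' z' p' : alternating b' z' (rcons p' z') -> uniq (z' :: p') ->
     alternating_square \/ exists b y p,
    [/\ alternating b y (rcons p y), uniq (y :: p) & ~~ odd (size p)].
    move=> ap' up'; have [o|o] := boolP (odd (size p')).
      by left; apply: even_alternating_cycle ap' up' o.
    by right; exists b', z', p'.
  case/orP: zP => [/eqP zx|zp].
    rewrite zx in ap; apply: fin ap _; rewrite /= up andbT.
    by apply/negP => /(allP Ap); rewrite /= inE eqxx.
  case/splitPr: zp ap up {Ap} => s t ap up.
  by apply: fin (alternating_loop ap) _; move: up; rewrite cat_uniq => /and3P[].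
  by [].
have uC : ucycle e (y :: p).
  by rewrite /ucycle up andbT; apply: alternating_path ap.
have oC : odd (size (y :: p)) by [].
have [z0 hz0] : exists z, r (~~ b) y z.
  have : exists w, r b w y.
    by case: (p) ap => [|w p'] /= /andP[h _]; [exists y|exists w; rewrite rs].
  by case=> w; apply: switch.
have [|q [z [aq uq Aq zP]]] := @lasso (mem (y :: p)) (~~ b) y; first by exists z0.
have qC w : w \in q -> w \notin y :: p by move/(allP Aq).
have clash b' z' t : alternating b' z' (rcons t z') -> uniq (z' :: t) ->
    (forall w, w \in y :: p -> w \in z' :: t -> w = y) -> odd (size t).
  move=> at' ut h; apply/negPn/negP => ot.
  have ut' : ucycle e (z' :: t).
    by rewrite /ucycle ut andbT; apply: alternating_path at'.
  have [v [w [vw v1 v2 w1 w2]]] := C2 _ _ uC ut' oC (ot : odd (size (z' :: t))).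
  by case/negP: vw; rewrite (h v v1 v2) (h w w1 w2).
case/orP: zP => [zC|zq]; last first.
  case/splitPr: zq aq uq qC {Aq} => s t aq uq qC.
  have at' := alternating_loop aq.
  have ut : uniq (z :: t) by move: uq; rewrite cat_uniq => /and3P[].
  apply: even_alternating_cycle at' ut (clash _ _ _ at' ut _) => w wC wt.
  by have := qC w; rewrite mem_cat wt orbT wC => /(_ isT).
have uyq : uniq (y :: q).
  by rewrite /= uq andbT; apply/negP => /qC; rewrite mem_head.
have [zy|zy] := eqVneq z y.
  rewrite zy in aq; apply: even_alternating_cycle aq uyq (clash _ _ _ aq uyq _).
  by move=> w wC; rewrite in_cons => /orP[/eqP //|/qC]; rewrite wC.
move: zC; rewrite in_cons (negPf zy) /= => zp.
case/splitPr: zp ap up ep qC {uC oC clash Aq} => t1 t2 ap up ep qC.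
have [a1 a2] : alternating b y (rcons t1 z) /\
    alternating (b (+) odd (size t1).+1) z (rcons t2 y).
  apply/andP; move: ap; rewrite rcons_cat -cat_rcons alternating_cat.
  by rewrite last_rcons size_rcons.
have inC w : w \in y :: t1 ++ z :: t2 -> w \notin q.
  by move=> wC; apply/negP => /qC; rewrite wC.
have zq : z \notin q by apply: inC; rewrite in_cons mem_cat mem_head !orbT.
have yq : y \notin q by apply: inC; rewrite mem_head.
move: up; rewrite cons_uniq mem_cat inE !negb_or cat_uniq /= negb_or.
case/and3P=> /and3P[y1 _ y2] u1 /and3P[/andP[z1 _] z2 u2].
have [eq1|ne1] := eqVneq (odd (size q)) (odd (size t1)).
  apply: (@even_alternating_cycle b y (t1 ++ z :: rev q)).
  - rewrite rcons_cat -cat_rcons alternating_cat a1 last_rcons size_rcons /=.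
    by have := alternating_rev aq; rewrite eq1 addNb addbN.
  - rewrite cons_uniq mem_cat inE mem_rev !negb_or y1 yq eq_sym zy cat_uniq u1 /=.
    rewrite mem_rev zq rev_uniq uq negb_or z1 /= andbT.
    apply/hasPn => w; rewrite mem_rev => /qC; apply: contra => w1.
    by rewrite in_cons mem_cat w1 orbT.
  by rewrite size_cat /= size_rev addnS /= oddD eq1 addbb.
apply: (@even_alternating_cycle (~~ b) y (q ++ z :: t2)).
- rewrite rcons_cat -cat_rcons alternating_cat aq last_rcons size_rcons /=.
  move: a2; rewrite /= addbN addNb addbN negbK.
  by move: ne1; case: (odd (size q)); case: (odd (size t1)) => // _; rewrite ?addbT ?addbF ?negbK.
- rewrite cons_uniq mem_cat inE !negb_or yq y2 eq_sym zy cat_uniq uq /=.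
  rewrite negb_or zq z2 u2 /= andbT; apply/hasPn => w w2; apply: inC.
  by rewrite in_cons mem_cat in_cons w2 !orbT.
rewrite size_cat /= addnS /= oddD; move: ep ne1.
rewrite size_cat /= addnS /= oddD.
by case: (odd (size q)); case: (odd (size t1)); case: (odd (size t2)).
Qed.

End Alternating.

From mathcomp Require Import all_order all_algebra.
From mathcomp.multinomials Require Import mpoly.
From Stdlib Require Import Classical_Prop.
Import GRing.Theory.

(** * Ideals of polynomials as spans *)

Section Span.
Local Open Scope ring_scope.
Variables (K : fieldType) (n : nat).
Implicit Types (S : {mpoly K[n]} -> Prop) (p g : {mpoly K[n]}).

(** The ideal generated by [S], as the span of the multiples of members of [S]
    by monomials; the form that lends itself to induction. *)
Inductive monomial_span S : {mpoly K[n]} -> Prop :=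
| monomial_span0 : monomial_span S 0
| monomial_spanD a m g p : S g -> monomial_span S p ->
    monomial_span S (a *: ('X_[m] * g) + p).

Lemma monomial_span_add S p q :
  monomial_span S p -> monomial_span S q -> monomial_span S (p + q).
Proof.
move=> sp sq; elim: sp => [|a m g p' Sg _ IH]; first by rewrite add0r.
by rewrite -addrA; apply: monomial_spanD.
Qed.

Lemma monomial_span_mul S c g : S g -> monomial_span S (c * g).
Proof.
move=> Sg; rewrite [c]mpolyE mulr_suml.
elim: (msupp c) => [|m s IH]; first by rewrite big_nil; apply: monomial_span0.
by rewrite big_cons -scalerAl; apply: monomial_spanD.
Qed.

Lemma ideal_generatedE S p : ideal_generated S p <-> monomial_span S p.
Proof.
split=> [[k [c [g [Sg ->]]]]|].
  elim/big_ind: _ => [||i _]; first exact: monomial_span0.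
    exact: monomial_span_add.
  exact: monomial_span_mul.
elim=> [|a m g q Sg _ [k [c [h [Sh ->]]]]].
  by exists 0%N, (fun _ => 0), (fun _ => 0); split=> [[]//|]; rewrite big_ord0.
exists k.+1, (fun i => if unlift ord0 i is Some j then c j else a *: 'X_[m]),
  (fun i => if unlift ord0 i is Some j then h j else g); split.
  by move=> i; case: unliftP.
rewrite big_ord_recl unlift_none scalerAl; congr (_ + _).
by apply: eq_bigr => i _; rewrite liftK.
Qed.

Lemma ideal_generated_mem S p : S p -> ideal_generated S p.
Proof.
move=> Sp; apply/ideal_generatedE; rewrite -[p]mul1r.
exact: monomial_span_mul.
Qed.

Lemma monomial_span_scale S a m p : monomial_span S p ->
  monomial_span S (a *: ('X_[m] * p)).
Proof.
elim=> [|b m' g q Sg _ IH].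
  by rewrite mulr0 scaler0; apply: monomial_span0.
rewrite mulrDr scalerDr -scalerAr mulrA -mpolyXD scalerA.
exact: monomial_spanD.
Qed.

Lemma monomial_span_sub S T p :
  (forall g, S g -> monomial_span T g) -> monomial_span S p -> monomial_span T p.
Proof.
move=> ST; elim=> [|a m g q Sg _ IH]; first exact: monomial_span0.
by apply: monomial_span_add IH; apply: monomial_span_scale; apply: ST.
Qed.

Lemma monomial_span_mono S T p :
  (forall g, S g -> T g) -> monomial_span S p -> monomial_span T p.
Proof.
move=> ST; apply: monomial_span_sub => g /ST Tg.
by rewrite -[g]mul1r; apply: monomial_span_mul.
Qed.

(** The coefficient of [X^w] in some term of the combination is nonzero. *)
Lemma monomial_ideal_mem S w :
  (forall q, S q -> exists u, q = 'X_[u]) ->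
  monomial_span S 'X_[w] -> exists2 u, S 'X_[u] & (u <= w)%MM.
Proof.
move=> SX; have : ('X_[w] : {mpoly K[n]})@_w != 0 by rewrite mcoeffX eqxx oner_eq0.
move: ('X_[w] : {mpoly K[n]}) => p + sp; elim: sp => [|a m g q Sg _ IH].
  by rewrite mcoeff0 eqxx.
have [u gE] := SX g Sg; rewrite gE -mpolyXD mcoeffD mcoeffZ mcoeffX.
have [<- _|_] := eqVneq (m + u)%MM w.
  by exists u; rewrite -?gE // lem_addl.
by rewrite mulr0 add0r.
Qed.

End Span.

(** * Dickson's lemma *)

(** Induction on the number of coordinates. A finite set of minimal elements of
    the projection lifts to tuples with first coordinate at most some [N], and
    the tuples with a smaller first coordinate fall into finitely many slices.
    *)
Lemma dickson_tuple n (P : n.-tuple nat -> Prop) :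
  exists s : seq (n.-tuple nat), (forall t, t \in s -> P t) /\
    forall t, P t -> exists2 t', t' \in s & forall i, tnth t' i <= tnth t i.
Proof.
elim: n P => [|n IH] P.
  have [Pt|nP] := classic (P [tuple]).
    exists [:: [tuple]]; split=> [t|t _]; first by rewrite inE => /eqP ->.
    by exists [tuple]; rewrite ?inE // => -[].
  by exists [::]; split=> // t Pt; rewrite tuple0 in Pt.
have slices N : exists s : seq (n.+1.-tuple nat), (forall t, t \in s -> P t) /\
    forall a (t : n.-tuple nat), a < N -> P [tuple of a :: t] ->
      exists2 t', t' \in s & forall i, tnth t' i <= tnth [tuple of a :: t] i.
  elim: N => [|N [s [sP sd]]]; first by exists [::].
  have [s' [sP' sd']] := IH (fun t : n.-tuple nat => P [tuple of N :: t]).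
  exists (s ++ [seq [tuple of N :: (t : n.-tuple nat)] | t <- s']); split.
    by move=> t; rewrite mem_cat => /orP[/sP//|/mapP [t' /sP' ? ->]].
  move=> a t; rewrite ltnS leq_eqVlt => /orP[/eqP -> Pt|aN Pt].
    have [t' ts le] := sd' t Pt; exists [tuple of N :: t'].
      by rewrite mem_cat; apply/orP; right; apply: map_f.
    move=> i; have [->|[j ->]] : i = ord0 \/ exists j, i = lift ord0 j.
    - by case: (unliftP ord0 i) => [j ->|->]; [right; exists j|left].
    - by rewrite !tnth0.
    by rewrite !tnthS.
  have [t' ts le] := sd a t aN Pt; exists t' => //.
  by rewrite mem_cat ts.
have [s' [sP' sd']] := IH (fun t : n.-tuple nat => exists a, P [tuple of a :: t]).
have [s0 [N [s0P sN s0d]]] : exists (s0 : seq (n.+1.-tuple nat)) N,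
  [/\ forall t, t \in s0 -> P t, forall t, t \in s0 -> tnth t ord0 <= N &
    forall t : n.-tuple nat, t \in s' -> exists a, [tuple of a :: t] \in s0].
  elim: s' sP' {sd'} => [|t s' IHs] sP'; first by exists [::], 0.
  have [|s0 [N [h1 h2 h3]]] := IHs.
    by move=> x xs; apply: sP'; rewrite inE xs orbT.
  have [|a Pa] := sP' t; first by rewrite inE eqxx.
  exists ([tuple of a :: t] :: s0), (maxn a N); split.
  - by move=> x; rewrite inE => /orP[/eqP ->|/h1].
  - move=> x; rewrite inE => /orP[/eqP ->|/h2 h]; first by rewrite tnth0 leq_maxl.
    by apply: leq_trans h (leq_maxr _ _).
  move=> x; rewrite inE => /orP[/eqP ->|/h3 [b hb]].
    by exists a; rewrite inE eqxx.
  by exists b; rewrite inE hb orbT.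
have [s1 [s1P s1d]] := slices N.
exists (s0 ++ s1); split.
  by move=> t; rewrite mem_cat => /orP[/s0P|/s1P].
move=> t; have -> : t = [tuple of thead t :: behead_tuple t].
  by rewrite [LHS]tuple_eta; apply: val_inj.
move: (thead t) (behead_tuple t) => a {}t Pt.
have [aN|Na] := ltnP a N.
  by have [t' ts le] := s1d a t aN Pt; exists t' => //; rewrite mem_cat ts orbT.
have [|t' ts le] := sd' t; first by exists a.
have [b bs] := s0d t' ts; exists [tuple of b :: t']; first by rewrite mem_cat bs.
move=> i; have [->|[j ->]] : i = ord0 \/ exists j, i = lift ord0 j.
- by case: (unliftP ord0 i) => [j ->|->]; [right; exists j|left].
- by rewrite tnth0; have := sN _ bs; rewrite !tnth0 => h; apply: leq_trans h Na.
by rewrite !tnthS.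
Qed.

Lemma dickson n (P : 'X_{1..n} -> Prop) :
  exists s : seq 'X_{1..n}, forall u, P u -> exists2 w, P w & w \in s /\ (w <= u)%MM.
Proof.
have [s [sP sd]] := dickson_tuple (fun t => P (Multinom t)).
exists [seq Multinom t | t <- s] => u Pu.
have [|t ts le] := sd (val u); first by case: u Pu.
exists (Multinom t); first exact: sP.
by split; [apply: map_f|apply/mnm_lepP => i; apply: le].
Qed.

(** * Weight orders *)

Section WeightOrder.
Variables (n : nat) (w : 'I_n -> nat).

Definition weight (u : 'X_{1..n}) := \sum_i w i * u i.

Definition weight_le : rel 'X_{1..n} := fun u v =>
  (weight u < weight v) || ((weight u == weight v) && (u <= v)%O).

Lemma weightD u v : weight (u + v)%MM = weight u + weight v.
Proof.
by rewrite /weight -big_split /=; apply: eq_bigr => i _; rewrite mnmDE mulnDr.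
Qed.

Lemma weight_le_order : monomial_order weight_le.
Proof.
split.
- by move=> u v; rewrite /weight_le; case: ltngtP => //= _; apply: Order.TotalTheory.le_total.
- move=> u v; rewrite /weight_le; case: ltngtP => //= _ h.
  exact: Order.POrderTheory.le_anti h.
- move=> v u z; rewrite /weight_le => /orP[h1|/andP[/eqP -> h1]] /orP[h2|/andP[/eqP <- h2]].
  + by rewrite (ltn_trans h1 h2).
  + by rewrite h1.
  + by rewrite h2.
  by rewrite eqxx (Order.POrderTheory.le_trans h1 h2) orbT.
- move=> u; rewrite /weight_le.
  have -> : weight 0%MM = 0 by rewrite /weight big1 // => i _; rewrite mnm0E muln0.
  by case: (weight u) => //=; apply: le0m.
move=> u v z; rewrite /weight_le !weightD ltn_add2r eqn_add2r => /orP[->//|].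
by case/andP=> -> h; rewrite lemc_add2l h orbT.
Qed.

End WeightOrder.

(** * Toric ideals and their reduced Groebner bases *)

Section Toric.
Local Open Scope ring_scope.
Variables (K : fieldType) (n : nat) (D : eqType) (deg : 'X_{1..n} -> D).
(** The grading is abstract. For a graph it is the degree vector: each edge has
    two endpoints, so it determines the total degree; and an edge is determined
    by its endpoints, so it separates the variables. *)
Hypothesis deg_mdeg : forall u v, deg u = deg v -> mdeg u = mdeg v.
Hypothesis degD : forall u v w, deg u = deg v -> deg (u + w)%MM = deg (v + w)%MM.
Hypothesis degI : forall u v w, deg (u + w)%MM = deg (v + w)%MM -> deg u = deg v.
Hypothesis deg_lin : forall u v, mdeg u = 1%N -> deg u = deg v -> u = v.
Implicit Types (p q g : {mpoly K[n]}) (u v w t : 'X_{1..n}).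

Definition toric_gens (p : {mpoly K[n]}) : Prop :=
  exists u v : 'X_{1..n}, deg u = deg v /\ p = 'X_[u] - 'X_[v].

Definition toric : {mpoly K[n]} -> Prop := ideal_generated toric_gens.

Definition binom u v : {mpoly K[n]} := 'X_[u] - 'X_[v].

Lemma mcoeff_binom u v m : (binom u v)@_m = (u == m)%:R - (v == m)%:R.
Proof. by rewrite mcoeffB !mcoeffX. Qed.

Lemma toric_mem u v : deg u = deg v -> toric (binom u v).
Proof. by move=> uv; apply: ideal_generated_mem; exists u, v. Qed.

(** Holds for multiples of generators, since their two monomials lie in the
    same fibre. The sequence [s] stands for the part of the fibre that meets
    the support of [p]. *)
Lemma toric_fiber p a (s : seq 'X_{1..n}) : toric p -> uniq s ->
  (forall m, m \in s -> deg m = a) ->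
  (forall m, p@_m != 0 -> deg m = a -> m \in s) ->
  \sum_(m <- s) p@_m = 0.
Proof.
move=> /ideal_generatedE sp us sa ps.
have [s0 h0] : exists s0 : seq 'X_{1..n}, forall s, uniq s -> {subset s0 <= s} ->
    \sum_(m <- s | deg m == a) p@_m = 0.
  elim: sp => [|c m g q [u [v [uv ->]]] _ [s0 IH]].
    by exists [::] => s' _ _; rewrite big1 // => m _; rewrite mcoeff0.
  exists [:: (m + u)%MM, (m + v)%MM & s0] => s' us' sub.
  have one x : x \in s' ->
      \sum_(y <- s' | deg y == a) ((x == y)%:R : K) = (deg x == a)%:R.
    move=> xs; rewrite big_mkcond (bigD1_seq x) //= eqxx.
    rewrite big1 ?addr0; first by case: (_ == _).
    by move=> y /negPf yx; rewrite [x == y]eq_sym yx; case: (_ == _).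
  rewrite (eq_bigr (fun y => c * (((m + u)%MM == y)%:R - ((m + v)%MM == y)%:R) + q@_y)).
    rewrite big_split /= IH //; last first.
      by move=> x xs; apply: sub; rewrite !inE xs !orbT.
    rewrite addr0 -mulr_sumr sumrB !one; try by apply: sub; rewrite !inE eqxx ?orbT.
    have -> : deg (m + u)%MM = deg (m + v)%MM by rewrite !(addmC m); apply: degD.
    by rewrite subrr mulr0.
  by move=> y _; rewrite mulrBr -!mpolyXD mcoeffD mcoeffZ mcoeffB !mcoeffX.
have := h0 (s ++ [seq x <- undup s0 | x \notin s]); rewrite cat_uniq us.
rewrite filter_uniq ?undup_uniq // andbT; have -> : ~~ has (mem s) [seq x <- undup s0 | x \notin s].
  by apply/hasPn => x; rewrite mem_filter => /andP[].
move=> /(_ isT) h.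
have {}h := h _; rewrite -[RHS]h; last first.
  move=> x xs; rewrite mem_cat mem_filter mem_undup xs andbT.
  by case: (x \in s).
rewrite big_cat /= [X in _ = _ + X]big1_seq ?addr0; last first.
  move=> x /andP[/eqP xa]; rewrite mem_filter => /andP[xs _].
  by apply/eqP; apply: contraNT xs => px; apply: ps.
rewrite [RHS]big_seq_cond [LHS]big_seq. apply: eq_bigl => x.
by apply/esym/andb_idr => /sa ->.
Qed.

Lemma toric_binom u v : toric (binom u v) -> deg u = deg v.
Proof.
move=> tp; apply/eqP; apply: contraT => duv.
have uv : (v == u) = false by apply: contraNF duv => /eqP ->.
have := @toric_fiber _ (deg u) [:: u] tp isT.
rewrite big_seq1 mcoeff_binom eqxx uv subr0 => h; case/negP: (oner_neq0 K); apply/eqP/h.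
  by move=> m; rewrite inE => /eqP ->.
move=> m; rewrite mcoeff_binom inE [m == u]eq_sym; case: (u == m) => //=.
rewrite mulr0n sub0r oppr_eq0; case: (eqVneq v m) => [<- _ e|_]; last by rewrite eqxx.
by rewrite e eqxx in duv.
Qed.

Section Order.
Variable le : rel 'X_{1..n}.
Hypothesis le_order : monomial_order le.

Let le_total u v : le u v || le v u. Proof. by case: le_order => h _ _ _ _; apply: h. Qed.
Let le_anti u v : le u v -> le v u -> u = v.
Proof. by case: le_order => _ h _ _ _ a b; apply: h; rewrite a. Qed.
Let le_trans u v w : le u v -> le v w -> le u w.
Proof. by case: le_order => _ _ h _ _; apply: h. Qed.
Let le_add u v w : le u v -> le (u + w)%MM (v + w)%MM.
Proof. by case: le_order => _ _ _ _ h; apply: h. Qed.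
Let le0 u : le 0%MM u. Proof. by case: le_order. Qed.
Let lexx u : le u u. Proof. by have := le_total u u; rewrite orbb. Qed.

(** The normal form of [u]. The minimum is taken over the monomials of total
    degree at most that of [u], among which is the whole fibre. *)
Definition nf u : 'X_{1..n} :=
  extremum le (BMultinom (ltnSn (mdeg u))) (fun i => deg (bmnm i) == deg u)
    (fun i => bmnm i).

Lemma nfP u : deg (nf u) = deg u /\ forall v, deg v = deg u -> le (nf u) v.
Proof.
rewrite /nf; case: extremumP => //=.
- by move=> v u' w; apply: le_trans.
move=> i /eqP iu mn; split=> // v vu.
have vd : (mdeg v < (mdeg u).+1)%N by rewrite (deg_mdeg vu).
by apply: (mn (BMultinom vd)); rewrite vu.
Qed.

Lemma nf_eq u v : deg u = deg v -> nf u = nf v.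
Proof.
move=> uv; have [du mu] := nfP u; have [dv mv] := nfP v.
by apply: le_anti; [apply: mu|apply: mv]; rewrite ?dv ?du.
Qed.

Lemma nf_min u : (forall v, deg v = deg u -> le u v) -> nf u = u.
Proof. by move=> mn; have [du mu] := nfP u; apply: le_anti; [apply: mu|apply: mn]. Qed.

Definition nonmin u := nf u != u.

Lemma nf_nonmin u : ~~ nonmin (nf u).
Proof. by rewrite negbK; apply/eqP; apply: nf_eq; case: (nfP u). Qed.

(** Adding the same monomial to [t] and to the smallest monomial of its fibre
    keeps their order. *)
Lemma nonmin_up t u : nonmin t -> (t <= u)%MM -> nonmin u.
Proof.
move=> nt tu; rewrite -(submK tu) addmC; set w := (u - t)%MM.
apply: contra nt => /eqP mn; have [dt mt] := nfP t.
have [_ mw] := nfP (t + w)%MM; rewrite mn in mw.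
have h1 := mw _ (degD w dt); have h2 := le_add w (mt t erefl).
by apply/eqP; apply: (@addIm _ w); apply: le_anti.
Qed.

Lemma le_of_dvd t u : (t <= u)%MM -> le t u.
Proof. by move=> tu; rewrite -(submK tu) -{1}[t]add0m; apply: le_add. Qed.

(** A leading monomial that is the smallest of its fibre would be the only one
    of this fibre in [p], and have coefficient zero by [toric_fiber]. *)
Lemma lead_nonmin p u : toric p -> is_lead le p u -> nonmin u.
Proof.
move=> tp [us mx]; apply/negP => /eqP mn; have [_ mu] := nfP u; rewrite mn in mu.
have := @toric_fiber _ (deg u) [:: u] tp isT; rewrite big_seq1 => h.
move: us; rewrite mcoeff_msupp h ?eqxx //.
  by move=> m; rewrite inE => /eqP ->.
move=> m pm mu'; rewrite inE; apply/eqP; apply: le_anti; last exact: mu.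
by apply: mx; rewrite mcoeff_msupp.
Qed.

Lemma binom_lead u : nonmin u -> is_lead le (binom u (nf u)) u.
Proof.
move=> nu; split.
  by rewrite mcoeff_msupp mcoeff_binom eqxx (negPf nu) subr0 oner_neq0.
move=> v; rewrite mcoeff_msupp mcoeff_binom; case: (eqVneq u v) => [->//|_].
case: (eqVneq (nf u) v) => [<- _|_]; first by have [_ h] := nfP u; apply: h.
by rewrite subr0 eqxx.
Qed.

Lemma lead_uniq p u v : is_lead le p u -> is_lead le p v -> u = v.
Proof. by move=> [us um] [vs vm]; apply: le_anti; [apply: vm|apply: um]. Qed.

Definition minimal_nonmin u := nonmin u &&
  [forall w : 'X_{1..n < (mdeg u).+1}, (nonmin w && (w <= u)%MM) ==> (bmnm w == u)].

Lemma mdeg_dvd t u : (t <= u)%MM -> (mdeg t <= mdeg u)%N.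
Proof. by move=> tu; rewrite -(submK tu) mdegD leq_addl. Qed.

Lemma dvd_mdeg_eq t u : (t <= u)%MM -> (mdeg u <= mdeg t)%N -> t = u.
Proof.
move=> tu h; have : mdeg (u - t)%MM == 0%N.
  by move: h; rewrite -{1}(submK tu) mdegD; clear; lia.
by rewrite mdeg_eq0 => /eqP e; move: (submK tu); rewrite e add0m.
Qed.

Lemma minimal_nonminP u :
  minimal_nonmin u <-> nonmin u /\ (forall w, nonmin w -> (w <= u)%MM -> w = u).
Proof.
split=> [/andP[nu /forallP h]|[nu h]].
  split=> // w nw wu; have wd : (mdeg w < (mdeg u).+1)%N by apply: mdeg_dvd.
  by apply/eqP; have := h (BMultinom wd); rewrite nw wu.
by rewrite /minimal_nonmin nu; apply/forallP => w; apply/implyP => /andP[nw wu]; apply/eqP/h.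
Qed.

Lemma minimal_below u : nonmin u -> exists2 t, minimal_nonmin t & (t <= u)%MM.
Proof.
elim: {u}_.+1 {-2}u (ltnSn (mdeg u)) => // k IH u uk nu.
have [mu|] := boolP (minimal_nonmin u); first by exists u => //; apply: lepm_refl.
rewrite /minimal_nonmin nu /= negb_forall => /existsP [w].
rewrite negb_imply => /andP[/andP[nw wu] neq].
have [|t mt tw] := IH w _ nw; last by exists t => //; apply: lepm_trans wu.
rewrite -ltnS (leq_trans _ uk) // !ltnS ltnNge; apply: contra neq => h.
by apply/eqP; apply: dvd_mdeg_eq.
Qed.

Lemma initial_mem S w : initial_ideal le S ('X_[w] : {mpoly K[n]}) ->
  exists p u, [/\ S p, is_lead le p u & (u <= w)%MM].
Proof.
move=> /ideal_generatedE /monomial_ideal_mem [].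
  by move=> q [p [u [_ _ ->]]]; exists u.
move=> u [p [u' [Sp lp e]]] uw; exists p, u'; split=> //.
have : u' \in msupp ('X_[u] : {mpoly K[n]}) by rewrite e msuppX inE.
by rewrite msuppX inE => /eqP ->.
Qed.

Lemma mem_initial S p u w : S p -> is_lead le p u -> (u <= w)%MM ->
  initial_ideal le S ('X_[w] : {mpoly K[n]}).
Proof.
move=> Sp lp uw; apply/ideal_generatedE.
rewrite -(submK uw) mpolyXD; apply: monomial_span_mul.
by exists p, u.
Qed.

Lemma groebner_criterion B : (forall p, p \in B -> toric p) ->
  (forall p u, toric p -> is_lead le p u ->
     exists q t, [/\ q \in B, is_lead le q t & (t <= u)%MM]) ->
  groebner_basis le toric B.
Proof.
move=> BI lB; split=> // q; rewrite /initial_ideal !ideal_generatedE.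
split; apply: monomial_span_sub => g [p [u [Sp lp ->]]].
  apply/ideal_generatedE/(mem_initial (S := toric) (BI p Sp) lp); exact: lepm_refl.
have [q' [t [qB lq tu]]] := lB p u Sp lp.
exact/ideal_generatedE/(mem_initial (S := fun p => p \in B) qB lq tu).
Qed.

(** The reduced basis consists of the binomials that lead from a minimal
    non-minimal monomial of a fibre to the smallest monomial of this fibre; by
    [dickson] there are finitely many of them. *)
Lemma reduced_basis_exists : exists B, reduced_groebner_basis le toric B /\
  forall u, minimal_nonmin u -> binom u (nf u) \in B.
Proof.
have [s0 ds] := dickson (fun u => minimal_nonmin u).
pose s := [seq u <- s0 | minimal_nonmin u].
have sP u : (u \in s) = minimal_nonmin u.
  rewrite mem_filter; apply: andb_idr => mu.
  have [w mw [ws wu]] := ds u mu; have [nw _] := iffLR (minimal_nonminP w) mw.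
  by have [_ h] := iffLR (minimal_nonminP u) mu; rewrite -(h w nw wu).
pose B := [seq binom u (nf u) | u <- s].
have BP p : p \in B -> exists2 u, minimal_nonmin u & p = binom u (nf u).
  by case/mapP=> u; rewrite sP => mu ->; exists u.
have inB u : minimal_nonmin u -> binom u (nf u) \in B.
  by move=> mu; apply/mapP; exists u; rewrite ?sP.
have nm u : minimal_nonmin u -> nonmin u by case/andP.
exists B; split=> //; split.
- apply: groebner_criterion => [p /BP [u _ ->]|p u tp lp].
    by apply: toric_mem; case: (nfP u).
  have [t mt tu] := minimal_below (lead_nonmin tp lp).
  exists (binom t (nf t)), t; split=> //; first exact: inB.
  by apply: binom_lead; apply: nm.
- move=> p /BP [u mu ->]; exists u; split; first exact: binom_lead (nm u mu).
  by rewrite mcoeff_binom eqxx (negPf (nm u mu)) subr0.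
move=> p v /BP [u mu ->]; rewrite mcoeff_msupp mcoeff_binom => vs.
move=> /initial_mem [q [t [[/BP [t' mt' ->] neq] lq tv]]].
have tE : t = t' by apply: lead_uniq lq (binom_lead (nm _ mt')).
move: vs; case: (eqVneq u v) => [uv _|_].
  have [_ h] := iffLR (minimal_nonminP u) mu.
  by apply: neq; rewrite -(h t') ?(nm _ mt') // -tE uv.
case: (eqVneq (nf u) v) => [nv _|_]; last by rewrite subrr eqxx.
have := nonmin_up (nm _ mt') (_ : (t' <= v)%MM); rewrite -tE tv -nv => /(_ isT).
by rewrite (negPf (nf_nonmin u)).
Qed.

End Order.
End Toric.

(** * Generalized robustness in terms of quadrics *)

Section Robust.
Local Open Scope ring_scope.
Variables (K : fieldType) (n : nat) (D : eqType) (deg : 'X_{1..n} -> D).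
Hypothesis deg_mdeg : forall u v, deg u = deg v -> mdeg u = mdeg v.
Hypothesis degD : forall u v w, deg u = deg v -> deg (u + w)%MM = deg (v + w)%MM.
Hypothesis degI : forall u v w, deg (u + w)%MM = deg (v + w)%MM -> deg u = deg v.
Hypothesis deg_lin : forall u v, mdeg u = 1%N -> deg u = deg v -> u = v.
Implicit Types (p q g : {mpoly K[n]}) (u v w t : 'X_{1..n}).

Let I : {mpoly K[n]} -> Prop := toric deg.
Let bin u v : {mpoly K[n]} := binom K u v.

Lemma low_degree_eq u v : deg u = deg v -> (mdeg u < 2)%N -> u = v.
Proof.
move=> uv; have := deg_mdeg uv; case e: (mdeg u) => [|[|//]] uv' _.
  move/eqP: e; move/esym/eqP: uv'; rewrite !mdeg_eq0 => /eqP -> /eqP ->.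
  by [].
exact: deg_lin.
Qed.

(** In degree two only constant multiples of quadric binomials survive:
    binomials of lower degree vanish, and multiples of those of higher degree
    have no component of degree two. *)
Lemma pihomog_span (S T : {mpoly K[n]} -> Prop) p :
  (forall g, S g -> exists u v, [/\ g = bin u v, deg u = deg v & mdeg u = 2%N -> T g]) ->
  monomial_span S p -> monomial_span T (pihomog mdeg 2 p).
Proof.
move=> ST; elim=> [|a m g q Sg _ IH]; first by rewrite pihomog0; apply: monomial_span0.
rewrite pihomogD; apply: monomial_span_add IH.
have [u [v [gE uv Tg]]] := ST g Sg.
rewrite linearZ /= gE /bin /binom mulrBr -!mpolyXD pihomogB !pihomogX /= !mdegD.
rewrite -(deg_mdeg uv); case: eqP => [mu|_]; last first.
  by rewrite subrr scaler0; apply: monomial_span0.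
have [u2|u2] := eqVneq (mdeg u) 2%N; last first.
  rewrite (low_degree_eq uv) ?subrr ?scaler0; first exact: monomial_span0.
  by move: mu u2; clear; lia.
rewrite !mpolyXD -mulrBr -[_ *: _]addr0; apply: monomial_spanD.
  by rewrite -[_ - _]/(bin u v) -gE; apply: Tg.
exact: monomial_span0.
Qed.

(** The members of degree two already generate the ideal, by [pihomog_span]. *)
Lemma markov_quadric M p : generated_by_quadrics I -> markov_basis I M -> M p ->
  exists u v, [/\ p = bin u v, deg u = deg v, u != v & mdeg u = 2%N].
Proof.
move=> [Q [Q2 genQ]] [Mbin genM minM] Mp.
have MI q : M q -> I q by move=> Mq; apply/genM; apply: ideal_generated_mem.
have MB q : M q -> exists u v, q = bin u v /\ deg u = deg v.
  move=> Mq; have [u [v qE]] := Mbin q Mq; exists u, v; split=> //.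
  by apply: (toric_binom degD (K := K)); rewrite /binom -qE; apply: MI.
have [u [v [pE uv]]] := MB p Mp.
pose M' q := M q /\ exists u v, [/\ q = bin u v, deg u = deg v, u != v & mdeg u = 2%N].
suff /minM h : generates M' I by case: (h _ p Mp) => // q [].
move=> q; split=> [/ideal_generatedE h|].
  by apply/genM/ideal_generatedE; apply: monomial_span_mono h => g [].
move=> /genQ /ideal_generatedE h; apply/ideal_generatedE.
apply: monomial_span_sub h => g Qg; rewrite -(pihomog_dE (Q2 g Qg)).
have /genM /ideal_generatedE : I g by apply/genQ; apply: ideal_generated_mem.
have red : monomial_span M g -> monomial_span (fun q => M q /\ q <> 0) g.
  apply: monomial_span_sub => q' Mq'; have [->|q0] := eqVneq q' 0.
    exact: monomial_span0.
  by rewrite -[q']mul1r; apply: monomial_span_mul; split=> //; apply/eqP.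
move=> /red; apply: pihomog_span => q' [Mq' q0].
have [a [b [qE ab]]] := MB q' Mq'; exists a, b; split=> // a2; split=> //.
exists a, b; split=> //; apply/eqP => e; case: q0.
by rewrite qE e /bin /binom subrr.
Qed.

Lemma quadric_is_homog u v : mdeg u = 2%N -> deg u = deg v -> bin u v \is 2.-homog.
Proof.
move=> u2 uv; apply/dhomogP => m.
rewrite mcoeff_msupp /bin mcoeff_binom; case: (eqVneq u m) => [<- //|_].
case: (eqVneq v m) => [<- _|_]; first by rewrite -[LHS](deg_mdeg uv).
by rewrite subrr eqxx.
Qed.

(** The binomial led by [u] belongs to a reduced Groebner basis, hence up to
    sign to a Markov basis. *)
Lemma robust_quadric_leads le u : generalized_robust I -> generated_by_quadrics I ->
  monomial_order le -> minimal_nonmin deg le u -> mdeg u = 2%N.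
Proof.
move=> gr gq lo mu.
have [B [rB inB]] := reduced_basis_exists K deg_mdeg degD lo.
have nu : u != nf deg le u by case/andP: mu; rewrite eq_sym.
have su : u \in msupp (bin u (nf deg le u)).
  by rewrite mcoeff_msupp mcoeff_binom eqxx [nf _ _ _ == _]eq_sym (negPf nu) subr0 oner_neq0.
have : up_to_sign (universal_groebner_basis I) (bin u (nf deg le u)).
  by left; exists le, B; split=> //; apply: inB.
move/gr => [[M [mM Mp]]|[M [mM Mp]]];
have [a [b [pE ab _ a2]]] := markov_quadric gq mM Mp;
have /dhomogP := quadric_is_homog a2 ab; rewrite -pE; apply=> //.
by rewrite (perm_mem (msuppN _)).
Qed.

(** In an order where the variables outside [S] weigh more than those in [S], a
    monomial in [S] can only be reduced to monomials in [S]. *)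
Lemma robust_quadric_in_support (S : pred 'I_n) u v :
  generalized_robust I -> generated_by_quadrics I ->
  u != v -> deg u = deg v ->
  (forall i, u i != 0%N -> S i) -> (forall i, v i != 0%N -> S i) ->
  exists t t', [/\ deg t = deg t', t != t', mdeg t = 2%N &
    (forall i, t i != 0%N -> S i) /\ (forall i, t' i != 0%N -> S i)].
Proof.
move=> gr gq uv duv uS vS.
pose w i := (~~ S i : nat); pose le := weight_le w.
have lo : monomial_order le := weight_le_order w.
have wS x : weight w x = 0%N <-> (forall i, x i != 0%N -> S i).
  split=> [/eqP|h].
    rewrite /weight sum_nat_eq0 => /forallP h i xi; have := h i.
    by rewrite /w muln_eq0 (negPf xi) orbF; case: (S i).
  rewrite /weight big1 // => i _; have [->|xi] := eqVneq (x i) 0%N; first by rewrite muln0.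
  by rewrite /w h.
wlog nu : u v uv duv uS vS / nonmin deg le u.
  move=> W; have [nu|] := boolP (nonmin deg le u); first exact: (W u v).
  rewrite negbK => /eqP nfu; apply: (W v u) => //; first by rewrite eq_sym.
  by rewrite /nonmin -(nf_eq deg_mdeg lo duv) nfu.
have [t mt tu] := minimal_below nu.
have [dt lt] := nfP deg_mdeg lo t.
have tS : weight w t = 0%N.
  apply/wS => i ti; apply: uS; apply: contraNneq ti => ui.
  by have /mnm_lepP/(_ i) := tu; rewrite ui leqn0.
exists t, (nf deg le t); split.
- by rewrite dt.
- by case/andP: mt; rewrite eq_sym.
- exact: robust_quadric_leads gr gq lo mt.
split; apply/wS => //.
have := lt t erefl; rewrite /le /weight_le tS ltn0 /=.
by case/andP=> /eqP.
Qed.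

(** * Relations that contain quadrics conformally *)

Section Conformal.
(** Each relation contains a quadric one conformally, that is, without
    cancellation between the two monomials. *)
Hypothesis conformal : forall u v, deg u = deg v -> u != v ->
  exists a b, [/\ (a <= u)%MM, (b <= v)%MM, deg a = deg b, a != b & mdeg a = 2%N].

Definition quadric_binomial (p : {mpoly K[n]}) :=
  exists u v, [/\ p = bin u v, deg u = deg v, u != v & mdeg u = 2%N].

(** Take the quadric relation of [a] below [u] and [b] below [v]. Replacing [a]
    by [b] in [u] makes [b] a common factor, so the degree drops. *)
Lemma toric_quadric_span p : I p -> monomial_span quadric_binomial p.
Proof.
move=> /ideal_generatedE; apply: monomial_span_sub => {p}_ [u [v [uv ->]]].
elim: {u}_.+1 {-2}u v (ltnSn (mdeg u)) uv => // k IH u v uk uv.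
have [->|neq] := eqVneq u v; first by rewrite subrr; apply: monomial_span0.
have [a [b [au bv ab nab a2]]] := conformal uv neq.
have -> : 'X_[u] - 'X_[v] = (1 *: ('X_[(u - a)%MM] * bin a b) +
   1 *: ('X_[b] * ('X_[(u - a)%MM] - 'X_[(v - b)%MM])) : {mpoly K[n]}).
  rewrite !scale1r /bin /binom !mulrBr -!mpolyXD submK //.
  by rewrite [(b + (v - b))%MM]addmC submK // [(b + _)%MM]addmC addrA subrK.
apply: monomial_spanD; first by exists a, b.
apply: monomial_span_scale; apply: IH.
  have := uk; rewrite -{1}(submK au) mdegD a2; clear; lia.
apply: (@degI _ _ b); rewrite submK // -uv -[in RHS](submK au).
by rewrite 2!(addmC (u - a)%MM); apply: degD.
Qed.

Lemma conformal_generated : generated_by_quadrics I.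
Proof.
exists quadric_binomial; split.
  by move=> q [u [v [-> uv _ u2]]]; apply: quadric_is_homog.
move=> p; split=> [/ideal_generatedE h|h]; last first.
  by apply/ideal_generatedE/toric_quadric_span.
apply/ideal_generatedE; apply: monomial_span_mono h => g [u [v [-> uv _ _]]].
by exists u, v.
Qed.

(** Take the quadric relation of [a] below [u] and [b] below its normal form.
    If [a] were the smallest monomial of its fibre, replacing [b] by [a] would
    not increase the normal form, which is impossible as [a] differs from [b].
    *)
Lemma minimal_quadric le u : monomial_order le -> minimal_nonmin deg le u ->
  mdeg u = 2%N.
Proof.
move=> lo mu; have [nu mn] := iffLR (minimal_nonminP _ _ _) mu.
have [dn ln] := nfP deg_mdeg lo u; have neq : u != nf deg le u by rewrite eq_sym.
have [a [b [au bv ab nab a2]]] := conformal (esym dn) neq.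
suff na : nonmin deg le a by rewrite -(mn a na au).
have [_ asym _ _ add] := lo.
apply/negP => /eqP nfa; have [_ la] := nfP deg_mdeg lo a; rewrite nfa in la.
have := add _ _ (nf deg le u - b)%MM (la b (esym ab)); rewrite [(b + _)%MM]addmC submK //.
move=> h1; have h2 : le (nf deg le u) (a + (nf deg le u - b))%MM.
  apply: ln; rewrite -dn -{2}(submK bv) [(_ - b + b)%MM]addmC; exact: degD.
have e : nf deg le u = (a + (nf deg le u - b))%MM by apply: asym; rewrite h1 h2.
case/negP: nab; apply/eqP; apply: (@addIm _ (nf deg le u - b)%MM).
by rewrite -e [(b + _)%MM]addmC submK.
Qed.

(** Apart from its leading monomial [u] a member has only monomials that are
    the smallest of their fibres; as the coefficients add up to zero on each
    fibre, it is the binomial of [u] and its normal form. *)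
Lemma reduced_basis_quadric le B p : monomial_order le ->
  reduced_groebner_basis le I B -> p \in B -> quadric_binomial p.
Proof.
move=> lo [[BI gB] monic red] pB.
have [u [lu cu]] := monic p pB.
have nu := lead_nonmin deg_mdeg degD lo (BI p pB) lu.
have inI t : nonmin deg le t -> exists q w, [/\ q \in B, is_lead le q w & (w <= t)%MM].
  move=> nt; apply: (@initial_mem _ _ le (fun q => q \in B)); apply/gB.
  apply: (mem_initial (p := bin t (nf deg le t)) (u := t)); last exact: lepm_refl.
    by apply: toric_mem; case: (nfP deg_mdeg lo t).
  exact: binom_lead.
have mu : minimal_nonmin deg le u.
  apply/(minimal_nonminP _ _ _); split=> // t nt tu.
  have [q [w [qB lq wt]]] := inI t nt.
  have [qp|qp] := eqVneq q p.
    rewrite qp in lq; have wu := lead_uniq lo lq lu; rewrite wu in wt.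
    by apply: dvd_mdeg_eq tu (mdeg_dvd wt).
  case: (red p u pB); first by case: lu.
  apply: (mem_initial (p := q) (u := w)) => //; first by split=> //; apply/eqP.
  exact: lepm_trans wt tu.
have others v : v \in msupp p -> v != u -> nf deg le v = v.
  move=> vp vu; apply/eqP/negPn/negP => nv.
  have [q [w [qB lq wv]]] := inI v nv.
  have [qp|qp] := eqVneq q p.
    rewrite qp in lq; have wu := lead_uniq lo lq lu; rewrite wu in wv.
    have [_ asym _ _ _] := lo; case: lu => _ mx.
    by case/negP: vu; apply/eqP; apply: asym; rewrite mx //= (le_of_dvd lo wv).
  case: (red p v pB vp).
  by apply: (mem_initial (p := q) (u := w)) => //; split=> //; apply/eqP.
have sup v : v \in msupp p -> v = u \/ v = nf deg le u.
  move=> vp; have [->|vu] := eqVneq v u; first by left.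
  right; have nv := others v vp vu.
  have [e|dvu] := eqVneq (deg v) (deg u); first by rewrite -nv; apply: nf_eq.
  have := @toric_fiber _ _ _ _ degD p (deg v) [:: v] (BI p pB) isT.
  rewrite big_seq1 => h; move: vp; rewrite mcoeff_msupp h ?eqxx //.
    by move=> m; rewrite inE => /eqP ->.
  move=> m pm dm; rewrite inE; have mp : m \in msupp p by rewrite mcoeff_msupp.
  have [mu'|mu'] := eqVneq m u; first by rewrite -mu' dm eqxx in dvu.
  by rewrite -nv -(others m mp mu'); apply/eqP; apply: nf_eq.
have [dn ln] := nfP deg_mdeg lo u.
have neq : nf deg le u != u by [].
have sum0 : p@_u + p@_(nf deg le u) = 0.
  have := @toric_fiber _ _ _ _ degD p (deg u) [:: u; nf deg le u] (BI p pB).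
  rewrite big_cons big_seq1; apply.
  - by rewrite /= inE eq_sym neq.
  - by move=> m; rewrite !inE => /orP[/eqP ->|/eqP ->].
  by move=> m pm _; rewrite !inE; case: (sup m); rewrite ?mcoeff_msupp // => ->; rewrite eqxx ?orbT.
exists u, (nf deg le u); split=> //; last exact: minimal_quadric lo mu.
- apply/mpolyP => m; rewrite mcoeff_binom.
  have [<-|um] := eqVneq u m; first by rewrite cu (negPf neq) subr0.
  have [<-|nm] := eqVneq (nf deg le u) m.
    by rewrite sub0r; apply/eqP; rewrite -addr_eq0 addrC -cu sum0.
  rewrite subrr; apply/eqP; rewrite mcoeff_eq0; apply/negP => /sup [e|e].
    by rewrite e eqxx in um.
  by rewrite e eqxx in nm.
by rewrite eq_sym.
Qed.

(** Cancelling a common variable would leave a relation in degree one. *)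
Lemma quadric_disjoint u v i : deg u = deg v -> mdeg u = 2%N -> u != v ->
  u i != 0%N -> v i = 0%N.
Proof.
move=> uv u2 neq ui; apply/eqP; apply: contraNT neq => vi.
rewrite -!lep1mP in ui vi; rewrite -(submK ui) -(submK vi); apply/eqP; congr (_ + _)%MM.
apply: deg_lin.
  by have := u2; rewrite -{1}(submK ui) mdegD mdeg1; clear; lia.
by apply: (@degI _ _ U_(i)%MM); rewrite !submK.
Qed.

(** Let the variables outside [v] have weight one. By [quadric_disjoint] the
    other monomials of the fibre consist of such variables. *)
Lemma order_with_min v : mdeg v = 2%N ->
  exists le, monomial_order le /\ forall u, deg u = deg v -> nf deg le u = v.
Proof.
move=> v2; pose w i := ((v i == 0%N) : nat).
have lo := weight_le_order w; exists (weight_le w); split=> // u uv.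
rewrite (nf_eq deg_mdeg lo uv); apply: nf_min => // t tv.
have [->|neq] := eqVneq t v.
  by rewrite /weight_le eqxx Order.POrderTheory.le_refl orbT.
have t2 : mdeg t = 2%N by rewrite (deg_mdeg tv).
have wv : weight w v = 0%N.
  by rewrite /weight big1 // => i _; rewrite /w; case: eqP => [->|]; rewrite ?muln0.
have wt : weight w t = 2%N.
  rewrite -t2 mdegE /weight; apply: eq_bigr => i _; rewrite /w.
  have [->|ti] := eqVneq (t i) 0%N; first by rewrite muln0.
  by rewrite (quadric_disjoint tv t2 neq ti) eqxx mul1n.
by rewrite /weight_le wv wt.
Qed.

(** Monomials of degree at most one are alone in their fibres. *)
Lemma quadric_minimal_nonmin le u v : monomial_order le -> deg u = deg v -> u != v ->
  mdeg u = 2%N -> nf deg le u = v -> minimal_nonmin deg le u.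
Proof.
move=> lo uv neq u2 nfu; apply/(minimal_nonminP _ _ _).
split=> [|w nw wu]; first by rewrite /nonmin nfu eq_sym.
apply: dvd_mdeg_eq wu _; rewrite u2 leqNgt; apply: contraL nw => w2.
have [dw _] := nfP deg_mdeg lo w; rewrite /nonmin negbK eq_sym; apply/eqP.
by apply: low_degree_eq w2.
Qed.

Lemma quadric_universal_groebner p :
  quadric_binomial p -> universal_groebner_basis I p.
Proof.
move=> [u [v [-> uv neq u2]]].
have v2 : mdeg v = 2%N by rewrite -(deg_mdeg uv).
have [le [lo nfv]] := order_with_min v2.
have [B [rB inB]] := reduced_basis_exists K deg_mdeg degD lo.
exists le, B; split=> //; rewrite -(nfv u uv) /bin; apply: inB.
exact: quadric_minimal_nonmin lo uv neq u2 (nfv u uv).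
Qed.

(** A Markov basis through a given quadric joins the monomials of each fibre to
    a chosen one, as the reduced basis of a suitable order does. *)
Lemma quadric_universal_markov p :
  quadric_binomial p -> universal_markov_basis I p.
Proof.
move=> [u [v [-> uv neq u2]]].
have v2 : mdeg v = 2%N by rewrite -(deg_mdeg uv).
have [le [lo nfv]] := order_with_min v2.
pose nfl := nf deg le.
pose M q := exists t, [/\ mdeg t = 2%N, nfl t != t & q = bin t (nfl t)].
exists M; split; last by exists u; rewrite /nfl (nfv u uv) eq_sym.
have dn t : deg (nfl t) = deg t by case: (nfP deg_mdeg lo t).
split=> [q [t [_ _ ->]]|q|M' MM' gM' q [t [t2 nt ->]]]; first by exists t, (nfl t).
  split=> [/ideal_generatedE h|Iq].
    apply/ideal_generatedE; apply: monomial_span_mono h => g [t [_ _ ->]].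
    by exists t, (nfl t).
  apply/ideal_generatedE; apply: monomial_span_sub (toric_quadric_span Iq).
  move=> g [a [b [-> ab _ a2]]].
  have half t : mdeg t = 2%N -> monomial_span M (bin t (nfl t)).
    move=> t2; have [e|nt] := eqVneq (nfl t) t.
      by rewrite e /bin /binom subrr; apply: monomial_span0.
    by rewrite -[bin _ _]mul1r; apply: monomial_span_mul; exists t.
  have -> : bin a b = bin a (nfl a) + (-1) *: ('X_[0%MM] * bin b (nfl b)).
    rewrite mpolyX0 mul1r scaleN1r /bin /binom /nfl (nf_eq deg_mdeg lo ab).
    by rewrite opprB addrA subrK.
  apply: monomial_span_add; first exact: half.
  by apply: monomial_span_scale; apply: half; rewrite -(deg_mdeg ab).
have : I (bin t (nfl t)) by apply: toric_mem; rewrite dn.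
move=> /gM' /ideal_generatedE sp.
have : (bin t (nfl t))@_t != 0 by rewrite mcoeff_binom eqxx (negPf nt) subr0 oner_neq0.
have key r : monomial_span M' r -> r@_t != 0 -> M' (bin t (nfl t)).
  elim=> [|c m g r' M'g _ IH]; first by rewrite mcoeff0 eqxx.
  have [s [s2 ns gE]] := MM' g M'g.
  rewrite mcoeffD; have [->|r0 _] := eqVneq (r'@_t) 0; last exact: IH.
  rewrite addr0 gE mcoeffZ /bin /binom mulrBr -!mpolyXD mcoeffB !mcoeffX.
  have m0 x : mdeg x = 2%N -> (m + x)%MM = t -> x = t.
    move=> x2 e; have : mdeg m == 0%N.
      by have := mdegD m x; rewrite e t2 x2; clear; lia.
    by rewrite mdeg_eq0 => /eqP m0; rewrite m0 add0m in e.
  have [/(m0 s s2) e _|_] := eqVneq (m + s)%MM t.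
    by rewrite -e /bin /binom -[_ - _]gE.
  have ns2 : mdeg (nfl s) = 2%N by rewrite (deg_mdeg (dn s)).
  have [/(m0 _ ns2) e|_] := eqVneq (m + nfl s)%MM t.
    by case/negP: nt; rewrite -e; apply/eqP; apply: nf_eq.
  by rewrite subrr mulr0 eqxx.
exact: key sp.
Qed.

Lemma conformal_robust : generalized_robust I.
Proof.
move=> p; split.
  case=> -[le [B [lo rB pB]]]; [left|right];
  exact/quadric_universal_markov/(reduced_basis_quadric lo rB).
case=> -[M [mM Mp]]; [left|right]; apply: quadric_universal_groebner;
exact: markov_quadric conformal_generated mM Mp.
Qed.

End Conformal.
End Robust.

(** * Relations between the edges of a graph *)

Section EdgeMonomials.
Variables (V : finType) (G : graph V).
Local Notation m := #|edges G|.
Implicit Types (u v w t : 'X_{1..m}) (i j k : 'I_m) (x y z : V).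

Let ev k : {set V} := enum_val k.

Lemma ev_edge k : ev k \in edges G.
Proof. exact: enum_valP. Qed.

Lemma ev_inj : injective ev.
Proof. exact: enum_val_inj. Qed.

Lemma edge_ev e : e \in edges G -> exists k, ev k = e.
Proof. by move=> eG; exists (enum_rank_in eG e); rewrite /ev enum_rankK_in. Qed.

Lemma degAE u x : degA u x = \sum_(k < m) u k * (x \in ev k).
Proof. by rewrite ffunE. Qed.

Lemma degAD_E u v x : degA (u + v)%MM x = degA u x + degA v x.
Proof.
rewrite !degAE -big_split /=; apply: eq_bigr => k _.
by rewrite mnmDE mulnDl.
Qed.

Lemma degAU k x : degA U_(k)%MM x = (x \in ev k).
Proof.
rewrite degAE (bigD1 k) //= mnm1E eqxx mul1n big1 ?addn0 // => j jk.
by rewrite mnm1E eq_sym (negPf jk).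
Qed.

Lemma degA_add u v w : degA u = degA v -> degA (u + w)%MM = degA (v + w)%MM.
Proof. by move=> uv; apply/ffunP => x; rewrite !degAD_E uv. Qed.

Lemma degA_cancel u v w : degA (u + w)%MM = degA (v + w)%MM -> degA u = degA v.
Proof.
move=> /ffunP uv; apply/ffunP => x; have := uv x.
by rewrite !degAD_E => /eqP; rewrite eqn_add2r => /eqP.
Qed.

Lemma degA_sum u : \sum_x degA u x = 2 * mdeg u.
Proof.
under eq_bigr => x _ do rewrite degAE.
rewrite exchange_big mdegE big_distrr /=; apply: eq_bigr => k _.
rewrite -big_distrr /= mulnC; congr (_ * _).
have [_ <-] := edgeP (ev_edge k); rewrite -sum1_card [RHS]big_mkcond /=.
by apply: eq_bigr => x _; case: (x \in _).
Qed.

Lemma degA_mdeg u v : degA u = degA v -> mdeg u = mdeg v.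
Proof.
by move=> uv; have := degA_sum u; rewrite uv degA_sum; clear; lia.
Qed.

Lemma degA_linear u v : mdeg u = 1 -> degA u = degA v -> u = v.
Proof.
move=> u1 uv; have v1 : mdeg v = 1 by rewrite -(degA_mdeg uv).
have /mdeg1P [i /eqP ui] : mdeg u == 1 by rewrite u1.
have /mdeg1P [j /eqP vj] : mdeg v == 1 by rewrite v1.
rewrite ui vj; congr U_(_)%MM; apply: ev_inj; apply/setP => x.
by move/ffunP/(_ x): uv; rewrite ui vj !degAU; case: (x \in _); case: (x \in _).
Qed.

(** ** The relation of a closed walk of even length *)

Definition edge_monomial (L : seq {set V}) : 'X_{1..m} :=
  [multinom count_mem (ev k) L | k < m].

Lemma degA_edge_monomial L x : {subset L <= edges G} ->
  degA (edge_monomial L) x = count (fun e : {set V} => x \in e) L.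
Proof.
elim: L => [|e L IH] LG.
  by rewrite degAE big1 // => k _; rewrite mnmE.
have [k ke] := edge_ev (LG e (mem_head _ _)).
have -> : edge_monomial (e :: L) = (U_(k) + edge_monomial L)%MM.
  apply/mnmP => j; rewrite mnmDE !mnmE /= -ke; congr (_ + _).
  by rewrite (inj_eq ev_inj).
rewrite degAD_E degAU IH ?ke //= => f fL.
by apply: LG; rewrite inE fL orbT.
Qed.

Fixpoint every_other (T : Type) (b : bool) (s : seq T) : seq T :=
  if s is e :: s' then
    if b then e :: every_other (~~ b) s' else every_other (~~ b) s'
  else [::].

Lemma count_every_other (T : Type) (P : pred T) s :
  count P (every_other true s) + count P (every_other false s) = count P s.
Proof.
by elim: s => //= e s <-; rewrite -addnA; congr (_ + _); rewrite addnC.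
Qed.

Lemma every_other_sub (T : eqType) b (s : seq T) : {subset every_other b s <= s}.
Proof.
elim: s b => //= e s IH [] f; rewrite ?inE.
  by case/orP=> [->//|/IH ->]; rewrite orbT.
by move/IH ->; rewrite orbT.
Qed.

(** Consecutive edges of a walk meet, so that their contributions to the degree
    cancel except at the ends. *)
Lemma degree_every_other x p z : path (adj G) x p ->
  let E := walk_edges x p in let inz := fun e : {set V} => z \in e in
  count inz (every_other true E) + (~~ odd (size p) && (last x p == z)) =
  count inz (every_other false E) + (x == z) + (odd (size p) && (last x p == z)).
Proof.
elim: p x => [|y p IH] x /=; first by move=> _; rewrite addn0.
case/andP=> xy /IH /=; rewrite !inE negbK !(eq_sym z).
move: (nat_of_bool (~~ odd _ && _)) (nat_of_bool (odd _ && _)) => A B.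
move: (count _ (every_other true _)) (count _ (every_other false _)) => T F.
have nxy := adj_neq xy.
case: (eqVneq x z) => [xz|_]; case: (eqVneq y z) => [yz|_] /=.
- by rewrite xz yz eqxx in nxy.
- by clear; lia.
- by clear; lia.
by clear; lia.
Qed.

Lemma walk_edges_edges x p : path (adj G) x p -> {subset walk_edges x p <= edges G}.
Proof.
by move=> xp f /(walk_edges_rel xp) [a [b [ab _ _ ->]]].
Qed.

(** The two monomials are made of the edges at even and at odd positions; the
    edge [e] distinguishes them. *)
Lemma closed_walk_relation x p e : path (adj G) x p -> last x p = x ->
  ~~ odd (size p) -> odd (count_mem e (walk_edges x p)) ->
  exists u v, [/\ degA u = degA v, u != v,
    forall k, u k != 0 -> ev k \in walk_edges x p &
    forall k, v k != 0 -> ev k \in walk_edges x p].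
Proof.
move=> xp lx ep oe; set E := walk_edges x p in oe *.
have EG : {subset E <= edges G} by apply: walk_edges_edges.
have altG b : {subset every_other b E <= edges G}.
  by move=> f /every_other_sub /EG.
have supp b k : edge_monomial (every_other b E) k != 0 -> ev k \in E.
  rewrite mnmE -lt0n -has_count has_pred1; exact: every_other_sub.
exists (edge_monomial (every_other true E)), (edge_monomial (every_other false E)).
split; [| |exact: supp|exact: supp].
  apply/ffunP => z; rewrite !degA_edge_monomial //.
  by have := degree_every_other z xp; rewrite /= lx ep (negPf ep) /= addn0 => /eqP;
    rewrite eqn_add2r => /eqP.
have eE : e \in E by rewrite -has_pred1 has_count; case: (count _ _) oe.
have [k ke] := edge_ev (EG e eE).
apply/eqP => /mnmP /(_ k); rewrite !mnmE ke => ce.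
by move: oe; rewrite -count_every_other ce addnn odd_double.
Qed.

(** ** Relations of degree two *)

Lemma mdeg2E t : mdeg t = 2 -> exists i j, t = (U_(i) + U_(j))%MM.
Proof.
move=> t2; have [i ti] : exists i, t i != 0.
  apply/existsP; apply: contraT; rewrite negb_exists => /forallP h.
  have t0 : t = 0%MM by apply/mnmP => i; rewrite mnm0E; apply/eqP/negPn.
  by rewrite t0 mdeg0 in t2.
rewrite -lep1mP in ti.
have : mdeg (t - U_(i))%MM == 1.
  by have := t2; rewrite -{1}(submK ti) mdegD mdeg1; clear; lia.
by case/mdeg1P=> j /eqP e; exists j, i; rewrite -e submK.
Qed.

Lemma edge_at (f : {set V}) x : f \in edges G -> x \in f ->
  exists2 y, f = [set x; y] & x != y.
Proof.
case/edge_adj=> a [b [-> ab]]; have := adj_neq ab; rewrite !inE => nab.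
case/orP=> /eqP ->; first by exists b.
by exists a; rewrite 1?setUC // eq_sym.
Qed.

(** The edges of [t] and those of [t'] cover the same vertices and are
    distinct: starting with an edge of [t], take edges of [t'] and of [t] in
    turn. *)
Lemma quadric_four_cycle (S : pred {set V}) t t' :
  degA t = degA t' -> t != t' -> mdeg t = 2 ->
  (forall k, t k != 0 -> S (ev k)) -> (forall k, t' k != 0 -> S (ev k)) ->
  four_cycle_in S.
Proof.
move=> tt' neq t2 tS t'S; have t2' : mdeg t' = 2 by rewrite -(degA_mdeg tt').
have [i [j tE]] := mdeg2E t2; have [k [l tE']] := mdeg2E t2'.
have U0 a b : (U_(a) + U_(b))%MM a != 0 by rewrite mnmDE mnm1E eqxx.
have Si : S (ev i) by apply: tS; rewrite tE.
have Sj : S (ev j) by apply: tS; rewrite tE addmC.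
have Sk : S (ev k) by apply: t'S; rewrite tE'.
have Sl : S (ev l) by apply: t'S; rewrite tE' addmC.
have dis a : t a != 0 -> t' a != 0 -> False.
  move=> ta; apply/negP; rewrite negbK.
  exact/eqP/(quadric_disjoint degA_cancel degA_linear tt' t2 neq ta).
have ne a b : t a != 0 -> t' b != 0 -> ev a <> ev b.
  by move=> ta tb /ev_inj e; apply: (dis a) => //; rewrite e.
have ti : t i != 0 by rewrite tE.
have tj : t j != 0 by rewrite tE addmC.
have tk : t' k != 0 by rewrite tE'.
have tl : t' l != 0 by rewrite tE' addmC.
have deg x : (x \in ev i) + (x \in ev j) = (x \in ev k) + (x \in ev l).
  by move/ffunP/(_ x): tt'; rewrite tE tE' !degAD_E !degAU.
clear tt' neq t2 tS t'S t2' tE tE'.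
have [a [b [iE ab]]] := edge_adj (ev_edge i); have nab := adj_neq ab.
wlog bk : k l Sk Sl tk tl deg / b \in ev k.
  move=> W; have : (b \in ev k) || (b \in ev l).
    have := deg b; rewrite iE !inE eqxx orbT.
    by case: (b \in ev k); case: (b \in ev l).
  case/orP=> h; first exact: (W k l).
  by apply: (W l k) => // x; rewrite deg addnC.
have [c kE nbc] := edge_at (ev_edge k) bk.
have nac : a != c.
  by apply/eqP => e; apply: (ne i k ti tk); rewrite iE kE e setUC.
have cj : c \in ev j.
  have := deg c; rewrite iE kE !inE eqxx orbT (eq_sym c a) (negPf nac).
  by rewrite (eq_sym c b) (negPf nbc); case: (c \in ev j).
have [d jE ncd] := edge_at (ev_edge j) cj.
have nbd : b != d.
  by apply/eqP => e; apply: (ne j k tj tk); rewrite jE kE e setUC.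
have ak : a \in ev k = false by rewrite kE !inE (negPf nab) (negPf nac).
have [al aj] : a \in ev l /\ a \notin ev j.
  have := deg a; rewrite ak iE !inE eqxx /=.
  by case: (a \in ev j); case: (a \in ev l).
have nad : a != d by apply: contraNneq aj => ->; rewrite jE !inE eqxx orbT.
have dl : d \in ev l.
  have dk : d \in ev k = false.
    by rewrite kE !inE (eq_sym d) (negPf nbd) (eq_sym d) (negPf ncd).
  by have := deg d; rewrite dk jE !inE eqxx orbT addn1 add0n; case: (d \in ev l).
have [z lE naz] := edge_at (ev_edge l) al.
have dz : d = z by move: dl; rewrite lE !inE (eq_sym d) (negPf nad) => /eqP.
exists a, b, c, d; rewrite -iE -kE -jE; split=> //.
  by rewrite /= !inE !negb_or nab nac nad nbc nbd ncd.
by rewrite dz setUC -lE.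
Qed.

(** ** Every relation contains a four-cycle, if the cycles are good *)

Definition excess u v : rel V :=
  [rel x y | [exists k, ([set x; y] == ev k) && (v k < u k)]].

Lemma excessP u v x y : reflect (exists2 k, [set x; y] = ev k & v k < u k)
  (excess u v x y).
Proof.
apply: (iffP existsP) => [[k /andP[/eqP e h]]|[k e h]]; first by exists k.
by exists k; rewrite e eqxx.
Qed.

(** The degrees agree at [y], so an edge at [y] that is more frequent in [u] is
    compensated by one that is more frequent in [v]. *)
Lemma excess_switch u v x y : degA u = degA v -> excess u v x y ->
  exists z, excess v u y z.
Proof.
move=> /ffunP/(_ y) duv /excessP [k ek vu].
have yk : y \in ev k by rewrite -ek !inE eqxx orbT.
have [/existsP [j /andP[yj uj]]|] := boolP [exists j, (y \in ev j) && (u j < v j)].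
  have [z jE _] := edge_at (ev_edge j) yj.
  by exists z; apply/excessP; exists j.
rewrite negb_exists => /forallP no; exfalso; move: duv; apply/eqP.
rewrite neq_ltn; apply/orP; right; rewrite !degAE.
rewrite [X in X < _](bigD1 k) //= [X in _ < X](bigD1 k) //= yk !muln1 -addSn.
apply: leq_add vu _; apply: leq_sum => j _; rewrite leq_mul2r.
by have := no j; case: (y \in ev j); rewrite //= -leqNgt => ->.
Qed.

(** Colour an edge by the monomial in which it has the larger exponent.
    Opposite edges of an alternating square have the same colour, and give [a]
    and [b]. *)
Lemma conformal_quadric u v : good_cycles (adj G) -> degA u = degA v -> u != v ->
  exists a b, [/\ (a <= u)%MM, (b <= v)%MM, degA a = degA b, a != b & mdeg a = 2].
Proof.
move=> [C1 C2] uv neq.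
pose r (b : bool) := if b then excess u v else excess v u.
have rE b x y : r b x y -> exists k, [set x; y] = ev k /\
    (if b then v k < u k else u k < v k).
  by case: b => /excessP [k e h]; exists k.
have rs b : ssrbool.symmetric (r b).
  by case: b => x y; apply/excessP/excessP => -[k e h]; exists k; rewrite // setUC.
have disj b x y : r b x y -> ~~ r (~~ b) x y.
  move=> /rE [k [ek hk]]; apply/negP => /rE [j [ej hj]].
  have kj : k = j by apply: ev_inj; rewrite -ek.
  by move: hk hj; rewrite kj; case: b => /= h1 h2; move: (ltn_trans h1 h2); rewrite ltnn.
have sub b x y : r b x y -> adj G x y.
  by case/rE=> k [e _]; rewrite /adj e ev_edge.
have switch b x y : r b x y -> exists z, r (~~ b) y z.
  by case: b => /= h; apply: excess_switch h.
have sub' : subrel (relU (r true) (r false)) (adj G).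
  by move=> x y /orP[] /sub.
have good : good_cycles (relU (r true) (r false)).
  by split; [apply: even_cycles_short_sub C1|apply: odd_cycles_meet_sub C2].
have [x0 [x1 h01]] : exists x0 x1, r true x0 x1.
  have [k uvk] : exists k, u k != v k.
    apply/existsP; apply: contraNT neq; rewrite negb_exists => /forallP h.
    by apply/eqP/mnmP => k; apply/eqP/negPn.
  have [x [y [kE _]]] := edge_adj (ev_edge k).
  have [vu|uv'|e] := ltngtP (v k) (u k); last by rewrite e eqxx in uvk.
    by exists x, y; apply/excessP; exists k.
  have h : r false x y by apply/excessP; exists k.
  by have [z hz] := switch false x y h; exists y, z.
have [a [b [c [d [u4 ab bc cd da]]]]] :=
  alternating_square_exists rs disj switch good h01.
have [k1 [e1 h1]] := rE _ _ _ ab; have [k2 [e2 h2]] := rE _ _ _ bc.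
have [k3 [e3 h3]] := rE _ _ _ cd; have [k4 [e4 h4]] := rE _ _ _ da.
have [nab nac nad [nbc nbd ncd]] : [/\ a != b, a != c, a != d &
    [/\ b != c, b != d & c != d]].
  by move: u4; rewrite /= !inE !negb_or => /and4P[/and3P[-> -> ->] /andP[-> ->] -> _].
have n13 : k1 != k3.
  apply/eqP => e; move: e1; rewrite e -e3 => /set2_eq [[E _]|[E _]].
    by rewrite E eqxx in nac.
  by rewrite E eqxx in nad.
have n24 : k2 != k4.
  apply/eqP => e; move: e2; rewrite e -e4 => /set2_eq [[E _]|[E _]].
    by rewrite E eqxx in nbd.
  by rewrite E eqxx in nab.
have n12 : k1 != k2.
  by apply/eqP => e; move: h1 h2; rewrite e => x y; move: (ltn_trans x y); rewrite ltnn.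
have n14 : k1 != k4.
  by apply/eqP => e; move: h1 h4; rewrite e => x y; move: (ltn_trans x y); rewrite ltnn.
have below (w w' : 'X_{1..m}) p q : p != q -> w' p < w p -> w' q < w q ->
    (U_(p) + U_(q) <= w)%MM.
  move=> pq hp hq; apply/mnm_lepP => k; rewrite mnmDE !mnm1E.
  have [<-|_] := eqVneq p k; last first.
    by have [<-|_] := eqVneq q k => //=; apply: leq_ltn_trans hq.
  by rewrite eq_sym (negPf pq) /=; apply: leq_ltn_trans hp.
exists (U_(k1) + U_(k3))%MM, (U_(k2) + U_(k4))%MM; split.
- exact: (below u v).
- exact: (below v u).
- apply/ffunP => x; rewrite !degAD_E !degAU -e1 -e2 -e3 -e4 !inE.
  have [->|xa] := eqVneq x a.
    by rewrite (negPf nab) (negPf nac) (negPf nad).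
  have [->|xb] := eqVneq x b.
    by rewrite (negPf nbc) (negPf nbd).
  have [->|xc] := eqVneq x c; first by rewrite (negPf ncd).
  by rewrite /= orbF.
- apply/eqP => /mnmP /(_ k1); rewrite !mnmDE !mnm1E eqxx.
  by rewrite (eq_sym k2) (negPf n12) (eq_sym k4) (negPf n14).
by rewrite mdegD !mdeg1.
Qed.

End EdgeMonomials.

(** * Robustness and good cycles *)

(** A nontrivial relation on the edges of a walk brings along a quadric
    relation on some of these edges, that is, a four-cycle. Conversely, good
    cycles make every relation contain a quadric. *)
Theorem robust_quadrics_iff_good_cycles (K : fieldType) (V : finType) (G : graph V) :
  connected G ->
  (generalized_robust (@toric_ideal K V G) /\
   generated_by_quadrics (@toric_ideal K V G)) <-> good_cycles (adj G).
Proof.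
move=> cG; split=> [[gr gq]|gc].
  apply: good_cycles_of_walks => // x w e xw lx ew oe.
  have [u [v [uv neq uS vS]]] := closed_walk_relation xw lx ew oe.
  have [t [t' [tt' nt t2 [tS t'S]]]] :=
    robust_quadric_in_support (@degA_mdeg _ G) (@degA_add _ G) (@degA_linear _ G)
      gr gq neq uv uS vS.
  exact: quadric_four_cycle tt' nt t2 tS t'S.
have conf u v (uv : degA u = degA v) neq := conformal_quadric gc uv neq.
split.
  exact: (conformal_robust (@degA_mdeg _ G) (@degA_add _ G) (@degA_cancel _ G)
    (@degA_linear _ G) conf).
exact: (conformal_generated K (@degA_mdeg _ G) (@degA_add _ G) (@degA_cancel _ G)
   conf).
Qed.

Theorem theorem1p1 (K : fieldType) (V : finType) (G : graph V)
    (G_connected : connected G) (G_has_edge : edges G != set0) :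
  (generalized_robust (@toric_ideal K V G) /\
   generated_by_quadrics (@toric_ideal K V G))
  <->
  [/\ #|[set B | is_block G B && ~~ bipartite B]| <= 1,
      forall B, is_block G B -> ~~ bipartite B ->
        [\/ is_complete 4 B,
            exists l e, is_K2_plus l e B,
            exists r s, is_double_K2 r s B |
            is_necklace_K2 B] &
      forall B, is_block G B -> bipartite B ->
        (exists l, is_K2 l B) \/ is_cut_edge_block B].
Proof.
apply: iff_trans (robust_quadrics_iff_good_cycles K G_connected) _.
exact: good_cycles_iff_blocks.
Qed.
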